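(* Let $(M,\boldsymbol p)$ be an $n$-dimensional projective manifold equipped with a solution $\zeta^{ab}\in\Gamma(\mathcal E^{(ab)}(-2))$ of the metrizability equation such that $L(\zeta)$ has rank $n+1$ everywhere, and let $\tau:=\mathbf{det}(\zeta)$. If $L(\zeta)$ is definite, then the degeneracy locus $\mathcal D(\zeta)$ is empty and $(M,\boldsymbol p,\zeta)$ is a Riemannian manifold with inverse metric $g^{-1}=\operatorname{sgn}(\tau)\,\tau\,\zeta$. If $L(\zeta)$ has signature $(p+1,q+1)$, with $p,q\ge 0$, then $\mathcal D(\zeta)$ is either empty or is a smoothly embedded separating hypersurface such that the following hold: (i) $M$ is stratified by the strict signature of $\zeta$ as a (density weighted) bilinear form on $T^*M$, with the partition of $M$ given by $M=\coprod_{i\in\{+,0,-\}}M_i$, where $\zeta$ has signature $(p+1,q)$, $(p,q+1)$ and $(p,q,1)$ on $M_+$, $M_-$ and $M_0$, respectively. (ii) $M_0$ has a conformal structure of signature $(p,q)$. (iii) On $M_\pm$, $\zeta$ induces a pseudo-Riemannian metric $g_\pm$, of the same signature as $\zeta$, with inverse $g_\pm^{-1}=\operatorname{sgn}(\tau)\,\tau\,\zeta|_{M_\pm}$. (iv) If $M$ is closed, then $(M\setminus M_\mp,\boldsymbol p)$ are order $2$ projective compactifications of $(M_\pm,g_\pm)$, with boundary $M_0$.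
   Context: Everything is smooth, $n\ge 2$, affine connections are torsion free, and indices are abstract indices. A projective structure $\boldsymbol p$ on $M$ is an equivalence class of torsion-free affine connections with the same unparametrized geodesics; $\bar\nabla,\nabla\in\boldsymbol p$ are related by $\bar\nabla_aY^b=\nabla_aY^b+\Upsilon_aY^b+\Upsilon_cY^c\delta^b_a$ for some 1-form $\Upsilon$. A projective manifold is a pair $(M,\boldsymbol p)$. $\mathcal E(1)$ is the positive $(2n+2)$-th root of the naturally oriented line bundle $(\Lambda^nTM)^2$, $\mathcal E(w):=\mathcal E(1)^w$ (oriented, so sections have a pointwise sign), $\mathcal E^a=TM$, $\mathcal E_a=T^*M$, $\mathcal B(w):=\mathcal B\otimes\mathcal E(w)$. In formulas $\nabla\in\boldsymbol p$ is special, i.e. preserves a volume density; then $P_{ab}=\frac1{n-1}\mathrm{Ric}_{ab}$, where $\mathrm{Ric}_{bd}=R_{ab}{}^a{}_d$ and $(\nabla_a\nabla_b-\nabla_b\nabla_a)v^c=R_{ab}{}^c{}_dv^d$. The metrizability equation on $\zeta^{ab}\in\Gamma(\mathcal E^{(ab)}(-2))$ is the projectively invariant equation $\nabla_c\zeta^{ab}-\frac1{n+1}\delta^a_c\nabla_d\zeta^{db}-\frac1{n+1}\delta^b_c\nabla_d\zeta^{ad}=0$. The standard cotractor bundle is $\mathcal T^*=J^1\mathcal E(1)$ (rank $n+1$); $\nabla\in\boldsymbol p$ gives a splitting $\mathcal T^*\cong\mathcal E(1)\oplus\mathcal E_a(1)$. For $\zeta\in\Gamma(\mathcal E^{(ab)}(-2))$,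 $L(\zeta)$ is the projectively invariant section of $S^2\mathcal T$ (symmetric bilinear form on $\mathcal T^*$) given in this splitting by $L(\zeta)\big((\xi,\mu),(\xi',\mu')\big)=\zeta^{ab}\mu_a\mu'_b+\lambda^a(\mu_a\xi'+\mu'_a\xi)+\rho\,\xi\xi'$, with $\lambda^a=-\frac1{n+1}\nabla_b\zeta^{ab}$, $\rho=\frac1nP_{ab}\zeta^{ab}+\frac1{n(n+1)}\nabla_a\nabla_b\zeta^{ab}$. $\mathbf{det}(\zeta):=\epsilon^2_{a_1\cdots a_nb_1\cdots b_n}\zeta^{a_1b_1}\cdots\zeta^{a_nb_n}\in\Gamma(\mathcal E(2))$, where $\epsilon^2$ is the canonical section of $\mathcal E_{[a_1\cdots a_n][b_1\cdots b_n]}(2n+2)$ identifying $\mathcal E^{[a_1\cdots a_n][b_1\cdots b_n]}$ with $\mathcal E(2n+2)$. The degeneracy locus $\mathcal D(\zeta)$ is the set of points where $\zeta$ has rank less than $n$. The signature $(p,q,r)$ of a symmetric bilinear form lists the numbers of positive, negative and zero eigenvalues; $r=0$ is omitted. ''Riemannian'' here allows a negative definite metric: if $L(\zeta)$ is negative definite then so is $g$. A hypersurface is a smoothly embedded codimension-1 submanifold; it is separating if it is the zero locus $M_0$ in a partition $M=M_-\sqcup M_0\sqcup M_+$ by the strict sign of a globally defined density whose derivative is nowhere zero along $M_0$; the pieces need not be connected. The conformal structure on $M_0=\mathcal D(\zeta)$ is the one induced by the restriction of $\zeta$ to $T^*M_0$. Closed manifold means compact without boundary. On a manifold $\overline N$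 with boundary and interior $N$, an affine connection $\nabla$ on $N$ is projectively compact of order $\alpha>0$ if near each boundary point there is a local defining function $r\ge 0$ for the boundary (zero set the boundary, $dr\ne 0$ there) such that $\hat\nabla_\mu\xi=\nabla_\mu\xi+\frac{dr(\mu)}{\alpha r}\xi+\frac{dr(\xi)}{\alpha r}\mu$ is smooth up to the boundary for all vector fields $\mu,\xi$ smooth up to the boundary. $(\overline N,\boldsymbol p)$ is then an order $\alpha$ projective compactification of $(N,\nabla)$, where $\boldsymbol p$ restricts to $[\nabla]$ on $N$; for a metric $g$ on $N$ one takes $\nabla$ to be its Levi-Civita connection. *)

(* Defs.v *)
(* Tensor fields, densities and connections on a manifold                      *)
(* are families of component functions indexed by the charts of the maximal    *)
(* atlas, subject to a transformation law.  A component function takes chart   *)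
(* coordinates as argument and is meaningful only on the relevant part of the  *)
(* image of the chart.                                                         *)
From HB Require Import structures.
From mathcomp Require Import all_boot all_order all_algebra perm.
From mathcomp Require Import all_classical all_reals topology normedtype derive exp.

Set Implicit Arguments.
Unset Strict Implicit.
Unset Printing Implicit Defensive.
Import Order.TTheory GRing.Theory Num.Theory.
Import numFieldNormedType.Exports.

Local Open Scope classical_set_scope.
Local Open Scope ring_scope.

Section Calculus.
Context {R : realType}.

(* For U open in a finite-dimensional space this is the usual C^k, phrased     *)
(* with all directional derivatives instead of the partial derivatives only.   *)
Fixpoint Ck (V W : normedModType R) (k : nat) (U : set V) (f : V -> W) : Prop :=
  (forall x, U x -> {for x, continuous f}) /\
  (if k is k'.+1 then
     forall v : V, (forall x, U x -> derivable f x v) /\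
                   Ck k' U (fun x => 'D_v f x)
   else True).

Definition smooth (V W : normedModType R) (U : set V) (f : V -> W) : Prop :=
  forall k, Ck k U f.

(* Smoothness on a set that need not be open: local smooth extensions exist.   *)
Definition smooth_upto (V W : normedModType R) (B : set V) (f : V -> W) : Prop :=
  forall x, B x -> exists (U : set V) (F : V -> W),
    [/\ open U, U x, smooth U F & forall y, B y -> U y -> F y = f y].

Definition pd (n : nat) (i : 'I_n) (f : 'rV[R]_n -> R) (x : 'rV[R]_n) : R :=
  'D_(delta_mx 0 i) f x.

End Calculus.

Section LinearAlgebra.
Context {R : realType}.

(* Numbers of positive, negative and zero eigenvalues, with multiplicity, of   *)
(* a symmetric matrix.                                                         *)
Definition signature (m : nat) (S : 'M[R]_m) (p q r : nat) : Prop :=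
  exists s : seq R, [/\ char_poly S = \prod_(a <- s) ('X - a%:P),
    count (fun a => 0 < a) s = p, count (fun a => a < 0) s = q
    & count (fun a => a == 0) s = r].

Definition pos_definite (m : nat) (S : 'M[R]_m) : Prop :=
  forall v : 'rV[R]_m, v != 0 -> 0 < (v *m S *m v^T) 0 0.

Definition neg_definite (m : nat) (S : 'M[R]_m) : Prop :=
  forall v : 'rV[R]_m, v != 0 -> (v *m S *m v^T) 0 0 < 0.

End LinearAlgebra.

Record chart (R : realType) (n : nat) (M : topologicalType) := Chart {
  dom : set M;
  cmap : M -> 'rV[R]_n;
  cinv : 'rV[R]_n -> M;
  dom_open : open dom;
  image_open : open (cmap @` dom);
  cmapK : forall x, dom x -> cinv (cmap x) = x;
  cmap_continuous : forall x, dom x -> {for x, continuous cmap};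
  cinv_continuous : forall u, (cmap @` dom) u -> {for u, continuous cinv} }.

Section Charts.
Context {R : realType} {n : nat} {M : topologicalType}.
Implicit Types c : chart R n M.

Definition coords c (N : set M) : set 'rV[R]_n := cmap c @` (dom c `&` N).

Definition trans c c' : 'rV[R]_n -> 'rV[R]_n := cmap c' \o cinv c.

(* Entry (a, k) is the derivative of the k-th coordinate of c' along the a-th  *)
(* coordinate of c.                                                            *)
Definition jac c c' (u : 'rV[R]_n) : 'M[R]_n := 'J (trans c c') u.

Definition compatible c c' : Prop :=
  smooth (coords c (dom c')) (trans c c') /\
  smooth (coords c' (dom c)) (trans c' c).

Definition smooth_manifold (A : set (chart R n M)) : Prop :=
  [/\ hausdorff_space M, @second_countable M,
      (forall x, exists2 c, A c & dom c x),
      (forall c c', A c -> A c' -> compatible c c')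
    & (forall c, (forall c', A c' -> compatible c c') -> A c)].

End Charts.

Section Manifold.
Context {R : realType} {n : nat} {M : topologicalType}.
Variable A : set (chart R n M).
Implicit Types (c : chart R n M) (N : set M) (x : M) (u : 'rV[R]_n).

Definition density_field := chart R n M -> 'rV[R]_n -> R.
Definition vector_field := chart R n M -> 'rV[R]_n -> 'rV[R]_n.
Definition matrix_field := chart R n M -> 'rV[R]_n -> 'M[R]_n.

(* G c u k i j is the Christoffel symbol with upper index k of the derivative  *)
(* of the j-th coordinate field along the i-th one.                            *)
Definition connection_field :=
  chart R n M -> 'rV[R]_n -> 'I_n -> 'I_n -> 'I_n -> R.

(* The square of the top exterior power of TM has transition factor det^2, so  *)
(* its positive (2n+2)-th root, raised to the power w, has the following one.  *)
Definition weight_factor (w : R) c c' u : R :=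
  ((\det (jac c c' u)) ^+ 2) `^ (w / (2 * n + 2)%N%:R).

(* s is a smooth section of E(w).                                              *)
Definition density (w : R) (s : density_field) : Prop :=
  (forall c, A c -> smooth (coords c setT) (s c)) /\
  (forall c c' u, A c -> A c' -> coords c (dom c') u ->
     s c' (trans c c' u) = weight_factor w c c' u * s c u).

(* z is a smooth section of E^(ab)(w).                                         *)
Definition sym_bivector_density (w : R) (z : matrix_field) : Prop :=
  [/\ (forall c, A c -> forall i j, smooth (coords c setT) (fun u => z c u i j)),
      (forall c u, A c -> coords c setT u -> (z c u)^T = z c u)
    & (forall c c' u, A c -> A c' -> coords c (dom c') u ->
         z c' (trans c c' u) =
         weight_factor w c c' u *: ((jac c c' u)^T *m z c u *m jac c c' u))].

Definition pseudo_metric N (g : matrix_field) : Prop :=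
  [/\ open N,
      (forall c, A c -> forall i j, smooth (coords c N) (fun u => g c u i j)),
      (forall c u, A c -> coords c N u ->
         (g c u)^T = g c u /\ g c u \in unitmx)
    & (forall c c' u, A c -> A c' -> coords c (dom c' `&` N) u ->
         g c u = jac c c' u *m g c' (trans c c' u) *m (jac c c' u)^T)].

Definition torsion_free_connection N (G : connection_field) : Prop :=
  [/\ (forall c, A c -> forall k i j, smooth (coords c N) (fun u => G c u k i j)),
      (forall c u, A c -> coords c N u -> forall k i j, G c u k i j = G c u k j i)
    & (forall c c' u, A c -> A c' -> coords c (dom c' `&` N) u ->
         forall k a b,
         \sum_(d < n) G c u d a b * jac c c' u d k =
         pd a (fun v => jac c c' v b k) u +
         \sum_(i < n) \sum_(j < n)
            G c' (trans c c' u) k i j * jac c c' u a i * jac c c' u b j)].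

Definition regular_curve N (a b : R) (gamma : R -> M) : Prop :=
  (forall t, a < t < b -> N (gamma t) /\ {for t, continuous gamma}) /\
  (forall c, A c ->
     smooth [set t | a < t < b /\ dom c (gamma t)]
            (fun t => cmap c (gamma t)) /\
     (forall t, a < t < b -> dom c (gamma t) ->
        derive1 (fun s => cmap c (gamma s)) t != 0)).

(* The acceleration is everywhere proportional to the velocity, i.e. gamma can *)
(* be reparametrized to a geodesic.                                            *)
Definition unparametrized_geodesic (G : connection_field) (a b : R)
    (gamma : R -> M) : Prop :=
  forall c t, A c -> a < t < b -> dom c (gamma t) ->
    let x' := derive1 (fun s => cmap c (gamma s)) in
    exists f : R, forall k,
      (derive1 x' t) 0 k +
      \sum_(i < n) \sum_(j < n)
         G c (cmap c (gamma t)) k i j * (x' t) 0 i * (x' t) 0 j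
      = f * (x' t) 0 k.

Definition proj_equiv N (G G' : connection_field) : Prop :=
  forall a b gamma, regular_curve N a b gamma ->
    (unparametrized_geodesic G a b gamma <->
     unparametrized_geodesic G' a b gamma).

Definition projective_structure (P : set connection_field) : Prop :=
  P !=set0 /\
  (forall G, P G -> torsion_free_connection setT G /\
     (forall G', P G' <->
        torsion_free_connection setT G' /\ proj_equiv setT G G')).

Section CovariantDerivative.
Variable G : connection_field.

(* Action of the connection on the weight of a density; as E(2n+2) is the      *)
(* square of the top exterior power of TM, E(w) contributes w/(n+1) times the  *)
(* trace of the connection.                                                    *)
Definition weight_term (w : R) c u (a : 'I_n) : R :=
  w / n.+1%:R * \sum_(d < n) G c u d a d.

Definition cov_density (w : R) (s : density_field) c u (a : 'I_n) : R :=
  pd a (s c) u + weight_term w c u a * s c u.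

Definition cov_vector (w : R) (Y : vector_field) c u (a b : 'I_n) : R :=
  pd a (fun v => Y c v 0 b) u + \sum_(d < n) G c u b a d * Y c u 0 d
  + weight_term w c u a * Y c u 0 b.

(* cov_bivector w z c u e a b is nabla_e z^{ab}.                               *)
Definition cov_bivector (w : R) (z : matrix_field) c u (e a b : 'I_n) : R :=
  pd e (fun v => z c v a b) u
  + \sum_(d < n) G c u a e d * z c u d b
  + \sum_(d < n) G c u b e d * z c u a d
  + weight_term w c u e * z c u a b.

(* Preserves a volume density, i.e. a positive section of E(-n-1).             *)
Definition special : Prop :=
  exists v : density_field, [/\ density (- n.+1%:R) v,
    (forall c u, A c -> coords c setT u -> 0 < v c u)
  & (forall c u, A c -> coords c setT u ->
       forall a, cov_density (- n.+1%:R) v c u a = 0)].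

(* R_{ab}^e_d with (nabla_a nabla_b - nabla_b nabla_a) v^e = R_{ab}^e_d v^d.   *)
Definition curvature c u (a b e d : 'I_n) : R :=
  pd a (fun v => G c v e b d) u - pd b (fun v => G c v e a d) u
  + \sum_(f < n) (G c u e a f * G c u f b d - G c u e b f * G c u f a d).

Definition ricci c u (b d : 'I_n) : R := \sum_(a < n) curvature c u a b a d.

(* This formula presupposes that G is special.                                 *)
Definition schouten c u (a b : 'I_n) : R := n.-1%:R^-1 * ricci c u a b.

Variable zeta : matrix_field.

Definition divergence : vector_field := fun c u =>
  \row_(a < n) \sum_(b < n) cov_bivector (-2) zeta c u b a b.

Definition metrizability : Prop :=
  forall c u, A c -> coords c setT u -> forall e a b : 'I_n,
    cov_bivector (-2) zeta c u e a b
    - n.+1%:R^-1 * (a == e)%:R *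
        (\sum_(d < n) cov_bivector (-2) zeta c u d d b)
    - n.+1%:R^-1 * (b == e)%:R *
        (\sum_(d < n) cov_bivector (-2) zeta c u d a d) = 0.

Definition tractor_lambda : vector_field := fun c u =>
  - n.+1%:R^-1 *: divergence c u.

Definition tractor_rho : density_field := fun c u =>
  n%:R^-1 * (\sum_(a < n) \sum_(b < n) schouten c u a b * zeta c u a b)
  + (n%:R * n.+1%:R)^-1 * \sum_(a < n) cov_vector (-2) divergence c u a a.

(* Gram matrix of L(zeta) in the splitting (xi, mu) of the cotractor bundle    *)
(* given by the (special) connection G.                                        *)
Definition tractor_form c u : 'M[R]_(1 + n) :=
  block_mx (tractor_rho c u)%:M (tractor_lambda c u)
           (tractor_lambda c u)^T (zeta c u).

End CovariantDerivative.

(* Contraction of zeta^{a_1 b_1} ... zeta^{a_n b_n} with epsilon^2, whose      *)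
(* components in any chart are products of two Levi-Civita symbols; this is a  *)
(* section of E(2).                                                            *)
Definition det_density (zeta : matrix_field) : density_field := fun c u =>
  \sum_(s : 'S_n) \sum_(t : 'S_n)
    (-1) ^+ (odd_perm s) * (-1) ^+ (odd_perm t) *
    \prod_(i < n) zeta c u (s i) (t i).

Definition degeneracy_locus (zeta : matrix_field) : set M :=
  [set x | forall c, A c -> dom c x -> (\rank (zeta c (cmap c x)) < n)%N].

Definition signature_locus (zeta : matrix_field) (p q r : nat) : set M :=
  [set x | forall c, A c -> dom c x -> signature (zeta c (cmap c x)) p q r].

(* sgn(tau) tau zeta, a section of E^(ab).                                     *)
Definition induced_inverse_metric (zeta : matrix_field) : matrix_field :=
  fun c u => (Num.sg (det_density zeta c u) * det_density zeta c u) *: zeta c u.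

Definition inverse_metric_on N (g h : matrix_field) : Prop :=
  forall c u, A c -> coords c N u -> g c u *m h c u = 1%:M.

Definition levi_civita N (g : matrix_field) (G : connection_field) : Prop :=
  torsion_free_connection N G /\
  (forall c u, A c -> coords c N u -> forall k i j,
     pd k (fun v => g c v i j) u =
     \sum_(d < n) (G c u d k i * g c u d j + G c u d k j * g c u i d)).

(* (c, i) is a chart in which the set S is given by x^i = 0.                   *)
Definition slice_chart (S : set M) c (i : 'I_n) : Prop :=
  A c /\ (forall x, dom c x -> (S x <-> cmap c x 0 i = 0)).

Definition embedded_hypersurface (S : set M) : Prop :=
  forall x, S x -> exists c i, slice_chart S c i /\ dom c x.

Definition separates (Mm M0 Mp : set M) : Prop :=
  exists (w : R) (s : density_field), density w s /\
    (forall c x, A c -> dom c x ->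
      [/\ Mm x <-> s c (cmap c x) < 0, M0 x <-> s c (cmap c x) = 0,
          Mp x <-> 0 < s c (cmap c x)
        & M0 x -> exists i, pd i (s c) (cmap c x) != 0]).

(* Conformal structure on an embedded hypersurface S: local representative     *)
(* metrics h c i in the slice charts (c, i), with respect to the coordinates   *)
(* other than x^i, which agree on overlaps up to positive factors.             *)
Definition conformal_structure (S : set M) (p q : nat)
    (h : chart R n M -> 'I_n -> 'rV[R]_n -> 'M[R]_n.-1) : Prop :=
  [/\ (forall c i, slice_chart S c i -> forall a b,
         smooth_upto (coords c S) (fun u => h c i u a b)),
      (forall c i, slice_chart S c i -> forall u, coords c S u ->
         (h c i u)^T = h c i u /\ signature (h c i u) p q 0)
    & (forall c i c' i', slice_chart S c i -> slice_chart S c' i' ->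
         forall u, coords c (dom c' `&` S) u ->
         let T := row' i (col' i' (jac c c' u)) in
         exists2 k : R, 0 < k &
           h c i u = k *: (T *m h c' i' (trans c c' u) *m T^T))].

(* The conormal dx^i of S lies in the radical of zeta, so that zeta descends   *)
(* to T*S = T*M|_S / conormal, where it is inverse to h up to positive scale.  *)
Definition conformal_structure_induced_by (S : set M) (zeta : matrix_field)
    (h : chart R n M -> 'I_n -> 'rV[R]_n -> 'M[R]_n.-1) : Prop :=
  forall c i, slice_chart S c i -> forall u, coords c S u ->
    row i (zeta c u) = 0 /\
    (exists2 k : R, 0 < k &
       h c i u *m row' i (col' i (zeta c u)) = k%:M).

(* Nbar, with the smooth structure of M, is a manifold with interior N and     *)
(* boundary B: the charts below are half-space charts.                         *)
Definition domain_with_boundary (Nbar N B : set M) : Prop :=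
  [/\ open N, N `&` B = set0, N `|` B = Nbar
    & (forall x, B x -> exists c i, [/\ A c, dom c x
        & forall y, dom c y -> (Nbar y <-> 0 <= cmap c y 0 i) /\
                               (B y <-> cmap c y 0 i = 0)])].

Definition projectively_compact (alpha : R) (Nbar N B : set M)
    (G : connection_field) : Prop :=
  forall x, B x -> exists c (r : 'rV[R]_n -> R),
    [/\ A c, dom c x, smooth (coords c setT) r,
        (forall y, dom c y -> Nbar y -> 0 <= r (cmap c y) /\
           (r (cmap c y) = 0 <-> B y) /\
           (B y -> exists i, pd i r (cmap c y) != 0))
      & (forall mu xi : 'rV[R]_n -> 'rV[R]_n,
           smooth_upto (coords c Nbar) mu -> smooth_upto (coords c Nbar) xi ->
           exists2 eta : 'rV[R]_n -> 'rV[R]_n, smooth_upto (coords c Nbar) eta &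
             forall u, coords c N u -> forall k,
             eta u 0 k =
               \sum_(a < n) mu u 0 a *
                 (pd a (fun v => xi v 0 k) u +
                  \sum_(b < n) G c u k a b * xi u 0 b)
               + 'D_(mu u) r u / (alpha * r u) * xi u 0 k
               + 'D_(xi u) r u / (alpha * r u) * mu u 0 k)].

Definition projective_compactification (alpha : R) (P : set connection_field)
    (Nbar N B : set M) (g : matrix_field) : Prop :=
  [/\ compact Nbar, domain_with_boundary Nbar N B
    & exists G : connection_field, [/\ levi_civita N g G,
        (forall G', P G' -> proj_equiv N G' G)
      & projectively_compact alpha Nbar N B G]].

End Manifold.

(* Main.v *)
(* Write Z for zeta and lam for the middle slot of L(Z), and let V be a volume
   density preserved by nabla. The metrizability equation says that nabla_c Z^ab
   is the pure trace - delta_c^a lam^b - delta_c^b lam^a; hence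
   nabla_c det Z = - 2 (lam adj Z)_c.
   Where det Z <> 0, the projective change of nabla by Y = lam Z^-1 kills nabla Z
   and is the Levi-Civita connection of (|tau| Z)^-1. It is a connection because
   Y = - d log |F| / (2 (n + 1)) for the function F = det(Z)^(n+1) V^2.
   Where det Z = 0, expanding the bordered determinant gives
   det L(Z) = - lam adj(Z) lam^T, so d det Z = - 2 lam adj(Z) does not vanish;
   it spans the radical of Z because Z adj(Z) = 0. So the degeneracy locus is a
   hypersurface whose conormal is the radical of Z. The signature of Z is
   controlled by that of L(Z), of which Z is the restriction to a hyperplane.
   Finally, for r = +det Z or r = -det Z, the form Y + dr / (2 r) extends smoothly
   across the locus: this is projective compactness of order 2. *)
Require Import Defs.
From HB Require Import structures.
From mathcomp Require Import all_boot all_order all_algebra perm.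
From mathcomp Require Import all_classical all_reals topology normedtype derive exp.
From mathcomp Require Import landau ring lra zify.
From mathcomp Require Import complex spectral sesquilinear mxpoly.

Set Implicit Arguments.
Unset Strict Implicit.
Unset Printing Implicit Defensive.
Import Order.TTheory GRing.Theory Num.Theory.
Import numFieldNormedType.Exports.

Local Open Scope classical_set_scope.
Local Open Scope ring_scope.

(** * Calculus on open sets *)

(** The formula Y = - d(det Z) / (2 det Z) - tr(Gamma) / (n + 1), with Gamma the connection matrices
    of nabla, isolates the pole of Y. For r = eps det Z with eps constant, Y + dr / (2 r) is exactly
    - tr(Gamma) / (n + 1), which has no denominator; the order 2 is the 2 of this formula. Neither
    summand of Y is a 1-form by itself, and this is the reason for F. A nondegenerate Z with q
    negative eigenvalues has a determinant of sign (-1)^q. So M_+ and M_- are the loci where (-1)^q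
    det Z is positive and negative, and eps = (-1)^q or - (-1)^q lets one argument serve both sides.
    The transition factor of det Z is positive, hence these signs do not depend on the chart.
    Inertia is measured by dimensions of definite and of nonpositive subspaces. Comparing L(Z) with
    its restriction to the hyperplane leaves exactly three signatures for Z, told apart by the sign
    of det Z. Fields smooth up to the boundary are known only through local extensions. Their
    derivatives at the boundary are well defined because dr != 0 there makes the open side dense. *)

Section CkTheory.
Context {R : realType}.
Implicit Types V W : normedModType R.

Lemma CkS V W k (U : set V) (f : V -> W) : Ck k.+1 U f -> Ck k U f.
Proof.
elim: k f => [|k IH] f /= [cf Hf]; first by split.
split=> // v; have [df Df] := Hf v; split=> //; exact: IH.
Qed.

Lemma Ck_cont V W k (U : set V) (f : V -> W) x :
  Ck k U f -> U x -> {for x, continuous f}.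
Proof. by case: k => [|k] [cf _] Ux; exact: cf. Qed.

Lemma Ck_sub V W k (U U' : set V) (f : V -> W) :
  U' `<=` U -> Ck k U f -> Ck k U' f.
Proof.
move=> sU; elim: k f => [|k IH] f /= [cf Hf]; split=> //.
- by move=> x /sU; exact: cf.
- by move=> x /sU; exact: cf.
- move=> v; have [df Df] := Hf v; split; last exact: IH.
  by move=> x /sU; exact: df.
Qed.

Lemma eq_near_open V W (U : set V) (f g : V -> W) x : open U -> U x ->
  (forall y, U y -> f y = g y) -> {near x, f =1 g}.
Proof.
move=> oU Ux fg; have : \near x, U x by exact: open_nbhs_nbhs.
by apply: filterS.
Qed.

Lemma eq_Ck V W k (U : set V) (f g : V -> W) : open U ->
  (forall x, U x -> f x = g x) -> Ck k U f -> Ck k U g.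
Proof.
move=> oU; elim: k f g => [|k IH] f g fg [cf Hf]; split.
- move=> x Ux; have nfg := eq_near_open oU Ux fg.
  rewrite /prop_for /continuous_at -(fg x Ux).
  by apply: cvg_trans (cf x Ux); apply: near_eq_cvg; exact: nfg.
- by [].
- move=> x Ux; have nfg := eq_near_open oU Ux fg.
  rewrite /prop_for /continuous_at -(fg x Ux).
  by apply: cvg_trans (cf x Ux); apply: near_eq_cvg; exact: nfg.
- move=> v; have [df Df] := Hf v; split.
    move=> x Ux; apply: near_eq_derivable (df x Ux).
    exact: eq_near_open oU Ux fg.
  apply: IH Df => x Ux; apply: near_eq_derive.
  exact: eq_near_open oU Ux fg.
Qed.

(** Applied to sgn(f) f, which is only locally a constant multiple of f. *)
Lemma Ck_local V W k (U : set V) (f : V -> W) :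
  (forall x, U x -> exists2 U' : set V, open U' /\ U' x & Ck k U' f) ->
  Ck k U f.
Proof.
elim: k f => [|k IH] f H; split=> //.
- by move=> x /H[U' [_ U'x] [cf _]]; exact: cf.
- by move=> x /H[U' [_ U'x] [cf _]]; exact: cf.
- move=> v; split.
    by move=> x /H[U' [_ U'x] [_ /(_ v)[df _]]]; exact: df.
  apply: IH => x /H[U' oU' [_ /(_ v)[_ Df]]]; by exists U'.
Qed.

Lemma Ck_cst V W k (U : set V) (a : W) : Ck k U (cst a : V -> W).
Proof.
elim: k a => [|k IH] a; split=> //.
- by move=> x _; exact: cvg_cst.
- by move=> x _; exact: cvg_cst.
- move=> v; split; first by move=> x _; exact: derivable_cst.
  suff -> : (fun x : V => 'D_v (cst a) x) = cst 0 by exact: IH.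
  by apply/funext => x; rewrite derive_cst.
Qed.

Lemma CkD V W k (U : set V) (f g : V -> W) : open U ->
  Ck k U f -> Ck k U g -> Ck k U (fun x => f x + g x).
Proof.
move=> oU; elim: k f g => [|k IH] f g [cf Hf] [cg Hg]; split=> //.
- by move=> x Ux; apply: cvgD; [exact: cf|exact: cg].
- by move=> x Ux; apply: cvgD; [exact: cf|exact: cg].
- move=> v; have [df Df] := Hf v; have [dg Dg] := Hg v; split.
    by move=> x Ux; apply: derivableD; [exact: df|exact: dg].
  refine (eq_Ck oU _ (IH _ _ Df Dg)) => x Ux /=.
  by rewrite deriveD//; [exact: df|exact: dg].
Qed.

Lemma CkZ V W k (U : set V) (f : V -> W) (a : R) : open U ->
  Ck k U f -> Ck k U (fun x => a *: f x).
Proof.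
move=> oU; elim: k f => [|k IH] f [cf Hf]; split=> //.
- by move=> x Ux; apply: cvgZl_tmp (cf x Ux).
- by move=> x Ux; apply: cvgZl_tmp (cf x Ux).
- move=> v; have [df Df] := Hf v; split.
    by move=> x Ux; apply: derivableZ (df x Ux).
  refine (eq_Ck oU _ (IH _ Df)) => x Ux /=.
  by rewrite deriveZ//; exact: df.
Qed.

Lemma CkM V k (U : set V) (f g : V -> R) : open U ->
  Ck k U f -> Ck k U g -> Ck k U (fun x => f x * g x).
Proof.
move=> oU; elim: k f g => [|k IH] f g [cf Hf] [cg Hg]; split=> //.
- by move=> x Ux; apply: cvgM; [exact: cf|exact: cg].
- by move=> x Ux; apply: cvgM; [exact: cf|exact: cg].
- move=> v; have [df Df] := Hf v; have [dg Dg] := Hg v; split.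
    by move=> x Ux; apply: derivableM; [exact: df|exact: dg].
  have H1 : Ck k U f by apply: CkS; split.
  have H2 : Ck k U g by apply: CkS; split.
  refine (eq_Ck oU _ (CkD oU (IH _ _ H1 Dg) (IH _ _ H2 Df))) => x Ux /=.
  by rewrite deriveM//; [exact: df|exact: dg].
Qed.

(** The derivative - f^-2 f' involves 1/f at one order less, so the induction closes. *)
Lemma CkV V k (U : set V) (f : V -> R) : open U ->
  (forall x, U x -> f x != 0) -> Ck k U f -> Ck k U (fun x => (f x)^-1).
Proof.
move=> oU f0; elim: k f f0 => [|k IH] f f0 [cf Hf]; split=> //.
- by move=> x Ux; apply: cvgV; [exact: f0|exact: cf].
- by move=> x Ux; apply: cvgV; [exact: f0|exact: cf].
- move=> v; have [df Df] := Hf v; split.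
    by move=> x Ux; apply: derivableV; [exact: f0|exact: df].
  have H1 : Ck k U f by apply: CkS; split.
  have H2 := IH _ f0 H1.
  refine (eq_Ck oU _ (CkZ (-1) oU (CkM oU (CkM oU H2 H2) Df))) => x Ux /=.
  rewrite deriveV; [|exact: f0|exact: df].
  by rewrite /GRing.scale /= mulN1r mulNr -exprVn expr2.
Qed.

Lemma Ck_sum V W k (U : set V) (I : Type) (r : seq I) (P : pred I) (f : I -> V -> W) :
  open U -> (forall i, Ck k U (f i)) -> Ck k U (fun x => \sum_(i <- r | P i) f i x).
Proof.
move=> oU Hf; elim: r => [|i r IH].
  refine (eq_Ck oU _ (Ck_cst k U (0 : W))) => x _; by rewrite big_nil.
case Pi : (P i).
  refine (eq_Ck oU _ (CkD oU (Hf i) IH)) => x _; by rewrite big_cons Pi.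
refine (eq_Ck oU _ IH) => x _; by rewrite big_cons Pi.
Qed.

Lemma Ck_prod V k (U : set V) (I : Type) (r : seq I) (P : pred I) (f : I -> V -> R) :
  open U -> (forall i, Ck k U (f i)) -> Ck k U (fun x => \prod_(i <- r | P i) f i x).
Proof.
move=> oU Hf; elim: r => [|i r IH].
  refine (eq_Ck oU _ (Ck_cst k U (1 : R))) => x _; by rewrite big_nil.
case Pi : (P i).
  refine (eq_Ck oU _ (CkM oU (Hf i) IH)) => x _; by rewrite big_cons Pi.
refine (eq_Ck oU _ IH) => x _; by rewrite big_cons Pi.
Qed.

Lemma cvg_mxP V m p (f : V -> 'M[R]_(m, p)) x :
  {for x, continuous f} <-> forall i j, {for x, continuous (fun y => f y i j)}.
Proof.
split=> [cf i j|cf].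
  apply: (@continuous_comp _ _ _ f (fun M : 'M[R]_(m, p) => M i j)) => //.
  exact: coord_continuous.
apply/cvgrPdist_le => /= e e0; near=> y.
rewrite /Num.Def.normr/= mx_normrE (bigmax_le _ (ltW e0))//= => i _.
rewrite !mxE/=; move: i; near: y; apply: filter_forall => /= i.
exact: ((cvgrPdist_le _ _).1 (cf i.1 i.2)).
Unshelve. all: by end_near. Qed.

Lemma Ck_mxP V k m p (U : set V) (f : V -> 'M[R]_(m, p)) : open U ->
  Ck k U f <-> forall i j, Ck k U (fun x => f x i j).
Proof.
move=> oU; elim: k f => [|k IH] f.
  split=> [[cf _] i j|H].
    by split=> // x Ux; exact: (cvg_mxP f x).1 (cf x Ux) i j.
  by split=> // x Ux; apply/cvg_mxP => i j; have [cf _] := H i j; exact: cf.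
split=> [[cf Hf] i j|H].
  split; first by move=> x Ux; exact: (cvg_mxP f x).1 (cf x Ux) i j.
  move=> v; have [df Df] := Hf v; split.
    by move=> x Ux; exact: (derivable_mxP f x v).1 (df x Ux) i j.
  refine (eq_Ck oU _ ((IH _).1 Df i j)) => x Ux /=.
  by rewrite derive_mx ?mxE//; exact: df.
split; first by move=> x Ux; apply/cvg_mxP => i j; have [cf _] := H i j; exact: cf.
move=> v; have df x : U x -> derivable f x v.
  move=> Ux; apply/derivable_mxP => i j.
  by have [_ /(_ v)[df _]] := H i j; exact: df.
split=> //; apply/IH => i j; have [_ /(_ v)[_ Df]] := H i j.
refine (eq_Ck oU _ Df) => x Ux /=.
by rewrite derive_mx ?mxE//; exact: df.
Qed.

Lemma is_derive_coord m p (i : 'I_m) (j : 'I_p) (x v : 'M[R]_(m, p)) :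
  is_derive x v (fun u : 'M[R]_(m, p) => u i j) (v i j).
Proof.
have := @is_derive_id R 'M[R]_(m, p) x v => -[d1 d2].
apply: DeriveDef; first exact: (derivable_mxP _ _ _).1 d1 i j.
have := derive_mx d1; rewrite d2 => /matrixP/(_ i j); by rewrite mxE.
Qed.

Lemma Ck_coord k m p (U : set 'M[R]_(m, p)) i j :
  open U -> Ck k U (fun u : 'M[R]_(m, p) => u i j).
Proof.
case: k => [|k] oU; split=> //; try by move=> x _; exact: coord_continuous.
move=> v; split; first by move=> x _; case: (is_derive_coord i j x v).
refine (eq_Ck oU _ (Ck_cst k U (v i j))) => x _ /=.
by case: (is_derive_coord i j x v) => _ ->.
Qed.

End CkTheory.

(** * Differentiability of C^1 functions and the chain rule *)

Section Differentiability.
Context {R : realType}.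
Implicit Types V W : normedModType R.

Lemma normr_entry m p (u : 'M[R]_(m, p)) i j : `|u i j| <= `|u|.
Proof.
rewrite [leRHS]/Num.Def.normr /= mx_normrE.
exact: (@le_bigmax _ _ _ 0 (fun ij : 'I_m * 'I_p => `|u ij.1 ij.2|) (i, j)).
Qed.

Lemma normr_mx_le m p (u : 'M[R]_(m, p)) e : 0 <= e ->
  (forall i j, `|u i j| <= e) -> `|u| <= e.
Proof.
by move=> e0 H; rewrite /Num.Def.normr /= mx_normrE bigmax_le// => -[i j] _; exact: H.
Qed.

Lemma derive_lineE V W (g : V -> W) x v :
  'D_v g x = 'D_1 (fun h : R => g (h *: v + x)) 0.
Proof.
rewrite /derive; set g1 := fun h => h^-1 *: _; set g2 := fun h => h^-1 *: _.
suff -> : g1 = g2 by [].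
by rewrite funeqE /g1 /g2 => h /=; rewrite addr0 scale0r add0r [_%:A]mulr1.
Qed.

Lemma is_derive_line V (g : V -> R) x w (t : R) :
  derivable g (t *: w + x) w ->
  is_derive t (1 : R) (fun h : R => g (h *: w + x)) ('D_w g (t *: w + x)).
Proof.
move=> dg; have E : (fun h : R => h^-1 *: (((fun h => g (h *: w + x)) \o shift t) (h *: (1 : R)) - g (t *: w + x)))
  = (fun h : R => h^-1 *: ((g \o shift (t *: w + x)) (h *: w) - g (t *: w + x))).
  apply/funext => h /=; congr (_ *: (g _ - _)).
  by rewrite /GRing.scale /= mulr1 addrA -scalerDl.
by apply: DeriveDef; rewrite /derivable /derive E.
Qed.

(** Directional derivability carries no linearity in the direction; homogeneity comes from the
    one-variable chain rule along the line. The case a = 0 is included. *)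
Lemma is_derive_scale V (g : V -> R) x v (a : R) : derivable g x v ->
  is_derive x (a *: v) g (a * 'D_v g x).
Proof.
move=> dg; have dg0 : derivable g (0 *: v + x) v by rewrite scale0r add0r.
have := is_derive_line dg0; rewrite scale0r add0r => -[d1 e1].
have H : is_derive (0 : R) (1 : R) ((fun h : R => g (h *: v + x)) \o ( *%R^~ a)) (a * 'D_v g x).
  have d2 : derivable ( *%R^~ a : R -> R) (0 : R) 1.
    by apply: (@derivableM _ _ (fun x : R => x) (cst a)); [exact: derivable_id|exact: derivable_cst].
  have d1' : derivable (fun h : R => g (h *: v + x)) (0 * a) 1 by rewrite mul0r.
  apply: DeriveDef.
    apply/derivable1_diffP; apply: differentiable_comp; apply/derivable1_diffP => //.
  rewrite -derive1E derive1_comp// !derive1E mul0r e1 mulrC.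
  by rewrite deriveMr ?derive_id// mulr1.
have E : (fun h : R => g (h *: v + x)) \o ( *%R^~ a) = (fun h => g (h *: (a *: v) + x)).
  by apply/funext => h /=; rewrite scalerA.
move: H; rewrite E => -[d3 e3]; apply: DeriveDef; first exact: (derivable1P g x (a *: v)).2 d3.
by rewrite -e3 derive_lineE.
Qed.

Lemma mvt_line V (g : V -> R) x w :
  (forall t : R, 0 <= t <= 1 -> derivable g (t *: w + x) w) ->
  exists2 t : R, 0 <= t <= 1 & g (w + x) - g x = 'D_w g (t *: w + x).
Proof.
move=> dg.
have dl (t : R) : 0 <= t <= 1 ->
    is_derive t (1 : R) (fun h : R => g (h *: w + x)) ('D_w g (t *: w + x)).
  by move=> /dg; exact: is_derive_line.
have [c|c|c c01] := @MVT_segment R (fun h : R => g (h *: w + x))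
  (fun t : R => 'D_w g (t *: w + x)) 0 1 ler01.
- by rewrite in_itv /= => /andP[c0 c1]; apply: dl; rewrite !ltW.
- apply: derivable_within_continuous c => t; rewrite in_itv /= => t01.
  by case: (dl _ t01).
- rewrite scale1r scale0r add0r subr0 mulr1 => ->.
  by exists c => //; move: c01; rewrite in_itv.
Qed.

(** The classical argument: x and h + x are joined by a path that changes one coordinate at a time,
    the mean value theorem is applied on each edge, and continuity of the partial derivatives bounds
    the error. *)
Lemma Ck1_differentiable n (U : set 'rV[R]_n) (g : 'rV[R]_n -> R) x :
  open U -> Ck 1 U g -> U x ->
  differentiable g x /\ forall v, 'd g x v = \sum_j v 0 j * pd j g x.
Proof.
move=> oU [cg Hg] Ux.
pose df (h : 'rV[R]_n) : R := \sum_j h 0 j * pd j g x.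
have df_lin : linear df.
  move=> a u v; rewrite /df /GRing.scale /= mulr_sumr -big_split /=.
  by apply: eq_bigr => j _; rewrite !mxE mulrDl mulrA.
pose dfHB := GRing.isLinear.Build _ _ _ _ df df_lin.
pose DF : {linear 'rV[R]_n -> R^o} := HB.pack df dfHB.
have cDF : continuous DF.
  apply/linear_bounded_continuous/linear_boundedP.
  apply: filterS (nbhs_pinfty_ge (num_real (\sum_j `|pd j g x|))) => r Hr u.
  rewrite (le_trans (ler_norm_sum _ _ _))//.
  apply: (@le_trans _ _ (\sum_j `|pd j g x| * `|u|)).
    apply: ler_sum => j _; rewrite normrM mulrC ler_wpM2l// normr_entry //.
  by rewrite -mulr_suml ler_wpM2r.
suff E : (g : 'rV[R]_n -> R^o) \o shift x = cst (g x : R^o) + (DF : 'rV[R]_n -> R^o) +o_ (0 : 'rV[R]_n) id.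
  have e1 := diff_unique cDF E.
  split; first by apply/diff_locallyP; rewrite e1.
  by move=> v; rewrite e1.
apply/eqaddoP => e e0.
(* Each of the n edges may contribute e / (n + 1) times the norm of h; the divisor n + 1 is nonzero
   even for n = 0. *)
have n0 : 0 < n.+1%:R :> R by rewrite ltr0n.
have H1 : \forall y \near x, U y by exact: open_nbhs_nbhs.
have H2 : \forall y \near x, forall j : 'I_n, `|pd j g y - pd j g x| <= e / n.+1%:R.
  refine (@filter_forall _ 'I_n (fun (j : 'I_n) y => `|pd j g y - pd j g x| <= e / n.+1%:R) (nbhs x) _ _) => j; have [_ [cD _]] := Hg (delta_mx 0 j).
  have /cvgrPdist_le /(_ (e / n.+1%:R) (divr_gt0 e0 n0)) := cD x Ux.
  by apply: filterS => y; rewrite distrC.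
have : \forall y \near x, U y /\ forall j : 'I_n, `|pd j g y - pd j g x| <= e / n.+1%:R.
  by apply: filterS2 H1 H2.
move=> /nbhs_ballP[r /= r0 Hr].
apply/nbhs_ballP; exists r => //= h; rewrite -ball_normE /= sub0r normrN => hr.
(* [T k] keeps the first k entries of h, so the points [T k + x] are the vertices of the path. *)
pose T (k : nat) : 'rV[R]_n := \row_j (if (j < k)%N then h 0 j else 0).
have T0 : T 0 = 0 by apply/rowP => j; rewrite !mxE.
have Tn : T n = h by apply/rowP => j; rewrite !mxE ltn_ord.
have TS (k : 'I_n) : T k.+1 = h 0 k *: delta_mx 0 k + T k.
  apply/rowP => j; rewrite !mxE eqxx /= ltnS leq_eqVlt -val_eqE /=.
  case: ltngtP => [jk|jk|jk] /=; rewrite ?mulr0 ?mulr1 ?add0r ?addr0//.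
  by congr (h _ _); exact: val_inj.
(* The norm is the maximum of the entries, and along the path no entry of the displacement from x
   exceeds that of h. *)
have inB (k : 'I_n) (t : R) : 0 <= t <= 1 -> ball x r (t *: (h 0 k *: delta_mx 0 k) + (T k + x)).
  move=> /andP[t0 t1]; rewrite -ball_normE /= addrA opprD addrCA subrr addr0 normrN.
  apply: le_lt_trans hr; apply: normr_mx_le => // i j; rewrite ord1 !mxE eqxx /=.
  case: (eqVneq j k) => [->|jk] /=.
    rewrite ltnn addr0 mulr1 normrM ger0_norm//.
    by rewrite (le_trans _ (normr_entry h 0 k))// ler_piMl.
  rewrite !mulr0 add0r; case: ifP => _; first exact: normr_entry.
  by rewrite normr0.
have fin : \sum_(k < n) (e / n.+1%:R * `|h|) <= e * `|h|.
  rewrite sumr_const card_ord -[X in X <= _]mulr_natl mulrA ler_wpM2r//.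
  by rewrite mulrCA ler_piMr ?ltW// ltr_pdivrMr// mul1r ltr_nat.
have step (k : 'I_n) : exists2 y, ball x r y &
    g (T k.+1 + x) - g (T k + x) = h 0 k * pd k g y.
  have [t t01|t t01] := @mvt_line _ g (T k + x) (h 0 k *: delta_mx 0 k).
    have [Uy _] := Hr _ (inB k t t01).
    have [dD _] := Hg (delta_mx 0 k).
    by case: (is_derive_scale (h 0 k) (dD _ Uy)).
  rewrite addrA -TS => ->; exists (t *: (h 0 k *: delta_mx 0 k) + (T k + x)).
    exact: inB.
  have [Uy _] := Hr _ (inB k t t01).
  have [dD _] := Hg (delta_mx 0 k).
  by case: (is_derive_scale (h 0 k) (dD _ Uy)).
have -> : ((g : 'rV[R]_n -> R^o) \o shift x - (cst (g x : R^o) + (DF : 'rV[R]_n -> R^o))) h =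
    \sum_(k < n) ((g (T k.+1 + x) - g (T k + x)) - h 0 k * pd k g x).
  rewrite sumrB -(big_mkord xpredT (fun k => g (T k.+1 + x) - g (T k + x))).
  rewrite telescope_sumr// T0 Tn add0r.
  by rewrite /= opprD addrA.
rewrite (le_trans (ler_norm_sum _ _ _))//.
apply: (@le_trans _ _ (\sum_(k < n) (e / n.+1%:R * `|h|))).
  apply: ler_sum => k _; have [y By ->] := step k.
  rewrite -mulrBr normrM mulrC ler_pM//; last exact: normr_entry.
  by have [_ ->] := Hr _ By.
exact: fin.
Unshelve. all: by end_near. Qed.

Lemma Ck1_derive n (U : set 'rV[R]_n) (g : 'rV[R]_n -> R) x v :
  open U -> Ck 1 U g -> U x -> 'D_v g x = \sum_j v 0 j * pd j g x.
Proof.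
by move=> oU Cg Ux; have [dg e] := Ck1_differentiable oU Cg Ux; rewrite deriveE.
Qed.

(** Derivability of f in the single direction v suffices: restricted to the line, f is a curve in
    one variable, hence differentiable. Only g has to be differentiable in the full sense. *)
Lemma is_derive_comp V n (f : V -> 'rV[R]_n) (g : 'rV[R]_n -> R) x v
    (U : set 'rV[R]_n) : open U -> Ck 1 U g -> U (f x) -> derivable f x v ->
  is_derive x v (g \o f) (\sum_j 'D_v f x 0 j * pd j g (f x)).
Proof.
move=> oU Cg Ufx df; have [dg e] := Ck1_differentiable oU Cg Ufx.
have df1 := (derivable1P f x v).1 df.
have f0 : f (0 *: v + x) = f x by rewrite scale0r add0r.
have dgf : differentiable (g \o (fun h : R => f (h *: v + x))) 0.
  by apply: differentiable_comp; [exact/derivable1_diffP|rewrite f0].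
apply: DeriveDef; first exact/derivable1P/derivable1_diffP.
have -> : 'D_v (g \o f) x = 'D_1 (g \o (fun h : R => f (h *: v + x))) 0.
  by rewrite derive_lineE.
rewrite deriveE// diff_comp; [|exact/derivable1_diffP|by rewrite f0].
rewrite /= f0 e; apply: eq_bigr => j _; congr (_ * _).
by rewrite [in RHS]derive_lineE deriveE//; exact/derivable1_diffP.
Qed.

(** The derivative is a sum of products with [pd j g \o f], so the induction on k has to range over
    g. *)
Lemma Ck_comp V n k (U : set V) (U' : set 'rV[R]_n) (f : V -> 'rV[R]_n)
    (g : 'rV[R]_n -> R) : open U -> open U' -> (forall x, U x -> U' (f x)) ->
  Ck k U f -> Ck k U' g -> Ck k U (g \o f).
Proof.
move=> oU oU' fU; elim: k f g fU => [|k IH] f g fU Cf Cg.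
  split=> // x Ux; apply: continuous_comp; first exact: Ck_cont Cf Ux.
  by apply: Ck_cont Cg _; exact: fU.
split.
  move=> x Ux; apply: continuous_comp; first exact: Ck_cont Cf Ux.
  by apply: Ck_cont Cg _; exact: fU.
have C1g : Ck 1 U' g.
  by case: Cg => cg Hg; split=> // v; have [dg Dg] := Hg v; split=> //; split=> // x; exact: Ck_cont Dg.
move=> v; have [df Df] := (Cf.2 v).
have D x : U x -> is_derive x v (g \o f) (\sum_j 'D_v f x 0 j * pd j g (f x)).
  by move=> Ux; apply: is_derive_comp oU' C1g _ _; [exact: fU|exact: df].
split; first by move=> x /D[].
refine (eq_Ck oU (f := fun x => \sum_j 'D_v f x 0 j * pd j g (f x)) _ _).
  by move=> x /D[_ ->].
apply: Ck_sum => // j; apply: CkM => //; first exact: (Ck_mxP _ _ oU).1 Df 0 j.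
apply: (IH f (pd j g)) => //; first exact: CkS.
by have [_] := Cg.2 (delta_mx 0 j).
Qed.

Lemma Ck_comp_mx V n m p k (U : set V) (U' : set 'rV[R]_n) (f : V -> 'rV[R]_n)
    (g : 'rV[R]_n -> 'M[R]_(m, p)) : open U -> open U' ->
  (forall x, U x -> U' (f x)) -> Ck k U f -> Ck k U' g -> Ck k U (g \o f).
Proof.
move=> oU oU' fU Cf Cg; apply/Ck_mxP => // i j.
exact: Ck_comp oU oU' fU Cf ((Ck_mxP _ _ oU').1 Cg i j).
Qed.

End Differentiability.

(* Adapted charts come from the map replacing the i-th coordinate by a function s
   with nonzero i-th derivative. It moves points along coordinate lines only, so the
   one-variable intermediate and mean value theorems replace the inverse function
   theorem. *)
Section CoordinateReplacement.
Context {R : realType} {n : nat}.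
Implicit Types (u v w : 'rV[R]_n) (i : 'I_n) (t : R).

Definition setc i u t : 'rV[R]_n := u + (t - u 0 i) *: delta_mx 0 i.

Lemma setcE i u t j : setc i u t 0 j = if j == i then t else u 0 j.
Proof.
rewrite !mxE eqxx /=; case: eqVneq => [->|_]; last by rewrite mulr0 addr0.
by rewrite mulr1 addrCA subrr addr0.
Qed.

Lemma setc_setc i u t t' : setc i (setc i u t) t' = setc i u t'.
Proof. by apply/rowP => j; rewrite !setcE; case: eqP. Qed.

Lemma setc_id i u : setc i u (u 0 i) = u.
Proof. by apply/rowP => j; rewrite !setcE; case: eqP => // ->. Qed.

Lemma cvg_setc (T : Type) (F : set_system T) {FF : Filter F} i
    (f : T -> 'rV[R]_n) (g : T -> R) u t :
  f x @[x --> F] --> u -> g x @[x --> F] --> t ->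
  setc i (f x) (g x) @[x --> F] --> setc i u t.
Proof.
move=> fu gt.
have fi : f x 0 i @[x --> F] --> u 0 i.
  exact: (@cvg_comp _ _ _ f (fun x => x 0 i) F (nbhs u) (nbhs (u 0 i)) fu (@coord_continuous R 1 n 0 i u)).
exact: (cvgD fu (cvgZr_tmp (a := delta_mx 0 i : 'rV[R]_n) (cvgB gt fi))).
Qed.

Lemma setc_cont i t : continuous (fun u => setc i u t).
Proof. by move=> u; apply: (@cvg_setc _ (nbhs u) _ i id (cst t) u t) => //; exact: cvg_cst. Qed.

Variables (i : 'I_n) (O : set 'rV[R]_n) (s : 'rV[R]_n -> R) (u0 : 'rV[R]_n).
Hypotheses (oO : open O) (ss : smooth O s) (Ou0 : O u0) (ds : pd i s u0 != 0).

Let D := pd i s u0.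

(** The factor D treats both signs of the derivative at once. Balls of the maximum norm are boxes,
    so they contain the coordinate segments used below. *)
Lemma pd_sign_ball : exists2 d : R, 0 < d &
  forall u, ball u0 d u -> O u /\ 0 < D * pd i s u.
Proof.
have H1 : \forall y \near u0, O y by exact: open_nbhs_nbhs.
have [_ H] := ss 1; have [_ [cD _]] := H (delta_mx 0 i).
have D2 : 0 < `|D| by rewrite normr_gt0.
have /cvgrPdist_lt /(_ `|D| D2) H2 := cD u0 Ou0.
have : \forall y \near u0, O y /\ 0 < D * pd i s y.
  apply: filterS2 H1 H2 => y Oy; rewrite -/(pd i s u0) -/(pd i s y) -/D => h.
  split=> //; move: h; rewrite ltr_norml.
  have [D0|D0] := ltP 0 D.
    by rewrite gtr0_norm// => /andP[_ h]; rewrite mulr_gt0//; lra.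
  have {}D0 : D < 0 by rewrite lt_neqAle D0 andbT.
  by rewrite ltr0_norm// opprK => /andP[h _]; rewrite nmulr_rgt0//; lra.
by move=> /nbhs_ballP[d /= d0 H3]; exists d.
Qed.

Variables (d : R).
Hypotheses (d0 : 0 < d)
  (Hd : forall u, ball u0 d u -> O u /\ 0 < D * pd i s u).

Let U : set 'rV[R]_n := ball u0 d.
Let phi u := setc i u (s u).

Lemma ball_coordP (c : 'rV[R]_n) (e : R) v : 0 < e ->
  ball c e v <-> forall j, `|c 0 j - v 0 j| < e.
Proof.
move=> e0; split=> [|H].
  rewrite -ball_normE /= => h j; apply: le_lt_trans h.
  by have := normr_entry (c - v) 0 j; rewrite !mxE.
by split=> // a j; rewrite ord1; have := H j; rewrite -ball_normE.
Qed.

Lemma setc_in_ball (c : 'rV[R]_n) (e : R) u t t' x : 0 < e ->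
  t <= x <= t' -> ball c e (setc i u t) -> ball c e (setc i u t') ->
  ball c e (setc i u x).
Proof.
move=> e0 /andP[tx xt'] /(ball_coordP _ _ e0) b /(ball_coordP _ _ e0) b'.
apply/ball_coordP => // j; have := b j; have := b' j; rewrite !setcE.
case: eqP => // _; rewrite !ltr_norml => /andP[h1 h2] /andP[h3 h4].
by apply/andP; split; lra.
Qed.

Lemma s_derivable u v : O u -> derivable s u v.
Proof. by move=> Ou; have [_ H] := ss 1; have [H1 _] := H v; exact: H1. Qed.

(** The bound on x forces the intermediate point to converge when [psi] is differentiated. *)
Lemma mvt_coord u t t' : U (setc i u t) -> U (setc i u t') ->
  exists2 x, U (setc i u x) /\ `|x - t| <= `|t' - t| &
    s (setc i u t') - s (setc i u t) = (t' - t) * pd i s (setc i u x).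
Proof.
move=> Ut Ut'.
pose w : 'rV[R]_n := (t' - t) *: delta_mx 0 i.
have wE (x : R) : x *: w + setc i u t = setc i u (t + x * (t' - t)).
  apply/rowP => j; rewrite !mxE !eqxx /=.
  by case: eqP => [->|_]; rewrite ?mulr0 ?mulr1 ?addr0 ?add0r//; ring.
have inU (x : R) : 0 <= x <= 1 -> U (x *: w + setc i u t).
  move=> /andP[x0 x1]; rewrite wE; have [tt|tt] := leP t t'.
    by apply: (setc_in_ball d0 _ Ut Ut'); apply/andP; split; nra.
  by apply: (setc_in_ball d0 _ Ut' Ut); apply/andP; split; nra.
have [x x01|x x01] := @mvt_line _ _ s (setc i u t) w.
  by apply: s_derivable; have [] := Hd (inU _ x01).
have -> : w + setc i u t = setc i u t' by rewrite -[w]scale1r wE; congr (setc _ _ _); ring.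
move=> ->.
exists (t + x * (t' - t)).
  rewrite -wE; split; first exact: inU.
  by rewrite addrC addrA addNr add0r normrM ler_piMl// ger0_norm; case/andP: x01.
rewrite -wE; have [Ox _] := Hd (inU _ x01).
by case: (is_derive_scale (t' - t) (@s_derivable _ (delta_mx 0 i) Ox)).
Qed.

Lemma s_mono u t t' : t < t' -> U (setc i u t) -> U (setc i u t') ->
  D * s (setc i u t) < D * s (setc i u t').
Proof.
move=> tt Ut Ut'; have [x [Ux _] E] := mvt_coord Ut Ut'.
rewrite -subr_gt0 -mulrBr E mulrCA mulr_gt0 ?subr_gt0//.
by have [] := Hd Ux.
Qed.

(** Two points with the same image differ at most in the i-th coordinate, and on a coordinate line D
    s is strictly increasing. *)
Lemma phi_inj u u' : U u -> U u' -> phi u = phi u' -> u = u'.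
Proof.
move=> Uu Uu' E.
have E1 : u' = setc i u (u' 0 i).
  apply/rowP => j; rewrite setcE; case: eqP => [->//|ji].
  by move/rowP: E => /(_ j); rewrite !setcE; move/eqP/negbTE: ji => ->.
have E2 : s u = s u' by move/rowP: E => /(_ i); rewrite !setcE eqxx.
have U1 : U (setc i u (u 0 i)) by rewrite setc_id.
have U2 : U (setc i u (u' 0 i)) by rewrite -E1.
have [h|h|h] := ltgtP (u 0 i) (u' 0 i).
- by have := s_mono h U1 U2; rewrite -E1 setc_id E2 ltxx.
- by have := s_mono h U2 U1; rewrite -E1 setc_id E2 ltxx.
- by rewrite E1 -h setc_id.
Qed.

(** This local surjectivity with control of the preimage yields both openness of the image and
    continuity of the inverse. For w near phi u, the values of D s at the two ends of a segment on
    the coordinate line through w enclose D w_i; the intermediate value theorem supplies the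
    preimage. *)
Lemma phi_near u (e : R) : U u -> 0 < e ->
  \forall w \near phi u, exists2 u', U u' /\ ball u e u' & phi u' = w.
Proof.
move=> Uu e0.
have : \forall y \near u, U y.
  by apply: open_nbhs_nbhs; split=> //; exact: ball_open.
move=> /nbhs_ballP[e1 /= e10 He1].
pose e' := Num.min e e1; have e'0 : 0 < e' by rewrite lt_min e0.
have Be v : ball u e' v -> U v /\ ball u e v.
  move=> b; split.
    by apply: He1; apply: (@le_ball _ _ u e' e1); rewrite ?ge_min ?lexx ?orbT.
  by apply: (@le_ball _ _ u e' e); rewrite ?ge_min ?lexx.
(* Half of e' keeps the closed segment from a to b inside the open ball. *)
pose h := e' / 2; have h0 : 0 < h by rewrite divr_gt0.
pose a := u 0 i - h; pose b := u 0 i + h.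
have ubox w t : (forall j, j != i -> `|u 0 j - w 0 j| < e') -> a <= t <= b ->
    ball u e' (setc i w t).
  move=> Hw /andP[at_ tb]; apply/ball_coordP => // j; rewrite setcE.
  case: eqP => [->|/eqP ji]; last exact: Hw.
  have he : e' = h + h by rewrite /h -splitr.
  by rewrite ltr_norml he; move: at_ tb h0; rewrite /a /b => *; apply/andP; split; lra.
have boxu j : j != i -> `|u 0 j - u 0 j| < e' by rewrite subrr normr0.
have ab : a <= b by rewrite /a /b; lra.
have Ba : ball u e' (setc i u a) by apply: ubox => //; rewrite lexx.
have Bb : ball u e' (setc i u b) by apply: ubox => //; rewrite lexx andbT.
have sa : D * s (setc i u a) < D * s u.
  rewrite -{2}(setc_id i u); apply: s_mono; first by rewrite /a; lra.
    by have [] := Be _ Ba.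
  by rewrite setc_id.
have sb : D * s u < D * s (setc i u b).
  rewrite -{1}(setc_id i u); apply: s_mono; first by rewrite /b; lra.
    by rewrite setc_id.
  by have [] := Be _ Bb.
have cs t : ball u e' (setc i u t) -> D * s (setc i w t) @[w --> phi u] --> D * s (setc i u t).
  move=> Bt; have Ot : O (setc i u t) by have [/Hd[]] := Be _ Bt.
  have E : setc i (phi u) t = setc i u t by rewrite setc_setc.
  have c1 : setc i w t @[w --> phi u] --> setc i u t by rewrite -E; exact: setc_cont.
  have c2 := @cvg_comp _ _ _ (fun w => setc i w t) s _ _ _ c1 (Ck_cont (ss 0) Ot).
  exact: cvgMl_tmp c2.
have ci : D * (w : 'rV[R]_n) 0 i @[w --> phi u] --> D * s u.
  have c1 : (w : 'rV[R]_n) 0 i @[w --> phi u] --> s u.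
    have <- : phi u 0 i = s u by rewrite setcE eqxx.
    exact: coord_continuous.
  exact: cvgMl_tmp c1.
have N1 : \forall w \near phi u, D * s (setc i w a) < D * w 0 i.
  have h1 : 0 < D * s u - D * s (setc i u a) by rewrite subr_gt0.
  have := cvgr_gt _ (cvgB ci (cs a Ba)) _ h1.
  by move=> H; near=> w; rewrite -subr_gt0; near: w; exact: H.
have N2 : \forall w \near phi u, D * (w : 'rV[R]_n) 0 i < D * s (setc i w b).
  have h1 : 0 < D * s (setc i u b) - D * s u by rewrite subr_gt0.
  have := cvgr_gt _ (cvgB (cs b Bb) ci) _ h1.
  by move=> H; near=> w; rewrite -subr_gt0; near: w; exact: H.
have N3 : \forall w \near phi u, forall j, j != i -> `|u 0 j - (w : 'rV[R]_n) 0 j| < e'.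
  have : \forall w \near phi u, ball (phi u) e' w by exact: nbhsx_ballx.
  apply: filterS => w /(ball_coordP _ _ e'0) H j ji; have := H j.
  by rewrite setcE (negbTE ji).
near=> w.
have n1 : D * s (setc i w a) < D * w 0 i by near: w.
have n2 : D * w 0 i < D * s (setc i w b) by near: w.
have n3 : forall j, j != i -> `|u 0 j - w 0 j| < e' by near: w.
have [||t tab tE] := @IVT _ (fun t => D * s (setc i w t)) a b (D * w 0 i) ab.
- apply: continuous_in_subspaceT => t; rewrite inE /= in_itv /= => tab.
  apply: cvgMl_tmp.
  apply: (@continuous_comp _ _ _ (fun t => setc i w t) s).
    by apply: (@cvg_setc _ (nbhs t) _ i (cst w) id w t) => //; exact: cvg_cst.
  apply: (Ck_cont (ss 0)); have [/Hd[]//] := Be _ (ubox w t n3 tab).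
- have n12 := lt_trans n1 n2.
  by rewrite min_l ?max_r ?ltW// n1 n2.
move: tab; rewrite in_itv /= => tab.
exists (setc i w t); first exact: Be (ubox w t n3 tab).
rewrite /phi setc_setc; have /mulfI : D != 0 by [].
by move=> /(_ _ _ tE) ->; rewrite setc_id.
Unshelve. all: by end_near. Qed.

Lemma phi_open : open (phi @` U).
Proof.
rewrite openE => _ [u Uu <-]; rewrite /interior.
have := phi_near Uu d0; apply: filterS => w [u' [Uu' _] <-]; by exists u'.
Qed.

Definition psi w : 'rV[R]_n := xget u0 [set u | U u /\ phi u = w].

Lemma psiP w : (phi @` U) w -> U (psi w) /\ phi (psi w) = w.
Proof.
move=> [u Uu uw]; rewrite /psi.
by case: xgetP => [x _ //|/(_ u)]; case.
Qed.

Lemma phiK u : U u -> psi (phi u) = u.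
Proof.
move=> Uu; have [|U1 E] := @psiP (phi u); first by exists u.
exact: phi_inj.
Qed.

Lemma psi_cont w : (phi @` U) w -> {for w, continuous psi}.
Proof.
move=> Vw; have [Uw Ew] := psiP Vw.
apply/(@cvgrPdist_lt _ _ _ (nbhs w) (nbhs_filter w)) => e e0; have H := phi_near Uw e0; rewrite Ew in H.
refine (@filterS _ (nbhs w) (nbhs_filter w) _ _ _ H) => w' [u' [Uu' Bu'] <-].
by rewrite phiK//; move: Bu'; rewrite -ball_normE.
Qed.

Lemma psi_coord w j : (phi @` U) w -> j != i -> psi w 0 j = w 0 j.
Proof.
move=> /psiP[_ E] ji; rewrite -[in RHS]E setcE (negbTE ji)//.
Qed.

Lemma s_psi w : (phi @` U) w -> s (psi w) = w 0 i.
Proof. by move=> /psiP[_ E]; rewrite -[in RHS]E setcE eqxx. Qed.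

(** Implicit differentiation of s (psi w) = w_i. The other coordinates of [psi] move with velocity
    [setc i v 0], and the mean value theorem in the i-th coordinate isolates the increment of
    [psi w 0 i]. *)
Lemma is_derive_psi w v : (phi @` U) w ->
  is_derive w v (fun w => psi w 0 i)
    ((v 0 i - 'D_(setc i v 0) s (psi w)) * (pd i s (psi w))^-1).
Proof.
move=> Vw; have [Uu Eu] := psiP Vw; set u := psi w in Uu Eu *.
set v' := setc i v 0.
pose h t := psi (t *: v + w) 0 i.
have cv (v1 w1 : 'rV[R]_n) : t *: v1 + w1 @[t --> (0 : R)] --> w1.
  rewrite -{2}[w1]add0r -(scale0r v1); apply: cvgD; last exact: cvg_cst.
  by apply: cvgZr_tmp; exact: cvg_id.
have near1 : \forall t \near (0 : R), (phi @` U) (t *: v + w).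
  apply: (cv v w); apply: open_nbhs_nbhs; split=> //; exact: phi_open.
have near2 : \forall t \near (0 : R), U (t *: v' + u).
  apply: (cv v' u); apply: open_nbhs_nbhs; split=> //; exact: ball_open.
have psiE t : (phi @` U) (t *: v + w) -> psi (t *: v + w) = setc i (t *: v' + u) (h t).
  move=> Vt; apply/rowP => j; rewrite setcE; case: eqP => [->//|/eqP ji].
  by rewrite psi_coord// !mxE (negbTE ji) andbF /= mulr0 addr0 psi_coord.
have u'E t : (t *: v' + u) = setc i (t *: v' + u) (u 0 i).
  have e1 : (t *: v' + u) 0 i = u 0 i by rewrite mxE mxE setcE eqxx mulr0 add0r.
  by rewrite -[in RHS]e1 setc_id.
have hc : h t @[t --> (0 : R)] --> u 0 i.
  have c1 : psi (t *: v + w) @[t --> (0 : R)] --> u.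
    apply: (@cvg_comp _ _ _ (fun t : R => t *: v + w) psi _ (nbhs w)); first exact: cv.
    exact: psi_cont.
  apply: (@cvg_comp _ _ _ (fun t : R => psi (t *: v + w)) (fun x => x 0 i) _ (nbhs u)) => //.
  exact: coord_continuous.
(* The intermediate point is asserted for every t, vacuously outside the two neighbourhoods, so that
   [choice] makes it a function of t. *)
have ex t : exists x : R, (phi @` U) (t *: v + w) -> U (t *: v' + u) ->
    `|x - u 0 i| <= `|h t - u 0 i| /\ U (setc i (t *: v' + u) x) /\
    (h t - u 0 i) * pd i s (setc i (t *: v' + u) x) = t * v 0 i - (s (t *: v' + u) - s u).
  case: (pselect ((phi @` U) (t *: v + w))) => [Vt|nV]; last by exists 0.
  case: (pselect (U (t *: v' + u))) => [Ut|nU]; last by exists 0.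
  have U1 : U (setc i (t *: v' + u) (u 0 i)) by rewrite -u'E.
  have U2 : U (setc i (t *: v' + u) (h t)) by rewrite -psiE//; case: (psiP Vt).
  have [x [Ux xle] E] := mvt_coord U1 U2.
  exists x => _ _; split=> //; split=> //; rewrite -E -u'E -psiE// s_psi//.
  have su : s u = w 0 i := s_psi Vw.
  by rewrite su !mxE; ring.
have [x Hx] := choice ex.
have xc : x t @[t --> (0 : R)] --> u 0 i.
  apply/cvgrPdist_lt => e e0.
  have /cvgrPdist_lt /(_ e e0) H := hc.
  near=> t; have [||le _] := Hx t; [by near: t|by near: t|].
  rewrite distrC (le_lt_trans le)// distrC; near: t; exact: H.
have yc : setc i (t *: v' + u) (x t) @[t --> (0 : R)] --> u.
  by rewrite -[X in _ --> X](setc_id i u); apply: cvg_setc; first exact: cv.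
have Ou : O u by have [] := Hd Uu.
have pc : pd i s (setc i (t *: v' + u) (x t)) @[t --> (0 : R)] --> pd i s u.
  have [_ H] := ss 1; have [_ [cD _]] := H (delta_mx 0 i).
  apply: (@cvg_comp _ _ _ (fun t : R => setc i (t *: v' + u) (x t)) (pd i s) _ (nbhs u)) => //.
  exact: cD.
have pu0 : pd i s u != 0.
  by have [_] := Hd Uu; apply: contraTneq => ->; rewrite mulr0 ltxx.
have dsu := @s_derivable _ v' Ou.
have L : t^-1 *: (((fun w => psi w 0 i) \o shift w) (t *: v) - psi w 0 i) @[t --> 0^'] -->
    (v 0 i - 'D_v' s u) * (pd i s u)^-1.
  have L1 : (v 0 i - t^-1 *: ((s \o shift u) (t *: v') - s u)) *
      (pd i s (setc i (t *: v' + u) (x t)))^-1 @[t --> 0^'] -->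
      (v 0 i - 'D_v' s u) * (pd i s u)^-1.
    apply: cvgM; last first.
      apply: cvgV => //; apply: cvg_trans pc; apply: cvg_app; exact: cvg_within.
    apply: cvgB; [exact: cvg_cst|exact: dsu].
  apply: cvg_trans L1; apply: near_eq_cvg; near=> t.
  have t0 : t != 0 by near: t; exact: nbhs_dnbhs_neq.
  have Vt : (phi @` U) (t *: v + w) by near: t; exact: nbhs_dnbhs near1.
  have Ut : U (t *: v' + u) by near: t; exact: nbhs_dnbhs near2.
  have [_ [Ux E]] := Hx t Vt Ut.
  have p0 : pd i s (setc i (t *: v' + u) (x t)) != 0.
    by have [_] := Hd Ux; apply: contraTneq => ->; rewrite mulr0 ltxx.
  rewrite /= -/u -/(h t).
  have -> : s (t *: v' + u) - s u = t * v 0 i - (h t - u 0 i) * pd i s (setc i (t *: v' + u) (x t)).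
    by rewrite E opprB addrCA subrr addr0.
  by rewrite /GRing.scale /=; field; rewrite t0.
apply: DeriveDef; first by apply/cvg_ex; exists ((v 0 i - 'D_v' s u) * (pd i s u)^-1).
exact: cvg_lim L.
Unshelve. all: by end_near. Qed.

(** Bootstrapping: the derivative of [psi] is an expression in derivatives of s composed with [psi],
    so order k of [psi] gives order k of its derivative. *)
Lemma psi_smooth : smooth (phi @` U) psi.
Proof.
have oV := phi_open; elim=> [|k IH]; first by split=> // w; exact: psi_cont.
apply/Ck_mxP => // a j; rewrite ord1.
case: (eqVneq j i) => [->|ji]; last first.
  refine (eq_Ck oV (f := fun w : 'rV[R]_n => w 0 j) _ (Ck_coord k.+1 0 j oV)).
  by move=> w Vw; rewrite psi_coord.
split; first by move=> w Vw; exact: (cvg_mxP _ _).1 (psi_cont Vw) 0 i.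
move=> v; split; first by move=> w Vw; case: (is_derive_psi v Vw).
refine (eq_Ck oV (f := fun w => (v 0 i - 'D_(setc i v 0) s (psi w)) * (pd i s (psi w))^-1) _ _).
  by move=> w Vw; case: (is_derive_psi v Vw) => _ ->.
have psiU w : (phi @` U) w -> O (psi w) by move=> /psiP[/Hd[]].
have Ds v1 : Ck k O (fun y => 'D_v1 s y) by have [_ /(_ v1)[]] := ss k.+1.
apply: CkM => //.
  refine (eq_Ck oV _ (CkD oV (Ck_cst k _ (v 0 i)) (CkZ (-1) oV (Ck_comp oV oO psiU IH (Ds (setc i v 0)))))).
  by move=> w _ /=; rewrite scaleN1r.
apply: CkV => //.
  move=> w /psiP[/Hd[_ h] _]; apply: contraTneq h => ->; by rewrite mulr0 ltxx.
exact: Ck_comp oV oO psiU IH (Ds _).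
Qed.

Lemma phi_smooth : smooth U phi.
Proof.
move=> k; apply/Ck_mxP; first exact: ball_open.
move=> a j; rewrite ord1.
have oU : open U by exact: ball_open.
case: (eqVneq j i) => [->|ji].
  refine (eq_Ck oU (f := s) _ (Ck_sub _ (ss k))).
    by move=> w Vw; rewrite setcE eqxx.
  by move=> w /Hd[].
refine (eq_Ck oU (f := fun w : 'rV[R]_n => w 0 j) _ (Ck_coord k 0 j oU)).
by move=> w Vw; rewrite setcE (negbTE ji).
Qed.

End CoordinateReplacement.

(** * Smoothness and derivatives of determinants and inverses *)

Section MatrixCalculus.
Context {R : realType}.
Implicit Types V W : normedModType R.

Lemma Ck_det V k n (U : set V) (f : V -> 'M[R]_n) : open U ->
  (forall i j, Ck k U (fun x => f x i j)) -> Ck k U (fun x => \det (f x)).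
Proof.
move=> oU Hf; rewrite /determinant; apply: Ck_sum => // s.
apply: CkM => //; first exact: Ck_cst.
by apply: Ck_prod => // i.
Qed.

Lemma Ck_cofactor V k n (U : set V) (f : V -> 'M[R]_n) i0 j0 : open U ->
  (forall i j, Ck k U (fun x => f x i j)) ->
  Ck k U (fun x => cofactor (f x) i0 j0).
Proof.
move=> oU Hf; rewrite /cofactor; apply: CkM => //; first exact: Ck_cst.
apply: Ck_det => // i j.
by refine (eq_Ck oU _ (Hf (lift i0 i) (lift j0 j))) => x _; rewrite !mxE.
Qed.

(** By Cramer's rule the entries are cofactors divided by the determinant. *)
Lemma Ck_invmx V k n (U : set V) (f : V -> 'M[R]_n) i0 j0 : open U ->
  (forall x, U x -> f x \in unitmx) ->
  (forall i j, Ck k U (fun x => f x i j)) ->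
  Ck k U (fun x => invmx (f x) i0 j0).
Proof.
move=> oU uf Hf.
refine (eq_Ck oU (f := fun x => (\det (f x))^-1 * cofactor (f x) j0 i0) _ _).
  by move=> x Ux; rewrite /invmx uf// !mxE.
apply: CkM => //; last exact: Ck_cofactor.
apply: CkV => //; last exact: Ck_det.
by move=> x /uf; rewrite unitmxE unitfE.
Qed.

Lemma is_derive_mulf V (f g : V -> R) x v df dg :
  is_derive x v f df -> is_derive x v g dg ->
  is_derive x v (fun y => f y * g y) (f x * dg + g x * df).
Proof. by move=> Hf Hg; exact: is_deriveM. Qed.

Lemma is_derive_addf V W (f g : V -> W) x v df dg :
  is_derive x v f df -> is_derive x v g dg ->
  is_derive x v (fun y => f y + g y) (df + dg).
Proof. by move=> Hf Hg; exact: is_deriveD. Qed.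

Lemma is_derive_bigsum V W (I : Type) (r : seq I) (P : pred I) (h : I -> V -> W) dh x v :
  (forall i, is_derive x v (h i) (dh i)) ->
  is_derive x v (fun y => \sum_(i <- r | P i) h i y) (\sum_(i <- r | P i) dh i).
Proof.
move=> H; elim: r => [|i r IH].
  rewrite big_nil (_ : (fun y => _) = cst 0); first exact: is_derive_cst.
  by apply/funext => y; rewrite big_nil.
rewrite big_cons; case: ifP => Pi.
  rewrite (_ : (fun y => _) = (fun y => h i y + \sum_(j <- r | P j) h j y)).
    exact: is_derive_addf.
  by apply/funext => y; rewrite big_cons Pi.
rewrite (_ : (fun y => _) = (fun y => \sum_(j <- r | P j) h j y))//.
by apply/funext => y; rewrite big_cons Pi.
Qed.

Lemma is_derive_prod V n (F : 'I_n -> V -> R) (F' : 'I_n -> R) x v :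
  (forall i, is_derive x v (F i) (F' i)) ->
  is_derive x v (fun y => \prod_i F i y)
    (\sum_k \prod_i (if i == k then F' i else F i x)).
Proof.
elim: n F F' => [|n IH] F F' H.
  rewrite big_ord0 (_ : (fun y => _) = cst 1); first exact: is_derive_cst.
  by apply/funext => y; rewrite big_ord0.
have d0 := H ord0.
have d1 := IH (fun i => F (lift ord0 i)) (fun i => F' (lift ord0 i)) (fun i => H _).
have -> : (fun y => \prod_i F i y) = F ord0 * (fun y => \prod_i F (lift ord0 i) y).
  by apply/funext => y; rewrite big_ord_recl.
apply: is_derive_eq; rewrite /GRing.scale /= big_ord_recl addrC; congr (_ + _).
  rewrite big_ord_recl eqxx mulrC; congr (_ * _).
rewrite mulr_sumr; apply: eq_bigr => k _; rewrite big_ord_recl /=; congr (_ * _).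
Qed.

(** Jacobi's formula: the Leibniz rule differentiates one row at a time, and Laplace expansion along
    that row produces the cofactors. *)
Lemma is_derive_det V n (A : V -> 'M[R]_n) (A' : 'M[R]_n) x v :
  (forall i j, is_derive x v (fun y => A y i j) (A' i j)) ->
  is_derive x v (fun y => \det (A y)) (\tr (\adj (A x) *m A')).
Proof.
move=> H.
have dp (s : 'S_n) := is_derive_prod (fun i => H i (s i)).
have D : is_derive x v (fun y => \det (A y))
    (\sum_(s : 'S_n) (-1) ^+ s * \sum_k \prod_i (if i == k then A' i (s i) else A x i (s i))).
  rewrite /determinant; exact: is_derive_bigsum.
apply: (is_derive_eq D).
under eq_bigr do rewrite mulr_sumr.
rewrite exchange_big /=.
(* [B k] is A at x with its k-th row replaced by the k-th row of A'. *)
pose B k : 'M[R]_n := \matrix_(i, j) (if i == k then A' i j else A x i j).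
transitivity (\sum_k \det (B k)).
  apply: eq_bigr => k _; rewrite /determinant; apply: eq_bigr => sg _; congr (_ * _).
  by apply: eq_bigr => i _; rewrite mxE.
rewrite /mxtrace; transitivity (\sum_k \sum_j A' k j * cofactor (A x) k j).
  apply: eq_bigr => k _; rewrite (expand_det_row _ k); apply: eq_bigr => j _.
  rewrite mxE eqxx; congr (_ * _); rewrite /cofactor; congr (_ * \det _).
  apply/matrixP => a b; rewrite !mxE; case: eqP => // /eqP.
  by rewrite eq_sym (negbTE (neq_lift _ _)).
rewrite exchange_big; apply: eq_bigr => j _; rewrite mxE; apply: eq_bigr => k _.
by rewrite mxE mulrC.
Qed.

End MatrixCalculus.

(** * Inertia of real symmetric matrices *)

Section Spectral.
Context {R : realType}.

(** Over the complex numbers S is hermitian, so the spectral theorem gives a real eigenvalue. It is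
    a root of the real characteristic polynomial, hence has a real eigenvector too. *)
Lemma real_symmetric_eigenvector n (S : 'M[R]_n.+1) : S^T = S ->
  exists (a : R) (v : 'rV[R]_n.+1), v != 0 /\ v *m S = a *: v.
Proof.
move=> Ssym; pose f := real_complex R; pose SC := map_mx f S.
have SCr : SC \is a realmx.
  apply/mxOverP => i j; rewrite mxE; by apply/complex_realP; exists (S i j).
have SCs : SC \is symmetricmx.
  apply/is_hermitianmxP; apply/matrixP => i j; rewrite !mxE expr0 mul1r /=.
  by rewrite -[in LHS]Ssym mxE.
have herm := realsym_hermsym SCs SCr.
have /hermitian_normalmx /orthomx_spectralP := herm.
have /mxOverP /(_ 0 0) := hermitian_spectral_diag_real herm.
set d := spectral_diag SC; set P := spectralmx SC => dreal E.
have Pu : P \in unitmx := spectral_unit SC.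
have ev : eigenvalue SC (d 0 0).
  (* The rows of the diagonalizing matrix P are eigenvectors; they are nonzero since P is
     invertible. *)
  apply/eigenvalueP; exists (row 0 P); last first.
    by apply: contraTneq Pu => P0; apply/negP => Pu; move: (row_mul 0 P (invmx P));
       rewrite mulmxV// P0 mul0mx => /rowP/(_ 0); rewrite !mxE eqxx => /eqP; rewrite oner_eq0.
  have : P *m SC = diag_mx d *m P by rewrite E !mulmxA mulmxV// mul1mx.
  move=> /(congr1 (row 0)); rewrite !row_mul => ->.
  by rewrite row_diag_mx -scalemxAl -rowE.
have [a da] : exists a : R, d 0 0 = f a.
  by move: dreal => /complex_realP.
move: ev; rewrite da eigenvalue_root_char -map_char_poly fmorph_root -eigenvalue_root_char.
by move=> /eigenvalueP[v v1 v2]; exists a, v.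
Qed.


Lemma dot_ge0 n (v : 'rV[R]_n) : 0 <= (v *m v^T) 0 0.
Proof. by rewrite mxE sumr_ge0// => j _; rewrite mxE -expr2 sqr_ge0. Qed.

Lemma dot_eq0 n (v : 'rV[R]_n) : ((v *m v^T) 0 0 == 0) = (v == 0).
Proof.
apply/eqP/eqP => [|->]; last by rewrite mul0mx mxE.
rewrite mxE => /eqP; rewrite psumr_eq0; last first.
  by move=> j _; rewrite mxE -expr2 sqr_ge0.
move=> /allP H; apply/rowP => j; have := H j (mem_index_enum j).
by rewrite !mxE mulf_eq0 orbb => /eqP.
Qed.

(* The Householder reflection in the hyperplane orthogonal to e - v. *)
Lemma reflection_exists n (v e : 'rV[R]_n) :
  (v *m v^T) 0 0 = 1 -> (e *m e^T) 0 0 = 1 ->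
  exists H : 'M[R]_n, [/\ H^T = H, H *m H = 1%:M & e *m H = v].
Proof.
move=> v1 e1; have [w wE] : exists w : 'rV[R]_n, w = e - v by exists (e - v).
have [w0|w0] := eqVneq w 0.
  exists 1%:M; rewrite trmx1 !mulmx1; split=> //.
  by apply/eqP; rewrite -subr_eq0 -wE w0.
pose c := (w *m w^T) 0 0; have c0 : c != 0 by rewrite dot_eq0.
have wwT : w *m w^T = c%:M by rewrite [LHS]mx11_scalar.
exists (1%:M - (2 / c) *: (w^T *m w)); split.
- by rewrite linearB linearZ /= trmx1 trmx_mul trmxK.
- have WW : w^T *m w *m (w^T *m w) = c *: (w^T *m w).
    by rewrite mulmxA -[w^T *m w *m w^T]mulmxA wwT mul_mx_scalar -scalemxAl.
  set W := w^T *m w in WW *.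
  rewrite mulmxBl mul1mx mulmxBr mulmx1 -scalemxAl -scalemxAr WW !scalerA.
  have -> : 2 / c * (2 / c) * c = 2 / c + 2 / c by field.
  by rewrite scalerDl opprB addrK subrK.
- rewrite mulmxBr mulmx1 -scalemxAr mulmxA.
  have ewT : e *m w^T = (c / 2)%:M.
    rewrite [LHS]mx11_scalar; congr (_ %:M).
    have vT : (e *m v^T) 0 0 = (v *m e^T) 0 0.
      have <- : (e *m v^T)^T = v *m e^T by rewrite trmx_mul trmxK.
      by rewrite [RHS]mxE.
    have mE (A B : 'M[R]_1) : (A - B) 0 0 = A 0 0 - B 0 0 by rewrite !mxE.
    have : c = 2 * (e *m w^T) 0 0.
      by rewrite /c wE linearB /= !mulmxBr !mulmxBl !mE v1 e1 -vT; ring.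
    by move=> ->; field.
  by rewrite ewT mul_scalar_mx scalerA (_ : 2 / c * (c / 2) = 1) ?scale1r ?wE ?subKr//; field.
Qed.

(** Conjugation by a reflection that sends the first basis vector to a unit eigenvector splits off a
    1 x 1 block; by symmetry the rest of the first column vanishes with the first row, and the
    induction continues on the complementary block. *)
Lemma real_spectral n (S : 'M[R]_n) : S^T = S ->
  exists (Q : 'M[R]_n) (d : 'rV[R]_n), Q *m Q^T = 1%:M /\ S = Q^T *m diag_mx d *m Q.
Proof.
elim: n S => [|n IH] S Ssym.
  by exists 1%:M, 0; split; apply/matrixP => -[].
have [a [v0 [v0n0 v0S]]] := real_symmetric_eigenvector Ssym.
pose c := (v0 *m v0^T) 0 0.
have c0 : 0 < c by rewrite lt_neqAle dot_ge0 eq_sym dot_eq0 v0n0.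
pose v := (Num.sqrt c)^-1 *: v0.
have v1 : (v *m v^T) 0 0 = 1.
  rewrite /v linearZ /= -scalemxAl -scalemxAr scalerA mxE -/c -invfM -expr2.
  by rewrite sqr_sqrtr ?ltW// mulVf ?gt_eqF.
have vS : v *m S = a *: v by rewrite -scalemxAl v0S !scalerA mulrC.
pose e : 'rV[R]_n.+1 := delta_mx 0 0.
have e1 : (e *m e^T) 0 0 = 1 by rewrite trmx_delta mul_delta_mx mxE eqxx.
have [H [HT HH eH]] := reflection_exists v1 e1.
have row0 : e *m (H *m S *m H) = a *: e.
  by rewrite !mulmxA eH vS -scalemxAl -eH -mulmxA HH mulmx1.
have [S1 S1def] : exists S1 : 'M[R]_(1 + n), S1 = H *m S *m H by exists (H *m S *m H).
have S1T : S1^T = S1 by rewrite S1def !trmx_mul HT Ssym mulmxA.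
pose S' := drsubmx S1.
have S'T : S'^T = S' by rewrite /S' -[in RHS]S1T trmx_drsub.
have [Q' [d' [QQ' SE]]] := IH S' S'T.
have S1E : S1 = block_mx a%:M 0 0 S'.
  have r0 j : S1 0 j = a * (0 == j)%:R.
    have /rowP/(_ j) := row0; rewrite -S1def -rowE mxE => ->; rewrite !mxE eqxx /=.
    by rewrite eq_sym.
  rewrite -[LHS]submxK; congr block_mx.
  - apply/matrixP => i j; rewrite !ord1 !mxE; rewrite (_ : lshift n 0 = 0); last exact: val_inj.
    by rewrite r0 eqxx mulr1.
  - apply/matrixP => i j; rewrite !ord1 !mxE; rewrite (_ : lshift n 0 = 0); last exact: val_inj.
    by rewrite r0 mulr0.
  - apply/matrixP => i j; rewrite !ord1 -S1T !mxE.
    rewrite (_ : lshift n 0 = 0); last exact: val_inj.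
    by rewrite r0 mulr0.
pose Q1 : 'M[R]_(1 + n) := block_mx 1%:M 0 0 Q'.
pose d1 : 'rV[R]_(1 + n) := row_mx a%:M d'.
have Q1Q1 : Q1 *m Q1^T = 1%:M.
  rewrite /Q1 tr_block_mx mulmx_block !(trmx0, trmx1, mulmx0, mul0mx, mulmx1, mul1mx, addr0, add0r) QQ'.
  by rewrite -scalar_mx_block.
have S1Q : S1 = Q1^T *m diag_mx d1 *m Q1.
  rewrite S1E SE /Q1 tr_block_mx diag_mx_row (_ : diag_mx a%:M = a%:M); last first.
    by apply/matrixP => i j; rewrite !ord1 !mxE.
  rewrite !mulmx_block !trmx0 !trmx1 !(mulmx0, mul0mx, mulmx1, mul1mx, addr0, add0r).
  by [].
clearbody Q1 d1.
exists (Q1 *m H), d1; split.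
  by rewrite trmx_mul HT mulmxA -(mulmxA _ H H) HH mulmx1; exact: Q1Q1.
have -> : S = H *m S1 *m H.
  by rewrite S1def !mulmxA HH mul1mx -mulmxA HH mulmx1.
by rewrite trmx_mul HT S1Q !mulmxA.
Qed.

End Spectral.

Section Inertia.
(* [set x | P] has to denote a finite set in this section. *)
Local Close Scope classical_set_scope.
Local Open Scope set_scope.
Context {R : realType}.
Implicit Types n m k p q r : nat.

(** Equal products of monic linear factors have the same roots up to order. *)
Lemma signature_unique n (S : 'M[R]_n) p q r p' q' r' :
  signature S p q r -> signature S p' q' r' -> [/\ p = p', q = q' & r = r'].
Proof.
move=> [s [E <- <- <-]] [s' [E' <- <- <-]].
by have /seq.permP H := prod_XsubC_eq (esym (etrans (esym E') E)); rewrite !H.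
Qed.

Lemma char_poly_diag n (Q : 'M[R]_n) d : Q *m Q^T = 1%:M ->
  char_poly (Q^T *m diag_mx d *m Q) = \prod_(i < n) ('X - (d 0 i)%:P).
Proof.
move=> QQ; have QTQ := mulmx1C QQ.
pose f : R -> {poly R} := polyC.
have E : char_poly_mx (Q^T *m diag_mx d *m Q) =
    map_mx f Q^T *m char_poly_mx (diag_mx d) *m map_mx f Q.
  rewrite /char_poly_mx mulmxBr mulmxBl !map_mxM; congr (_ - _).
  by rewrite mul_mx_scalar -scalemxAl -map_mxM QTQ map_mx1 scalemx1.
rewrite /char_poly E !det_mulmx mulrAC -det_mulmx -map_mxM QTQ map_mx1 det1 mul1r.
rewrite -/(char_poly (diag_mx d)) char_poly_trig ?diag_mx_is_trig//.
by apply: eq_bigr => i _; rewrite mxE eqxx mulr1n.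
Qed.

Lemma signature_diag n (Q : 'M[R]_n) d p q r : Q *m Q^T = 1%:M ->
  signature (Q^T *m diag_mx d *m Q) p q r <->
  [/\ #|[set i | 0 < d 0 i]| = p, #|[set i | d 0 i < 0]| = q
    & #|[set i | d 0 i == 0]| = r].
Proof.
move=> QQ; have E := char_poly_diag d QQ.
have cnt (a : pred R) : count a [seq d 0 i | i <- enum 'I_n] = #|[set i | a (d 0 i)]|.
  rewrite count_map -sum1_count -sum1_card big_enum_cond.
  by apply: eq_bigl => i; rewrite inE.
have S0 : signature (Q^T *m diag_mx d *m Q) #|[set i | 0 < d 0 i]|
    #|[set i | d 0 i < 0]| #|[set i | d 0 i == 0]|.
  exists [seq d 0 i | i <- enum 'I_n]; rewrite !cnt; split=> //.
  by rewrite E big_map big_enum.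
split=> [/signature_unique/(_ S0)[-> -> ->]|[<- <- <-]] //.
Qed.

Lemma signature_exists n (S : 'M[R]_n) : S^T = S -> exists p q r, signature S p q r.
Proof.
move=> /real_spectral[Q [d [QQ ->]]]; do 3 eexists.
by apply/(signature_diag _ _ _ _ QQ); split.
Qed.

Lemma signature_sum n (S : 'M[R]_n) p q r : S^T = S -> signature S p q r ->
  (p + q + r = n)%N.
Proof.
move=> /real_spectral[Q [d [QQ ->]]] /(signature_diag _ _ _ _ QQ)[<- <- <-].
rewrite -cardsUI (_ : _ :&: _ = finset.set0); last first.
  apply/finset.setP => i; rewrite !inE; case: ltgtP => //.
rewrite cards0 addn0 -cardsUI (_ : _ :&: _ = finset.set0); last first.
  apply/finset.setP => i; rewrite !inE; case: ltgtP => //.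
rewrite cards0 addn0 (_ : _ :|: _ = [set: 'I_n]) ?cardsT ?card_ord//.
by apply/finset.setP => i; rewrite !inE; case: ltgtP.
Qed.

Lemma signatureN n (S : 'M[R]_n) p q r : S^T = S -> signature S p q r ->
  signature (- S) q p r.
Proof.
move=> /real_spectral[Q [d [QQ ->]]] /(signature_diag _ _ _ _ QQ)[<- <- <-].
have -> : - (Q^T *m diag_mx d *m Q) = Q^T *m diag_mx (- d) *m Q.
  by rewrite linearN /= mulmxN mulNmx.
apply/(signature_diag _ _ _ _ QQ); split; apply: eq_card => i; rewrite !inE mxE.
- by rewrite oppr_gt0.
- by rewrite oppr_lt0.
- by rewrite oppr_eq0.
Qed.

Lemma quad_diag k n (V : 'M[R]_(k, n)) (Q : 'M[R]_n) d (u : 'rV[R]_k) :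
  (u *m (V *m (Q^T *m diag_mx d *m Q) *m V^T) *m u^T) 0 0 =
  \sum_i d 0 i * ((u *m V *m Q^T) 0 i) ^+ 2.
Proof.
have -> : u *m (V *m (Q^T *m diag_mx d *m Q) *m V^T) *m u^T =
    (u *m V *m Q^T) *m diag_mx d *m (u *m V *m Q^T)^T.
  by rewrite !trmx_mul trmxK !mulmxA.
rewrite mxE; apply: eq_bigr => i _; rewrite mul_mx_diag !mxE.
by rewrite expr2; ring.
Qed.

(** Fewer linear conditions than unknowns. This is the only dimension count behind the inertia
    bounds. *)
Lemma vanishing_combination k n (W : 'M[R]_(k, n)) (A : {set 'I_n}) :
  (#|A| < k)%N -> exists2 u : 'rV[R]_k, u != 0 & forall i, i \in A -> (u *m W) 0 i = 0.
Proof.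
move=> Ak; pose W' : 'M[R]_(k, #|A|) := \matrix_(a, b) W a (enum_val b).
have : kermx W' != 0.
  rewrite -mxrank_eq0 mxrank_ker -lt0n subn_gt0.
  exact: leq_ltn_trans (rank_leq_col _) Ak.
move=> /rowV0Pn[u /sub_kermxP uW u0]; exists u => // i iA.
have := congr1 (fun M : 'rV[R]_#|A| => M 0 (enum_rank_in iA i)) uW.
rewrite !mxE => H; apply: etrans H; apply: eq_bigr => a _; rewrite mxE.
by rewrite enum_rankK_in.
Qed.

(** Otherwise some nonzero combination of the rows of V has no component along the p positive
    eigenvectors, and the form is nonpositive on it. *)
Lemma pos_definite_le n (S : 'M[R]_n) p q r k (V : 'M[R]_(k, n)) :
  S^T = S -> signature S p q r -> pos_definite (V *m S *m V^T) -> (k <= p)%N.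
Proof.
move=> /real_spectral[Q [d [QQ ->]]] /(signature_diag _ _ _ _ QQ)[<- _ _] pV.
rewrite leqNgt; apply/negP => /(vanishing_combination (V *m Q^T))[u u0 uW].
have := pV u u0; rewrite quad_diag; apply/negP; rewrite -leNgt.
apply: sumr_le0 => i _; have [di|di] := ltP 0 (d 0 i).
  by rewrite -mulmxA uW ?inE// expr0n /= mulr0.
by rewrite mulr_le0_ge0// sqr_ge0.
Qed.

Lemma pos_definite_ex n (S : 'M[R]_n) p q r :
  S^T = S -> signature S p q r -> exists V : 'M[R]_(p, n), pos_definite (V *m S *m V^T).
Proof.
move=> /real_spectral[Q [d [QQ ->]]] /(signature_diag _ _ _ _ QQ)[<- _ _].
set A := [set i | _]; pose V : 'M[R]_(#|A|, n) := \matrix_(a, j) Q (enum_val a) j.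
exists V => u u0; rewrite quad_diag.
have VQ : V *m Q^T = \matrix_(a, j) (enum_val a == j)%:R.
  apply/matrixP => a j; rewrite !mxE -[RHS](_ : (1%:M : 'M[R]_n) (enum_val a) j = _); last by rewrite mxE.
  by rewrite -QQ !mxE; apply: eq_bigr => b _; rewrite !mxE.
have uVQ (a : 'I_#|A|) : (u *m V *m Q^T) 0 (enum_val a) = u 0 a.
  rewrite -mulmxA VQ !mxE (bigD1 a)//= mxE eqxx mulr1 big1 ?addr0// => b ba.
  by rewrite mxE (inj_eq enum_val_inj) (negbTE ba) mulr0.
have uVQ0 i : i \notin A -> (u *m V *m Q^T) 0 i = 0.
  move=> iA; rewrite -mulmxA VQ !mxE big1// => b _; rewrite mxE.
  case: eqP => [bi|_]; last by rewrite mulr0.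
  by move: iA; rewrite -bi enum_valP.
have /rV0Pn[a ua] := u0.
rewrite lt_neqAle eq_sym andbC sumr_ge0 /=; last first.
  move=> i _; have [iA|iA] := boolP (i \in A); last by rewrite uVQ0// expr0n mulr0.
  by rewrite mulr_ge0 ?sqr_ge0// ltW//; move: iA; rewrite inE.
rewrite psumr_neq0; last first.
  move=> i _; have [iA|iA] := boolP (i \in A); last by rewrite uVQ0// expr0n mulr0.
  by rewrite mulr_ge0 ?sqr_ge0// ltW//; move: iA; rewrite inE.
apply/hasP; exists (enum_val a); first exact: mem_index_enum.
have := enum_valP a; rewrite inE => da.
by rewrite uVQ /= mulr_gt0// lt_neqAle eq_sym sqrf_eq0 ua sqr_ge0.
Qed.

(** The witnesses are the eigenvectors of nonpositive eigenvalues. Independence of the rows is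
    recorded separately, as semidefiniteness does not imply it. *)
Lemma nonpos_ex n (S : 'M[R]_n) p q r : S^T = S -> signature S p q r ->
  exists2 V : 'M[R]_(q + r, n), row_free V &
    forall u : 'rV[R]_(q + r), (u *m (V *m S *m V^T) *m u^T) 0 0 <= 0.
Proof.
move=> /real_spectral[Q [d [QQ ->]]] /(signature_diag _ _ _ _ QQ)[_ <- <-].
rewrite -cardsUI (_ : _ :&: _ = finset.set0); last first.
  by apply/finset.setP => i; rewrite !inE; case: ltgtP.
rewrite cards0 addn0.
set A := _ :|: _; pose V : 'M[R]_(#|A|, n) := \matrix_(a, j) Q (enum_val a) j.
have VQ : V *m Q^T = \matrix_(a, j) (enum_val a == j)%:R.
  apply/matrixP => a j; rewrite !mxE -[RHS](_ : (1%:M : 'M[R]_n) (enum_val a) j = _); last by rewrite mxE.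
  by rewrite -QQ !mxE; apply: eq_bigr => b _; rewrite !mxE.
exists V.
  apply/row_freeP; exists (Q^T *m \matrix_(j, a) (enum_val a == j)%:R).
  rewrite mulmxA VQ; apply/matrixP => a b; rewrite !mxE (bigD1 (enum_val a))//= !mxE eqxx mul1r.
  rewrite big1 ?addr0 ?(inj_eq enum_val_inj) 1?eq_sym// => j ja.
  by rewrite !mxE eq_sym (negbTE ja) mul0r.
move=> u; rewrite quad_diag; apply: sumr_le0 => i _.
have [di|di] := ltP 0 (d 0 i); last by rewrite mulr_le0_ge0// sqr_ge0.
rewrite (_ : (u *m V *m Q^T) 0 i = 0) ?expr0n ?mulr0//.
rewrite -mulmxA VQ !mxE big1// => b _; rewrite mxE.
case: eqP => [bi|_]; last by rewrite mulr0.
have := enum_valP b; rewrite bi !inE => /orP[|]; by case: ltgtP di.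
Qed.

(** If k exceeds q + r, a nonzero combination of the rows has only components along positive
    eigenvectors. The form is then both nonnegative and nonpositive on it, so all components vanish,
    against independence of the rows. *)
Lemma nonpos_le n (S : 'M[R]_n) p q r k (V : 'M[R]_(k, n)) :
  S^T = S -> signature S p q r -> row_free V ->
  (forall u : 'rV[R]_k, (u *m (V *m S *m V^T) *m u^T) 0 0 <= 0) -> (k <= q + r)%N.
Proof.
move=> /real_spectral[Q [d [QQ ->]]] /(signature_diag _ _ _ _ QQ)[_ <- <-] fV nV.
rewrite -cardsUI (_ : _ :&: _ = finset.set0); last first.
  by apply/finset.setP => i; rewrite !inE; case: ltgtP.
rewrite cards0 addn0; set A := _ :|: _.
rewrite leqNgt; apply/negP => /(vanishing_combination (V *m Q^T))[u u0 uW].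
have := nV u; rewrite quad_diag => H.
have pos i : 0 <= d 0 i * ((u *m V *m Q^T) 0 i) ^+ 2.
  have [iA|iA] := boolP (i \in A); first by rewrite -mulmxA uW// expr0n /= mulr0.
  by rewrite mulr_ge0 ?sqr_ge0//; move: iA; rewrite !inE; case: ltgtP.
have E : \sum_i d 0 i * ((u *m V *m Q^T) 0 i) ^+ 2 == 0.
  by rewrite eq_le H sumr_ge0.
move: E; rewrite psumr_eq0// => /allP E.
have uVQ : u *m V *m Q^T = 0.
  apply/rowP => i; rewrite [RHS]mxE; have [iA|iA] := boolP (i \in A).
    by rewrite -mulmxA uW.
  have := E i (mem_index_enum i); rewrite /= mulf_eq0 sqrf_eq0 => /orP[|/eqP//].
  by move: iA; rewrite !inE; case: ltgtP.
have : u *m V = 0.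
  by rewrite -[u *m V]mulmx1 -(mulmx1C QQ) mulmxA uVQ mul0mx.
by move/eqP; rewrite mulmx_free_eq0// (negbTE u0).
Qed.

Lemma pos_definiteN n (S : 'M[R]_n) : pos_definite (- S) <-> neg_definite S.
Proof.
have E v : (v *m (- S) *m v^T) 0 0 = - (v *m S *m v^T) 0 0.
  by rewrite mulmxN mulNmx [LHS]mxE.
by split=> H v v0; have := H v v0; rewrite E oppr_gt0.
Qed.

Lemma neg_definite_ex n (S : 'M[R]_n) p q r :
  S^T = S -> signature S p q r -> exists W : 'M[R]_(q, n), neg_definite (W *m S *m W^T).
Proof.
move=> Ss /(signatureN Ss) /pos_definite_ex[|W HW]; first by rewrite linearN /= Ss.
by exists W; apply/pos_definiteN; move: HW; rewrite mulmxN mulNmx.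
Qed.

Lemma neg_definite_le n (S : 'M[R]_n) p q r k (W : 'M[R]_(k, n)) :
  S^T = S -> signature S p q r -> neg_definite (W *m S *m W^T) -> (k <= q)%N.
Proof.
move=> Ss /(signatureN Ss) sS /pos_definiteN HW.
apply: (pos_definite_le (V := W) _ sS); first by rewrite linearN /= Ss.
by rewrite mulmxN mulNmx.
Qed.

(** The subspaces bound both counts from below, and p + q = n leaves no room for a surplus or for a
    zero eigenvalue. *)
Lemma signature_from_subspaces n (S : 'M[R]_n) p q (V : 'M[R]_(p, n)) (W : 'M[R]_(q, n)) :
  S^T = S -> (p + q = n)%N -> pos_definite (V *m S *m V^T) ->
  neg_definite (W *m S *m W^T) -> signature S p q 0.
Proof.
move=> Ss pq HV HW; have [a [b [c sS]]] := signature_exists Ss.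
have := signature_sum Ss sS.
have := pos_definite_le Ss sS HV; have := neg_definite_le Ss sS HW.
move=> h1 h2 h3; have pa : p = a by lia.
have qb : q = b by lia.
have c0 : c = 0%N by lia.
by subst.
Qed.

Lemma signature_det0 n (S : 'M[R]_n) p q r : S^T = S -> signature S p q r ->
  (\det S == 0) = (0 < r)%N.
Proof.
move=> /real_spectral[Q [d [QQ ->]]] /(signature_diag _ _ _ _ QQ)[_ _ <-].
rewrite !det_mulmx det_diag mulrAC -det_mulmx (mulmx1C QQ) det1 mul1r.
rewrite card_gt0; apply/prodf_eq0/finset.set0Pn => -[j].
  by move=> _ di; exists j; rewrite inE.
by rewrite inE => di; exists j.
Qed.

Lemma signature_det_sign n (S : 'M[R]_n) p q : S^T = S -> signature S p q 0 ->
  0 < (-1) ^+ q * \det S.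
Proof.
move=> /real_spectral[Q [d [QQ ->]]] /(signature_diag _ _ _ _ QQ)[_ <- /eqP].
rewrite cards_eq0 => /eqP/finset.setP d0.
rewrite !det_mulmx det_diag mulrAC -det_mulmx (mulmx1C QQ) det1 mul1r.
rewrite -prodr_const big_mkcond /=.
rewrite -big_split /=; apply: prodr_gt0 => i _.
by have := d0 i; rewrite !inE; case: (ltgtP (d 0 i) 0) => // di _; rewrite ?mulN1r ?oppr_gt0 ?mul1r.
Qed.

End Inertia.

(** * Bordered matrices and division by the radical *)

Section Blocks.
Context {R : realType}.
Implicit Types n m k p q r : nat.

(** Two Laplace expansions: along the first column, then of each remaining minor along its row lam.
    The second minors are minors of z, and the signs assemble to its cofactors. *)
Lemma det_bordered n (rho : R) (lam : 'rV[R]_n) (z : 'M[R]_n) : z^T = z ->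
  \det (block_mx rho%:M lam lam^T z) = rho * \det z - (lam *m \adj z *m lam^T) 0 0.
Proof.
move=> zs; case: n lam z zs => [|n] lam z zs.
  have -> : lam = 0 by apply/rowP => -[].
  by rewrite trmx0 det_ublock !det_mx00 det_scalar1 !mul0mx mxE subr0.
have [L LE] : exists L : 'M[R]_(1 + n.+1), L = block_mx rho%:M lam lam^T z by eexists.
rewrite -LE.
have l0 : (0 : 'I_(1 + n.+1)) = lshift n.+1 (0 : 'I_1) by exact: val_inj.
have lr (c : 'I_n.+1) : lift (0 : 'I_(1 + n.+1)) c = rshift 1 c by exact: val_inj.
have e00 : L 0 0 = rho by rewrite LE l0 block_mxEul mxE eqxx mulr1n.
have e0r (k : 'I_n.+1) : L 0 (lift 0 k) = lam 0 k by rewrite LE lr l0 block_mxEur.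
have er0 (k : 'I_n.+1) : L (lift 0 k) 0 = lam 0 k by rewrite LE lr l0 block_mxEdl mxE.
have err (j k : 'I_n.+1) : L (lift 0 j) (lift 0 k) = z j k by rewrite LE !lr block_mxEdr.
clear LE lr l0.
rewrite (expand_det_col L 0) big_ord_recl e00; congr (_ + _).
  rewrite /cofactor addn0 expr0 mul1r; congr (_ * \det _).
  by apply/matrixP => a b; rewrite !mxE err.
rewrite !mxE -sumrN; apply: eq_bigr => j _.
rewrite er0 [lam^T j 0]mxE mulrC -mulNr; congr (_ * _).
rewrite /cofactor (expand_det_row _ (0 : 'I_n.+1)) mxE -sumrN mulr_sumr.
apply: eq_bigr => k _; rewrite !mxE /cofactor.
have -> : lift (lift 0 j) 0 = 0 :> 'I_(1 + n.+1) by exact: val_inj.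
rewrite e0r.
have -> : row' 0 (col' k (row' (lift 0 j) (col' 0 L))) = row' j (col' k z).
  apply/matrixP => a b; rewrite !mxE -err; congr (L _ _).
  by apply: val_inj; rewrite /= /bump /= !add1n ltnS addnS.
have -> : (lift 0 j : nat) = j.+1 by [].
rewrite /= !add0n addn0 exprS exprD; ring.
Qed.

Lemma tr_bordered n (rho : R) (lam : 'rV[R]_n) (z : 'M[R]_n) : z^T = z ->
  (block_mx rho%:M lam lam^T z)^T = block_mx rho%:M lam lam^T z.
Proof. by move=> zs; rewrite tr_block_mx trmxK tr_scalar_mx zs. Qed.

(** This exhibits z as the restriction of the bordered form to the hyperplane of vectors (0, v), so
    subspaces for z become subspaces for the bordered form. *)
Lemma bordered_restrict n k (rho : R) (lam : 'rV[R]_n) (z : 'M[R]_n) (V : 'M[R]_(k, n)) :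
  row_mx 0 V *m block_mx rho%:M lam lam^T z *m (row_mx 0 V)^T = V *m z *m V^T.
Proof.
by rewrite mul_row_block tr_row_mx !mul0mx !add0r mul_row_col trmx0 mulmx0 add0r.
Qed.

(** Let (a, b, c) be the signature of z. Subspaces for z remain such for the bordered form, so a + c
    <= p + 1 and b + c <= q + 1; with a + b + c = p + q + 1 only (p + 1, q, 0), (p, q + 1, 0) and
    (p, q, 1) survive. The determinant has sign (-1)^b or is 0, which selects one of them. *)
Lemma signature_bordered n (rho : R) (lam : 'rV[R]_n) (z : 'M[R]_n) p q : z^T = z ->
  signature (block_mx rho%:M lam lam^T z) p.+1 q.+1 0 ->
  [/\ (p + q).+1 = n,
      \det z = 0 -> signature z p q 1,
      0 < (-1) ^+ q * \det z -> signature z p.+1 q 0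
    & (-1) ^+ q * \det z < 0 -> signature z p q.+1 0].
Proof.
move=> zs sL; have Ls := tr_bordered rho lam zs.
set L := block_mx _ _ _ _ in sL Ls.
have [a [b [c sz]]] := signature_exists zs.
have s1 := signature_sum Ls sL; have s2 := signature_sum zs sz.
have nz : (- z)^T = - z by rewrite linearN /= zs.
have rfree k (V : 'M[R]_(k, n)) : row_free V -> row_free (row_mx (0 : 'M[R]_(k, 1)) V).
  by move=> /row_freeP[B VB]; apply/row_freeP; exists (col_mx 0 B); rewrite mul_row_col mul0mx add0r.
have nL : (- L)^T = - L by rewrite linearN /= Ls.
have ap : (a <= p.+1)%N.
  have [V HV] := pos_definite_ex zs sz.
  by apply: (pos_definite_le (V := row_mx 0 V) Ls sL); rewrite bordered_restrict.
have bq : (b <= q.+1)%N.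
  have [V HV] := neg_definite_ex zs sz.
  by apply: (neg_definite_le (W := row_mx 0 V) Ls sL); rewrite bordered_restrict.
have bc : (b + c <= q.+1 + 0)%N.
  have [V fV HV] := nonpos_ex zs sz.
  apply: (nonpos_le (V := row_mx 0 V) Ls sL); first exact: rfree.
  by move=> u; rewrite bordered_restrict.
have ac : (a + c <= p.+1 + 0)%N.
  have [V fV HV] := nonpos_ex nz (signatureN zs sz).
  apply: (nonpos_le (V := row_mx 0 V) nL (signatureN Ls sL)); first exact: rfree.
  move=> u; rewrite mulmxN mulNmx bordered_restrict.
  by have := HV u; rewrite mulmxN mulNmx.
have d0 := signature_det0 zs sz.
have H : (a = p.+1 /\ b = q /\ c = 0)%N \/ (a = p /\ b = q.+1 /\ c = 0)%N \/
    (a = p /\ b = q /\ c = 1)%N by lia.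
split; first by lia.
- by move=> /eqP; rewrite d0; case: H => [[h1 [h2 h3]]|[[h1 [h2 h3]]|[h1 [h2 h3]]]]; rewrite h1 h2 h3 in sz *.
- case: H => [[<- [<- <-]]//|[[h1 [h2 h3]]|[h1 [h2 h3]]]].
    rewrite h1 h2 h3 in sz; have := signature_det_sign zs sz.
    by rewrite exprS mulN1r mulNr oppr_gt0 => h /(lt_trans h); rewrite ltxx.
  by move: d0; rewrite h3 => /eqP ->; rewrite mulr0 ltxx.
- case: H => [[h1 [h2 h3]]|[[<- [<- <-]]//|[h1 [h2 h3]]]].
    rewrite h1 h2 h3 in sz; have := signature_det_sign zs sz.
    by move=> h /(lt_trans h); rewrite ltxx.
  by move: d0; rewrite h3 => /eqP ->; rewrite mulr0 ltxx.
Qed.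

(** S T S = S with S symmetric, so S and T are congruent; definite subspaces of S are transported by
    S. *)
Lemma signature_inverse n (S T : 'M[R]_n) p q : S^T = S -> T *m S = 1%:M ->
  signature S p q 0 -> signature T p q 0.
Proof.
move=> Ss TS sS; have ST := mulmx1C TS.
have Ts : T^T = T.
  rewrite -[LHS]mulmx1 -ST mulmxA -{1}Ss -trmx_mul ST trmx1 mul1mx//.
have [V HV] := pos_definite_ex Ss sS; have [W HW] := neg_definite_ex Ss sS.
have pq := signature_sum Ss sS; rewrite addn0 in pq.
apply: (signature_from_subspaces (V := V *m S) (W := W *m S)) => //.
- by rewrite trmx_mul Ss -!mulmxA (mulmxA T) TS mul1mx mulmxA.
- by rewrite trmx_mul Ss -!mulmxA (mulmxA T) TS mul1mx mulmxA.
Qed.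

Lemma signatureZ n (S : 'M[R]_n) p q (k : R) : S^T = S -> 0 < k ->
  signature S p q 0 -> signature (k *: S) p q 0.
Proof.
move=> Ss k0 sS.
have [V HV] := pos_definite_ex Ss sS; have [W HW] := neg_definite_ex Ss sS.
have pq := signature_sum Ss sS; rewrite addn0 in pq.
have E m (U : 'M[R]_(m, n)) v : (v *m (U *m (k *: S) *m U^T) *m v^T) 0 0 =
    k * (v *m (U *m S *m U^T) *m v^T) 0 0.
  by rewrite -scalemxAr -!scalemxAl -scalemxAr -scalemxAl [LHS]mxE.
apply: (signature_from_subspaces (V := V) (W := W)) => //.
- by rewrite linearZ /= Ss.
- by move=> v v0; rewrite E mulr_gt0// HV.
- by move=> v v0; rewrite E pmulr_rlt0// HW.
Qed.

Lemma mulmx_drop m n k i (A : 'M[R]_(m, n)) (B : 'M[R]_(n, k)) : row i B = 0 ->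
  A *m B = col' i A *m row' i B.
Proof.
move=> Bi; apply/matrixP => a b; rewrite !mxE (bigD1_ord i)//=.
have -> : B i b = 0 by move/rowP: Bi => /(_ b); rewrite !mxE.
by rewrite mulr0 add0r; apply: eq_bigr => j _; rewrite !mxE.
Qed.

(** The i-th basis covector lies in the radical of z, so the form descends to the quotient by it,
    where the i-th column of A is forgotten. *)
Lemma sandwich_drop m n i (A : 'M[R]_(m, n)) (z : 'M[R]_n) : z^T = z -> row i z = 0 ->
  A *m z *m A^T = col' i A *m row' i (col' i z) *m (col' i A)^T.
Proof.
move=> zs zi; have zi' : row i (row' i z)^T = 0.
  apply/rowP => j; rewrite !mxE -[z]zs mxE.
  by move/rowP: zi => /(_ (lift i j)); rewrite !mxE.
rewrite (mulmx_drop _ zi) -mulmxA.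
rewrite -[row' i z *m A^T]trmxK trmx_mul trmxK (mulmx_drop _ zi') trmx_mul mulmxA.
congr (_ *m _ *m _); apply/matrixP => a b; rewrite !mxE.
by rewrite -[in RHS]zs mxE -[in LHS]zs mxE.
Qed.

(** Definite subspaces survive in the quotient by the radical line, and p + q = n - 1 fills its
    dimension. *)
Lemma signature_drop n i (z : 'M[R]_n) p q : z^T = z -> row i z = 0 ->
  signature z p q 1 -> signature (row' i (col' i z)) p q 0.
Proof.
move=> zs zi sz; have := signature_sum zs sz => pq.
have [V HV] := pos_definite_ex zs sz; have [W HW] := neg_definite_ex zs sz.
apply: (signature_from_subspaces (V := col' i V) (W := col' i W)).
- by apply/matrixP => a b; rewrite !mxE -[in LHS]zs mxE.
- by rewrite -pq addn1.
- by rewrite -sandwich_drop.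
- by rewrite -sandwich_drop.
Qed.

Lemma pos_definite_unit n (S : 'M[R]_n) : pos_definite S -> S \in unitmx.
Proof.
move=> HS; rewrite unitmxE unitfE; apply/det0P => -[v v0 vS].
by have := HS v v0; rewrite vS mul0mx mxE ltxx.
Qed.

Lemma pos_definite_inverse n (S T : 'M[R]_n) : S^T = S -> T *m S = 1%:M ->
  pos_definite S -> pos_definite T.
Proof.
move=> Ss TS HS v v0; have ST := mulmx1C TS.
have Ts : T^T = T.
  by rewrite -[LHS]mulmx1 -ST mulmxA -{1}Ss -trmx_mul ST trmx1 mul1mx.
have w0 : v *m T != 0.
  by apply: contra v0 => /eqP E; rewrite -[v]mulmx1 -TS mulmxA E mul0mx.
have := HS _ w0; rewrite trmx_mul Ts -!mulmxA (mulmxA S) ST mul1mx.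
by [].
Qed.

Lemma pos_definiteZ n (S : 'M[R]_n) (k : R) : 0 < k -> pos_definite S -> pos_definite (k *: S).
Proof.
by move=> k0 HS v v0; rewrite -scalemxAr -scalemxAl mxE mulr_gt0// HS.
Qed.

Lemma pos_definite_bordered n (rho : R) (lam : 'rV[R]_n) (z : 'M[R]_n) :
  pos_definite (block_mx rho%:M lam lam^T z) -> pos_definite z.
Proof.
move=> H v v0; rewrite -(bordered_restrict rho lam); apply: H.
by rewrite row_mx_eq0 eqxx.
Qed.

End Blocks.

(** * Charts and weights *)

Section ChartTheory.
Context {R : realType} {n : nat} {M : topologicalType}.
Implicit Types (c : chart R n M) (N S : set M) (x y : M) (u v : 'rV[R]_n).

Lemma coordsE c N u : coords c N u <-> (cmap c @` dom c) u /\ N (cinv c u).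
Proof.
split=> [[x [dx Nx] <-]|[[x dx <-]]].
  by rewrite cmapK//; split=> //; exists x.
by rewrite cmapK// => Nx; exists x.
Qed.

Lemma coords_dom c N x : dom c x -> N x -> coords c N (cmap c x).
Proof. by move=> dx Nx; exists x. Qed.

Lemma cinv_coords c N u : coords c N u ->
  [/\ dom c (cinv c u), N (cinv c u) & cmap c (cinv c u) = u].
Proof. by move=> [x [dx Nx] <-]; rewrite cmapK. Qed.

Lemma coords_open c N : open N -> open (coords c N).
Proof.
move=> oN; rewrite openE => u /coordsE[iu Nu].
have n1 : \forall v \near u, (cmap c @` dom c) v.
  by apply: open_nbhs_nbhs; split=> //; exact: image_open.
have n2 : \forall v \near u, N (cinv c v).
  have := cinv_continuous iu; apply; exact: open_nbhs_nbhs.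
by apply: filterS2 n1 n2 => v h1 h2; apply/coordsE.
Qed.

Lemma coordsT_open c : open (coords c setT).
Proof. exact: coords_open openT. Qed.

Lemma coords_sub c N N' : N `<=` N' -> coords c N `<=` coords c N'.
Proof. by move=> NN u [x [dx /NN Nx] <-]; exists x. Qed.

Lemma coordsT c N : coords c N `<=` coords c setT.
Proof. exact: coords_sub. Qed.

Lemma transE c c' x : dom c x -> trans c c' (cmap c x) = cmap c' x.
Proof. by move=> dx; rewrite /trans /= cmapK. Qed.

Lemma trans_coords c c' N u : coords c (dom c' `&` N) u ->
  coords c' (dom c `&` N) (trans c c' u).
Proof. by move=> [x [dx [dx' Nx]] <-]; rewrite transE//; exists x. Qed.

Lemma differentiable_rV k m (f : 'rV[R]_k -> 'rV[R]_m) (u : 'rV[R]_k) :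
  (forall j, differentiable (fun v : 'rV[R]_k => f v 0 j) u) -> differentiable f u.
Proof.
move=> df; rewrite (_ : f = \sum_j (fun v : 'rV[R]_k => f v 0 j *: (delta_mx 0 j : 'rV[R]_m))).
  apply: differentiable_sum => j; apply: differentiableZl; exact: df.
apply/funext => v; rewrite fct_sumE; exact: row_sum_delta.
Qed.

Lemma pd_comp m (U : set 'rV[R]_m) (f : 'rV[R]_n -> 'rV[R]_m) (g : 'rV[R]_m -> R)
    (O : set 'rV[R]_n) a u :
  open O -> Ck 1 O f -> O u -> open U -> Ck 1 U g -> U (f u) ->
  pd a (g \o f) u = \sum_k ('J f u) a k * pd k g (f u).
Proof.
move=> oO Cf Ou oU Cg Ufu.
have df v : derivable f u v by have [_ H] := Cf; have [h _] := H v; exact: h.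
have dif : differentiable f u.
  apply: differentiable_rV => j.
  by have [] := Ck1_differentiable oO ((Ck_mxP _ _ oO).1 Cf 0 j) Ou.
have [_ E] := is_derive_comp oU Cg Ufu (df (delta_mx 0 a)).
rewrite /pd E; apply: eq_bigr => k _; congr (_ * _).
by rewrite deriveEjacobian// -rowE mxE.
Qed.

End ChartTheory.

(** * Arithmetic of density weights *)

Section WeightFactor.
Context {R : realType} {n : nat} {M : topologicalType}.
Implicit Types (c : chart R n M) (u : 'rV[R]_n).

Lemma weight_factor_gt0 w c c' u : \det (jac c c' u) != 0 -> 0 < weight_factor w c c' u.
Proof. by move=> d0; rewrite /weight_factor powR_gt0// lt_neqAle sqr_ge0 eq_sym sqrf_eq0 d0. Qed.

(** A real power of 0 with nonzero exponent is 0, so a nonvanishing weight factor detects an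
    invertible Jacobian. *)
Lemma weight_factor_det w c c' u : w != 0 -> weight_factor w c c' u != 0 ->
  \det (jac c c' u) != 0.
Proof.
move=> w0; apply: contraNneq => d0; rewrite /weight_factor d0 expr0n /= powR0//.
by rewrite mulf_neq0// invr_eq0 pnatr_eq0 addn2.
Qed.

Lemma weight_factorD w w' c c' u : \det (jac c c' u) != 0 ->
  weight_factor w c c' u * weight_factor w' c c' u = weight_factor (w + w') c c' u.
Proof.
move=> d0; rewrite /weight_factor -powRD ?mulrDl//.
by rewrite sqrf_eq0 d0 implybT.
Qed.

Lemma weight_factor0 c c' u : weight_factor 0 c c' u = 1.
Proof. by rewrite /weight_factor mul0r powRr0. Qed.

Lemma weight_factor2n2 c c' u :
  weight_factor (2 * n + 2)%N%:R c c' u = (\det (jac c c' u)) ^+ 2.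
Proof.
by rewrite /weight_factor divff ?powRr1 ?sqr_ge0// pnatr_eq0 addn2.
Qed.

Lemma weight_factorX w k c c' u : \det (jac c c' u) != 0 ->
  weight_factor w c c' u ^+ k = weight_factor (k%:R * w) c c' u.
Proof.
move=> d0; elim: k => [|k IH]; first by rewrite expr0 mul0r weight_factor0.
by rewrite exprS IH weight_factorD// mulrSr mulrDl mul1r addrC.
Qed.

End WeightFactor.

(** * The metrizability equation *)

Section Metrizability.
Context {R : realType} {n : nat} {M : topologicalType}.
Variables (A : set (chart R n M)) (nabla : @connection_field R n M)
  (zeta : @matrix_field R n M).
Hypotheses (hz : sym_bivector_density A (-2) zeta)
  (hm : metrizability A nabla zeta).
Implicit Types (c : chart R n M) (u : 'rV[R]_n) (e : 'I_n).

Let lam c u : 'rV[R]_n := tractor_lambda nabla zeta c u.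
Definition conn_mx (G : @connection_field R n M) c u e : 'M[R]_n := \matrix_(a, d) G c u a e d.
Definition det_field c u : R := \det (zeta c u).

Lemma zeta_smooth c i j : A c -> smooth (coords c setT) (fun u => zeta c u i j).
Proof. by move=> Ac; case: hz => H _ _; exact: H. Qed.

Lemma zeta_sym c u : A c -> coords c setT u -> (zeta c u)^T = zeta c u.
Proof. by move=> Ac cu; case: hz => _ H _; exact: H. Qed.

Lemma det_field_smooth c : A c -> smooth (coords c setT) (det_field c).
Proof.
by move=> Ac k; apply: Ck_det; [exact: coordsT_open|move=> i j; exact: zeta_smooth].
Qed.

Lemma smooth_derivable (U : set 'rV[R]_n) (f : 'rV[R]_n -> R) u w :
  smooth U f -> U u -> derivable f u w.
Proof. by move=> sf Uu; have [_ H] := sf 1; have [h _] := H w; exact: h. Qed.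

Lemma smooth_is_derive (U : set 'rV[R]_n) (f : 'rV[R]_n -> R) u w :
  smooth U f -> U u -> is_derive u w f ('D_w f u).
Proof. by move=> sf Uu; apply: derivableP; exact: smooth_derivable Uu. Qed.

Lemma smooth_pd (U : set 'rV[R]_n) (f : 'rV[R]_n -> R) e :
  smooth U f -> smooth U (pd e f).
Proof. by move=> sf k; have [_ H] := sf k.+1; have [_ h] := H (delta_mx 0 e). Qed.

Lemma trace_conn_mx G c u e : \tr (conn_mx G c u e) = \sum_d G c u d e d.
Proof. by apply: eq_bigr => d _; rewrite mxE. Qed.

Lemma cov_bivector_sym c u e a b : A c -> coords c setT u ->
  cov_bivector nabla (-2) zeta c u e a b = cov_bivector nabla (-2) zeta c u e b a.
Proof.
move=> Ac cu; have zs w : coords c setT w -> forall i j, zeta c w i j = zeta c w j i.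
  by move=> cw i j; rewrite -[in LHS](zeta_sym Ac cw) mxE.
rewrite /cov_bivector (zs u cu b a); congr (_ + _).
rewrite -!addrA; congr (_ + _).
  apply: near_eq_derive.
  exact: (@eq_near_open R 'rV[R]_n R _ (fun v => zeta c v a b)
    (fun v => zeta c v b a) u (@coordsT_open _ _ _ c) cu (fun w cw => zs w cw a b)).
rewrite addrC; congr (_ + _); apply: eq_bigr => d _; congr (_ * _); exact: zs.
Qed.

Lemma cov_zeta c u e a b : A c -> coords c setT u ->
  cov_bivector nabla (-2) zeta c u e a b =
  - ((a == e)%:R * lam c u 0 b) - (b == e)%:R * lam c u 0 a.
Proof.
move=> Ac cu; have := hm Ac cu e a b; rewrite /lam /tractor_lambda /divergence !mxE.
rewrite (eq_bigr (fun d => cov_bivector nabla (-2) zeta c u d b d)); last first.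
  by move=> d _; exact: cov_bivector_sym.
set x := cov_bivector _ _ _ _ _ _ _ _; set s1 := \sum_(d < n) _; set s2 := \sum_(d < n) _.
by move=> H; apply: subr0_eq; rewrite -[RHS]H; ring.
Qed.

(** The matrix form allows traces against the adjugate to be taken without indices. The trace term
    comes from the weight - 2. *)
Lemma pd_zeta c u e : A c -> coords c setT u ->
  \matrix_(a, b) pd e (fun v => zeta c v a b) u =
  - (conn_mx nabla c u e *m zeta c u) - zeta c u *m (conn_mx nabla c u e)^T
  + (2 / n.+1%:R * \tr (conn_mx nabla c u e)) *: zeta c u
  - (delta_mx 0 e)^T *m lam c u - (lam c u)^T *m delta_mx 0 e.
Proof.
move=> Ac cu; apply/matrixP => a b; have := cov_zeta e a b Ac cu.
rewrite /cov_bivector /weight_term -trace_conn_mx !mxE !big_ord1 !mxE !eqxx /=.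
rewrite -/(lam c u) (eq_bigr (fun d => conn_mx nabla c u e a d * zeta c u d b)); last first.
  by move=> d _; rewrite mxE.
rewrite [X in _ + X + _](eq_bigr (fun d => zeta c u a d * (conn_mx nabla c u e)^T d b)); last first.
  by move=> d _; rewrite !mxE mulrC.
set x := pd _ _ _ => H.
move/eqP: H; rewrite -subr_eq0 => /eqP H.
by apply: subr0_eq; rewrite -[RHS]H; ring.
Qed.

Lemma adj_sym (Z : 'M[R]_n) : Z^T = Z -> (\adj Z)^T = \adj Z.
Proof. by move=> Zs; rewrite trmx_adj Zs. Qed.

Lemma pd_det c u e : A c -> coords c setT u ->
  pd e (det_field c) u =
  - (2 / n.+1%:R * \tr (conn_mx nabla c u e)) * det_field c u
  - 2 * (lam c u *m \adj (zeta c u)) 0 e.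
Proof.
move=> Ac cu.
have D i j : is_derive u (delta_mx 0 e : 'rV[R]_n) (fun v => zeta c v i j)
    ((\matrix_(a, b) pd e (fun v => zeta c v a b) u) i j).
  by rewrite mxE; exact: smooth_is_derive (zeta_smooth i j Ac) cu.
have [_ E] := is_derive_det D; apply: etrans E _; rewrite pd_zeta//.
set G := conn_mx _ _ _ _; set Z := zeta c u; set l := lam c u; set t := \tr G.
have Zs : Z^T = Z by exact: zeta_sym.
have As := adj_sym Zs.
rewrite !(mulmxBr, mulmxDr, mulmxN) !(raddfB, raddfD, raddfN) /=.
have -> : \tr (\adj Z *m (G *m Z)) = \det Z * t.
  by rewrite mulmxA mxtrace_mulC mulmxA mul_mx_adj mul_scalar_mx linearZ.
have -> : \tr (\adj Z *m (Z *m G^T)) = \det Z * t.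
  by rewrite mulmxA mul_adj_mx mul_scalar_mx linearZ /= mxtrace_tr.
have -> : \tr (\adj Z *m ((2 / n.+1%:R * t) *: Z)) = 2 / n.+1%:R * t * (n%:R * \det Z).
  by rewrite -scalemxAr mul_adj_mx linearZ /= mxtrace_scalar -[X in _ * X]mulr_natl.
have -> : \tr (\adj Z *m ((delta_mx 0 e)^T *m l)) = (l *m \adj Z) 0 e.
  by rewrite mulmxA mxtrace_mulC mulmxA trmx_delta -colE /mxtrace big_ord1 mxE.
have -> : \tr (\adj Z *m (l^T *m delta_mx 0 e)) = (l *m \adj Z) 0 e.
  rewrite mulmxA -mxtrace_tr !trmx_mul trmxK As trmx_delta mxtrace_mulC.
  by rewrite -colE /mxtrace big_ord1 mxE.
rewrite /det_field -/Z; have n0 : n.+1%:R != 0 :> R by rewrite pnatr_eq0.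
have -> : n%:R = n.+1%:R - 1 :> R by rewrite -[n.+1%:R]natr1 addrK.
have key (x m y s : R) : m != 0 -> - (x * s) - x * s + 2 / m * s * ((m - 1) * x) - y - y =
    - (2 / m * s) * x - 2 * y by move=> m0; field.
exact: key.
Qed.

End Metrizability.

Section SignedPart.
Context {R : realType}.
Implicit Types V : normedModType R.

Lemma open_pos V (U : set V) (g : V -> R) : open U ->
  (forall x, U x -> {for x, continuous g}) -> open (U `&` [set y | 0 < g y]).
Proof.
move=> oU cg; rewrite openE => x [Ux gx].
have n1 : \forall y \near x, U y by exact: open_nbhs_nbhs.
have n2 : \forall y \near x, 0 < g y by exact: (cvgr_gt _ (cg x Ux) _ gx).
by apply: filterS2 n1 n2.
Qed.

Lemma sg_mul_local V (U : set V) (f : V -> R) x : open U -> smooth U f -> U x ->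
  f x != 0 ->
  exists U', [/\ open U', U' x, U' `<=` U &
    forall y, U' y -> f y != 0 /\ Num.sg (f y) = Num.sg (f x)].
Proof.
move=> oU sf Ux fx0; exists (U `&` [set y | 0 < Num.sg (f x) * f y]); split.
- apply: open_pos => // y Uy; apply: cvgMl_tmp; exact: (Ck_cont (sf 0) Uy).
- by split=> //=; rewrite -normrEsg normr_gt0.
- by move=> y [].
- move=> y [Uy] /=; case: (sgrP (f x)) fx0 => // h _; rewrite ?mul1r ?mulN1r ?oppr_gt0 => fy.
    by rewrite gtr0_sg// gt_eqF.
  by rewrite ltr0_sg// lt_eqF.
Qed.

Lemma smooth_sg_mul V (U : set V) (f : V -> R) : open U -> smooth U f ->
  (forall x, U x -> f x != 0) -> smooth U (fun x => Num.sg (f x) * f x).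
Proof.
move=> oU sf f0 k; apply: Ck_local => x Ux.
have [U' [oU' U'x U'U H]] := sg_mul_local oU sf Ux (f0 x Ux).
exists U' => //.
refine (eq_Ck oU' (f := fun y => Num.sg (f x) * f y) _ _).
  by move=> y /H[_ ->].
by apply: CkM => //; [exact: Ck_cst|exact: Ck_sub U'U (sf k)].
Qed.

Lemma smoothD V (U : set V) (f g : V -> R) : open U -> smooth U f -> smooth U g ->
  smooth U (fun x => f x + g x).
Proof. by move=> oU sf sg k; apply: CkD. Qed.

Lemma smoothM V (U : set V) (f g : V -> R) : open U -> smooth U f -> smooth U g ->
  smooth U (fun x => f x * g x).
Proof. by move=> oU sf sg k; apply: CkM. Qed.

Lemma smooth_cst V (U : set V) (a : R) : smooth U (fun _ : V => a).
Proof. by move=> k; exact: Ck_cst. Qed.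

Lemma smooth_sum V (U : set V) (I : Type) (r : seq I) (P : pred I) (f : I -> V -> R) :
  open U -> (forall i, smooth U (f i)) -> smooth U (fun x => \sum_(i <- r | P i) f i x).
Proof. by move=> oU sf k; apply: Ck_sum => // i; exact: sf. Qed.

Lemma smoothV V (U : set V) (f : V -> R) : open U -> (forall x, U x -> f x != 0) ->
  smooth U f -> smooth U (fun x => (f x)^-1).
Proof. by move=> oU f0 sf k; apply: CkV. Qed.

Lemma smooth_sub V (U U' : set V) (f : V -> R) : U' `<=` U -> smooth U f -> smooth U' f.
Proof. by move=> UU sf k; exact: Ck_sub UU (sf k). Qed.

Lemma eq_smooth V (U : set V) (f g : V -> R) : open U -> (forall x, U x -> f x = g x) ->
  smooth U f -> smooth U g.
Proof. by move=> oU fg sf k; exact: eq_Ck oU fg (sf k). Qed.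

End SignedPart.

(** * The induced metric and its Levi-Civita connection *)

Section LeviCivita.
Context {R : realType} {n : nat} {M : topologicalType}.
Variables (A : set (chart R n M)) (nabla : @connection_field R n M)
  (zeta : @matrix_field R n M).
Hypotheses (hz : sym_bivector_density A (-2) zeta)
  (hm : metrizability A nabla zeta).
Implicit Types (c : chart R n M) (u : 'rV[R]_n) (e : 'I_n).

Let lam c u : 'rV[R]_n := tractor_lambda nabla zeta c u.
Let D := det_field zeta.

(** For each s, reindexing t by s turns the inner sum into a determinant; there are n! choices of s.
    The constant n! rescales the metric and does not affect its Levi-Civita connection. *)
Lemma det_densityE c u : det_density zeta c u = (n`!)%:R * D c u.
Proof.
rewrite /det_density (eq_bigr (fun=> D c u)); last first.
  move=> s _; rewrite /D /det_field /determinant.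
  rewrite (reindex_inj (mulgI s)) /=; apply: eq_bigr => t _.
  rewrite odd_permM signr_addb mulrA -expr2 sqrr_sign mul1r; congr (_ * _).
  rewrite (reindex_inj (@perm_inj _ (s^-1)%g)) /=; apply: eq_bigr => i _.
  by rewrite permM permKV.
by rewrite sumr_const card_Sn mulr_natl.
Qed.

(* For a volume density V preserved by nabla this is
   - d log (|det zeta|^(1/2) V^(1/(n+1))). *)
Definition upsilon c u e : R :=
  - (pd e (D c) u / (2 * D c u)) - n.+1%:R^-1 * \tr (conn_mx nabla c u e).

Definition projective_change (G : @connection_field R n M)
    (Y : chart R n M -> 'rV[R]_n -> 'I_n -> R) : @connection_field R n M :=
  fun c u k i j => G c u k i j + Y c u i * (k == j)%:R + Y c u j * (k == i)%:R.

(** The trace terms of [pd_det] and of [upsilon] cancel, which leaves the form lam zeta^-1. *)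
Lemma upsilonE c u e : A c -> coords c setT u -> D c u != 0 ->
  upsilon c u e = (lam c u *m \adj (zeta c u)) 0 e / D c u.
Proof.
move=> Ac cu D0; rewrite /upsilon (pd_det hz hm)// -/D /= -/(lam c u).
have n0 : n.+1%:R != 0 :> R by rewrite pnatr_eq0.
have key (m x y t : R) : m != 0 -> x != 0 ->
  - ((- (2 / m * t) * x - 2 * y) / (2 * x)) - m^-1 * t = y / x by move=> m0 x0; field; rewrite ?m0 ?x0.
exact: key.
Qed.

Lemma upsilon_zeta c u : A c -> coords c setT u -> D c u != 0 ->
  (\row_e upsilon c u e) *m zeta c u = lam c u.
Proof.
move=> Ac cu D0.
have -> : \row_e upsilon c u e = (D c u)^-1 *: (lam c u *m \adj (zeta c u)).
  by apply/rowP => e; rewrite [LHS]mxE upsilonE// [RHS]mxE mulrC.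
by rewrite -scalemxAl -mulmxA mul_adj_mx mul_mx_scalar scalerA mulVf// scale1r.
Qed.

Let G' := projective_change nabla upsilon.
Let h := induced_inverse_metric zeta.

Lemma conn_mx_change c u e : conn_mx G' c u e =
  conn_mx nabla c u e + (upsilon c u e)%:M + (delta_mx 0 e)^T *m \row_d upsilon c u d.
Proof.
apply/matrixP => a d; rewrite !mxE big_ord1 !mxE eqxx /= /G' /projective_change.
by rewrite mulr_natr mulrC.
Qed.

Lemma sg_det_density c u : Num.sg (det_density zeta c u) * det_density zeta c u =
  (n`!)%:R * (Num.sg (D c u) * D c u).
Proof.
rewrite det_densityE sgrM (gtr0_sg (x := (n`!)%:R)) ?ltr0n ?fact_gt0//.
by rewrite mul1r mulrCA.
Qed.

(** This says that the changed connection annihilates the inverse metric. There is no trace term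
    because the weights of tau and zeta cancel. *)
Lemma pd_induced c u e : A c -> coords c setT u -> D c u != 0 ->
  \matrix_(a, b) pd e (fun v => h c v a b) u =
  - (conn_mx G' c u e *m h c u) - h c u *m (conn_mx G' c u e)^T.
Proof.
move=> Ac cu D0.
(* The sign of D is constant near u, so the inverse metric is there the constant K times D zeta. *)
pose K : R := (n`!)%:R * Num.sg (D c u).
have [U' [oU' U'u U'U H]] :=
  sg_mul_local (@coordsT_open _ _ _ c) (det_field_smooth hz Ac) cu D0.
have hE v : U' v -> h c v = (K * D c v) *: zeta c v.
  move=> /H[_ E]; rewrite /h /induced_inverse_metric sg_det_density /K mulrA.
  by rewrite -/(D c v) in E; rewrite E.
have dE : \matrix_(a, b) pd e (fun v => h c v a b) u =
    (K * pd e (D c) u) *: zeta c u +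
    (K * D c u) *: \matrix_(a, b) pd e (fun v => zeta c v a b) u.
  apply/matrixP => a b; rewrite !mxE.
  have -> : pd e (fun v => h c v a b) u = pd e (fun v => (K * D c v) * zeta c v a b) u.
    apply: near_eq_derive; apply: (@eq_near_open R 'rV[R]_n R U') => // v U'v.
    by rewrite hE// mxE.
  have dz := smooth_is_derive (delta_mx 0 e) (zeta_smooth hz a b Ac) cu.
  have dD := smooth_is_derive (delta_mx 0 e) (det_field_smooth hz Ac) cu.
  have [_ E] := is_derive_mulf (is_derive_mulf (is_derive_cst K u (delta_mx 0 e : 'rV[R]_n)) dD) dz.
  apply: etrans E _; rewrite mulr0 addr0 /cst addrC.
  by rewrite [zeta c u a b * _]mulrC.
rewrite dE (pd_zeta hz hm)// hE// conn_mx_change /=.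
set Y := \row_d _; set Z := zeta c u; set Ge := conn_mx nabla c u e; set y := upsilon c u e.
set l := tractor_lambda _ _ _ _.
have YZ : Y *m Z = l by exact: upsilon_zeta.
clearbody l.
have Zs : Z^T = Z := zeta_sym hz Ac cu.
(* The definition of [upsilon] solved for dD. Its first term matches the two scalar terms of
   [conn_mx_change], its second cancels the weight term of [pd_zeta]. *)
have pdD : pd e (D c) u = - 2 * D c u * y - 2 / n.+1%:R * \tr Ge * D c u.
  rewrite /y /upsilon -/Ge; have n0 : n.+1%:R != 0 :> R by rewrite pnatr_eq0.
  have key (m x p t : R) : m != 0 -> x != 0 ->
    p = - 2 * x * (- (p / (2 * x)) - m^-1 * t) - 2 / m * t * x.
    by move=> m0 x0; field; rewrite ?m0 ?x0.
  exact: key.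
have ZY : Z *m (('e_e)^T *m Y)^T = l^T *m 'e_e.
  by rewrite trmx_mul trmxK mulmxA -YZ trmx_mul Zs.
rewrite pdD !(linearD, linearB) /= !(mulmxDl, mulmxDr, mulmxBl) tr_scalar_mx.
rewrite -!scalemxAl -!scalemxAr ZY -[_ *m Y *m Z]mulmxA YZ mul_scalar_mx mul_mx_scalar.
set d := D c u; set t := \tr Ge.
apply/matrixP => a b; rewrite !mxE; ring.
Qed.

Lemma induced_unit c u : D c u != 0 -> h c u \in unitmx.
Proof.
move=> D0; rewrite unitmxE /h /induced_inverse_metric detZ unitfE mulf_neq0//.
rewrite expf_neq0// sg_det_density !mulf_neq0 ?sgr_eq0//.
by rewrite pnatr_eq0 -lt0n fact_gt0.
Qed.

(** Meaningful only off the degeneracy locus. One field serves as metric on both sides, each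
    statement being confined to an open set where D does not vanish. *)
Definition induced_metric c u : 'M[R]_n := invmx (h c u).
Let g := induced_metric.

Lemma induced_metricK c u : D c u != 0 -> g c u *m h c u = 1%:M.
Proof. by move=> D0; rewrite mulVmx// induced_unit. Qed.

Lemma induced_smooth (U : set 'rV[R]_n) c i j : A c -> open U -> U `<=` coords c setT ->
  (forall u, U u -> D c u != 0) -> smooth U (fun u => h c u i j).
Proof.
move=> Ac oU Uc D0.
apply: (eq_smooth (f := fun u => (n`!)%:R * (Num.sg (D c u) * D c u) * zeta c u i j)) => //.
  by move=> u Uu; rewrite /h /induced_inverse_metric mxE sg_det_density.
apply: smoothM => //; last exact: smooth_sub Uc (zeta_smooth hz i j Ac).
apply: smoothM => //; first exact: smooth_cst.
by apply: smooth_sg_mul => //; exact: smooth_sub Uc (det_field_smooth hz Ac).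
Qed.

Lemma induced_metric_smooth (U : set 'rV[R]_n) c i j : A c -> open U -> U `<=` coords c setT ->
  (forall u, U u -> D c u != 0) -> smooth U (fun u => g c u i j).
Proof.
move=> Ac oU Uc D0 k; apply: Ck_invmx => //.
  by move=> u /D0; exact: induced_unit.
by move=> a b; exact: (induced_smooth a b Ac oU Uc D0).
Qed.

Lemma induced_sym c u : A c -> coords c setT u -> (h c u)^T = h c u.
Proof. by move=> Ac cu; rewrite /h /induced_inverse_metric linearZ /= (zeta_sym hz Ac cu). Qed.

(** Differentiating g h = 1 transfers parallelism from the inverse metric to the metric. *)
Lemma pd_induced_metric (U : set 'rV[R]_n) c u e : A c -> open U -> U `<=` coords c setT ->
  (forall u, U u -> D c u != 0) -> U u ->
  \matrix_(a, b) pd e (fun v => g c v a b) u =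
  (conn_mx G' c u e)^T *m g c u + g c u *m conn_mx G' c u e.
Proof.
move=> Ac oU Uc D0 Uu.
have gh v : U v -> g c v *m h c v = 1%:M by move=> /D0; exact: induced_metricK.
set dg := \matrix_(_, _) _.
pose dh := \matrix_(a, b) pd e (fun v => h c v a b) u.
have E : dg *m h c u + g c u *m dh = 0.
  apply/matrixP => a b; rewrite [RHS]mxE.
  have d1 i j := smooth_is_derive (delta_mx 0 e) (induced_metric_smooth i j Ac oU Uc D0) Uu.
  have d2 i j := smooth_is_derive (delta_mx 0 e) (induced_smooth i j Ac oU Uc D0) Uu.
  have [_ F] := is_derive_bigsum (index_enum 'I_n) xpredT (fun d => is_derive_mulf (d1 a d) (d2 d b)).
  have : 'D_(delta_mx 0 e) (fun v => \sum_d g c v a d * h c v d b) u = 0.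
    rewrite (near_eq_derive (g := fun=> (a == b)%:R : R)) ?derive_cst//.
    apply: (@eq_near_open R 'rV[R]_n R U) => // v Uv.
    by have /matrixP/(_ a b) := gh v Uv; rewrite !mxE.
  move=> F'; rewrite F' in F; rewrite [LHS]mxE [X in X + _]mxE [X in _ + X]mxE -big_split /=.
  apply: etrans (esym F); apply: eq_bigr => d _; rewrite !mxE addrC; congr (_ + _).
  by rewrite mulrC.
have gg : h c u *m g c u = 1%:M by apply: mulmx1C; exact: gh.
have -> : dg = - (g c u *m dh *m g c u).
  have : dg *m h c u *m g c u = - (g c u *m dh) *m g c u.
    by congr (_ *m _); apply/eqP; rewrite -addr_eq0 E.
  by rewrite -mulmxA gg mulmx1 mulNmx.
rewrite /dh pd_induced; [|exact: Ac|exact: Uc|exact: D0].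
rewrite mulmxBr mulmxN !mulmxBl !mulNmx opprB opprK.
rewrite !mulmxA gh// mul1mx -!mulmxA gg mulmx1.
by rewrite addrC.
Qed.

End LeviCivita.

(** * Projective changes and unparametrized geodesics *)

Section ProjectiveEquivalence.
Context {R : realType} {n : nat} {M : topologicalType}.
Variable A : set (chart R n M).
Implicit Types (N : set M) (G : @connection_field R n M).

(** On a velocity w the added terms amount to 2 Y(w) w, a multiple of w, which only changes the
    factor f of proportionality. *)
Lemma proj_equiv_change N G G' (Y : chart R n M -> 'rV[R]_n -> 'I_n -> R) :
  (forall c u, A c -> coords c N u -> forall k i j,
     G' c u k i j = G c u k i j + Y c u i * (k == j)%:R + Y c u j * (k == i)%:R) ->
  proj_equiv A N G G'.
Proof.
move=> H a b gamma [Hg _].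
have key c t (w : 'rV[R]_n) k : A c -> a < t < b -> dom c (gamma t) ->
    \sum_(i < n) \sum_(j < n) G' c (cmap c (gamma t)) k i j * w 0 i * w 0 j =
    \sum_(i < n) \sum_(j < n) G c (cmap c (gamma t)) k i j * w 0 i * w 0 j +
    2 * (\sum_i Y c (cmap c (gamma t)) i * w 0 i) * w 0 k.
  move=> Ac tab dt; set u := cmap c (gamma t).
  have cu : coords c N u by apply: coords_dom => //; case: (Hg t tab).
  pose s := \sum_i Y c u i * w 0 i.
  have E1 : \sum_(i < n) \sum_(j < n) Y c u i * (k == j)%:R * w 0 i * w 0 j = s * w 0 k.
    rewrite /s mulr_suml; apply: eq_bigr => i _.
    rewrite (bigD1 k)//= eqxx big1 ?addr0 ?mulr1// => j jk.
    by rewrite eq_sym (negbTE jk) mulr0 !mul0r.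
  have E2 : \sum_(i < n) \sum_(j < n) Y c u j * (k == i)%:R * w 0 i * w 0 j = s * w 0 k.
    rewrite (bigD1 k)//= eqxx /= [X in _ + X]big1 ?addr0; last first.
      by move=> j jk; rewrite eq_sym (negbTE jk) big1// => i _; rewrite mulr0 !mul0r.
    by rewrite /s mulr_suml; apply: eq_bigr => i _; ring.
  rewrite -/s (_ : 2 * s * w 0 k = s * w 0 k + s * w 0 k); last by ring.
  rewrite -{1}E1 -E2 -!big_split /=; apply: eq_bigr => i _.
  rewrite -!big_split /=; apply: eq_bigr => j _; rewrite H//; ring.
split=> U c t Ac tab dt; have [f Hf] := U c t Ac tab dt.
  exists (f + 2 * (\sum_i Y c (cmap c (gamma t)) i *
      (derive1 (fun s => cmap c (gamma s)) t) 0 i)) => k.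
  rewrite key// addrA Hf; exact: esym (mulrDl _ _ _).
exists (f - 2 * (\sum_i Y c (cmap c (gamma t)) i *
    (derive1 (fun s => cmap c (gamma s)) t) 0 i)) => k.
by have := Hf k; rewrite key// addrA => E; rewrite mulrBl -E addrK.
Qed.

Lemma proj_equiv_trans N G1 G2 G3 :
  proj_equiv A N G1 G2 -> proj_equiv A N G2 G3 -> proj_equiv A N G1 G3.
Proof.
by move=> h1 h2 a b gamma rc; split=> [/(h1 a b gamma rc)/(h2 a b gamma rc)|/(h2 a b gamma rc)/(h1 a b gamma rc)].
Qed.

Lemma proj_equiv_sub N N' G1 G2 : N' `<=` N ->
  proj_equiv A N G1 G2 -> proj_equiv A N' G1 G2.
Proof.
move=> NN h a b gamma [rc1 rc2]; apply: h; split=> // t tab.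
by have [/NN Nt ct] := rc1 t tab.
Qed.

End ProjectiveEquivalence.

(** * Behaviour under change of chart *)

Section Transition.
Context {R : realType} {n : nat} {M : topologicalType}.
Variables (A : set (chart R n M)) (nabla : @connection_field R n M)
  (zeta : @matrix_field R n M) (V : @density_field R n M).
Hypotheses (hM : smooth_manifold A) (hz : sym_bivector_density A (-2) zeta)
  (htf : torsion_free_connection A setT nabla)
  (hV : density A (- n.+1%:R) V)
  (V0 : forall c u, A c -> coords c setT u -> 0 < V c u)
  (dV : forall c u, A c -> coords c setT u ->
       forall a, cov_density nabla (- n.+1%:R) V c u a = 0).
Implicit Types (c : chart R n M) (u : 'rV[R]_n) (e : 'I_n).

Let D := det_field zeta.

Lemma transition_smooth c c' : A c -> A c' -> smooth (coords c (dom c')) (trans c c').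
Proof. by case: hM => _ _ _ H _ Ac Ac'; have [] := H c c' Ac Ac'. Qed.

Lemma coords_dom_open c c' : open (coords c (dom c')).
Proof. by apply: coords_open; exact: dom_open. Qed.

Lemma coordsIT c c' u : coords c (dom c') u -> coords c' setT (trans c c' u).
Proof. by move=> [x [dx dx'] <-]; rewrite transE//; exists x. Qed.

(** The volume density V is positive in both charts, so its transition factor cannot vanish. *)
Lemma jac_det_neq0 c c' u : A c -> A c' -> coords c (dom c') u -> \det (jac c c' u) != 0.
Proof.
move=> Ac Ac' cu; have [_ H] := hV.
have := V0 Ac' (coordsIT cu); rewrite (H c c' u Ac Ac' cu) => h.
apply: (@weight_factor_det _ _ _ (- n.+1%:R)); first by rewrite oppr_eq0 pnatr_eq0.
by apply: contraTneq h => ->; rewrite mul0r ltxx.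
Qed.

Lemma jac_unit c c' u : A c -> A c' -> coords c (dom c') u -> jac c c' u \in unitmx.
Proof. by move=> *; rewrite unitmxE unitfE jac_det_neq0. Qed.

Lemma zeta_trans c c' u : A c -> A c' -> coords c (dom c') u ->
  zeta c' (trans c c' u) =
  weight_factor (-2) c c' u *: ((jac c c' u)^T *m zeta c u *m jac c c' u).
Proof. by case: hz => _ _ H; exact: H. Qed.

(** The weight 2 is the sum of - 2 n from the factor of zeta, raised to the power n, and 2 n + 2
    from the square of det J. *)
Lemma det_trans c c' u : A c -> A c' -> coords c (dom c') u ->
  D c' (trans c c' u) = weight_factor 2 c c' u * D c u.
Proof.
move=> Ac Ac' cu; rewrite /D /det_field zeta_trans// detZ !det_mulmx det_tr.
have J0 := jac_det_neq0 Ac Ac' cu.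
rewrite [X in _ * X](_ : _ = (\det (jac c c' u)) ^+ 2 * \det (zeta c u)); last by ring.
rewrite mulrA -weight_factor2n2 weight_factorX// weight_factorD//; congr (weight_factor _ _ _ _ * _).
by rewrite natrD natrM; ring.
Qed.

Lemma det_density_field : density A 2 D.
Proof.
split; last exact: det_trans.
by move=> c Ac; have H := det_field_smooth hz Ac; exact: H.
Qed.

(* The weights 2 (n + 1) and - 2 (n + 1) cancel: F is a function on M. *)
Let F c u := D c u ^+ n.+1 * V c u ^+ 2.

Lemma F_trans c c' u : A c -> A c' -> coords c (dom c') u -> F c' (trans c c' u) = F c u.
Proof.
move=> Ac Ac' cu; have J0 := jac_det_neq0 Ac Ac' cu; have [_ H] := hV.
rewrite /F det_trans// (H c c' u)// !exprMn mulrACA !weight_factorX// weight_factorD//.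
by rewrite [X in weight_factor X](_ : _ = 0) ?weight_factor0 ?mul1r//; ring.
Qed.

Lemma V_smooth c : A c -> smooth (coords c setT) (V c).
Proof. by case: hV => H _; exact: H. Qed.

Lemma pd_V c u e : A c -> coords c setT u ->
  pd e (V c) u = \tr (conn_mx nabla c u e) * V c u.
Proof.
move=> Ac cu; have := dV Ac cu e; rewrite /cov_density /weight_term -trace_conn_mx.
rewrite mulNr divff ?pnatr_eq0// mulN1r mulNr => /eqP; rewrite subr_eq0 => /eqP //.
Qed.

(** The quotient dF / F stands for d log |F|, so no case distinction on the sign of D arises. *)
Lemma pd_F c u e : A c -> coords c setT u -> D c u != 0 ->
  upsilon nabla zeta c u e = - (2 * n.+1%:R)^-1 * (pd e (F c) u / F c u).
Proof.
move=> Ac cu D0; have Vu := V0 Ac cu; have Vn : V c u != 0 by rewrite gt_eqF.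
have d1 := smooth_is_derive (delta_mx 0 e) (det_field_smooth hz Ac) cu.
have d2 := smooth_is_derive (delta_mx 0 e) (V_smooth Ac) cu.
have pw (f : 'rV[R]_n -> R) m x v df : is_derive x v f df ->
    is_derive x v (fun y => f y ^+ m) (m%:R * f x ^+ m.-1 * df).
  by move=> df'; have := is_deriveX m df'; rewrite exprfctE.
have [_ E] := is_derive_mulf (pw _ n.+1 _ _ _ d1) (pw _ 2%N _ _ _ d2).
have -> : pd e (F c) u = D c u ^+ n.+1 * (2 * V c u * pd e (V c) u) +
    V c u ^+ 2 * (n.+1%:R * D c u ^+ n * pd e (D c) u).
  by apply: etrans E _.
rewrite pd_V// /F /upsilon -/D exprS.
have Dn : D c u ^+ n != 0 by rewrite expf_neq0.
have n0 : n.+1%:R != 0 :> R by rewrite pnatr_eq0.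
have key (m x v p t y : R) : m != 0 -> x != 0 -> v != 0 -> y != 0 ->
  - (p / (2 * x)) - m^-1 * t = - (2 * m)^-1 * ((x * y * (2 * v * (t * v)) + v ^+ 2 * (m * y * p)) / (x * y * v ^+ 2)).
  by move=> m0 x0 v0 y0; field; rewrite m0 x0 v0 y0.
exact: key.
Qed.

Lemma F_smooth c : A c -> smooth (coords c setT) (F c).
Proof.
move=> Ac; have oc := @coordsT_open _ _ _ c.
have X (f : 'rV[R]_n -> R) m : smooth (coords c setT) f -> smooth (coords c setT) (fun u => f u ^+ m).
  move=> sf; elim: m => [|m IH].
    by apply: (eq_smooth (f := fun=> 1)) => //; exact: smooth_cst.
  by apply: (eq_smooth (f := fun u => f u * f u ^+ m)) => //; [move=> u _; rewrite exprS|exact: smoothM].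
have sD := det_field_smooth hz Ac; have sV := V_smooth Ac.
by apply: smoothM => //; apply: X; [exact: sD|exact: sV].
Qed.

Lemma pd_trans (f : @density_field R n M) c c' u e : A c -> A c' -> coords c (dom c') u ->
  smooth (coords c' setT) (f c') ->
  (forall v, coords c (dom c') v -> f c v = f c' (trans c c' v)) ->
  pd e (f c) u = \sum_k jac c c' u e k * pd k (f c') (trans c c' u).
Proof.
move=> Ac Ac' cu sf E.
rewrite -(pd_comp e (@coords_dom_open c c') (transition_smooth Ac Ac' 1) cu
  (@coordsT_open _ _ _ c') (sf 1) (coordsIT cu)).
apply: near_eq_derive; apply: (@eq_near_open R 'rV[R]_n R (coords c (dom c'))) => //.
exact: coords_dom_open.
Qed.

(** Neither summand of [upsilon] is a 1-form, as D is a density and the trace of a connection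
    transforms affinely. Their sum is a multiple of dF / F for a function F on M, and such a
    quotient is a 1-form. *)
Lemma upsilon_trans c c' u e : A c -> A c' -> coords c (dom c') u -> D c u != 0 ->
  upsilon nabla zeta c u e =
  \sum_k jac c c' u e k * upsilon nabla zeta c' (trans c c' u) k.
Proof.
move=> Ac Ac' cu D0; have J0 := jac_det_neq0 Ac Ac' cu.
have cu' := coordsIT cu.
have D0' : D c' (trans c c' u) != 0.
  by rewrite det_trans// mulf_neq0// gt_eqF// weight_factor_gt0.
rewrite pd_F//; last exact: coordsT cu.
rewrite (pd_trans e Ac Ac' cu (F_smooth Ac')); last by move=> v cv; rewrite F_trans.
rewrite mulr_suml mulr_sumr; apply: eq_bigr => k _.
rewrite pd_F// F_trans//; ring.
Qed.

Variable N : set M.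
Hypotheses (oN : open N) (DN : forall c u, A c -> coords c N u -> D c u != 0).

Let G' := projective_change nabla (upsilon nabla zeta).

Lemma upsilon_smooth c e : A c -> smooth (coords c N) (fun u => upsilon nabla zeta c u e).
Proof.
move=> Ac; have oc := @coords_open _ _ _ c _ oN; have cT := @coordsT _ _ _ c N.
have sD := smooth_sub cT (det_field_smooth hz Ac).
have [sG _ _] := htf.
have s1 : smooth (coords c N) (fun u => (-1) * (pd e (D c) u * (2 * D c u)^-1)).
  apply: smoothM => //; first exact: smooth_cst.
  apply: smoothM => //; first exact: smooth_pd sD.
  apply: smoothV => //; first by move=> u cu; apply: mulf_neq0; [rewrite pnatr_eq0|exact: DN].
  by apply: smoothM => //; exact: smooth_cst.
have s2 : smooth (coords c N) (fun u => (- n.+1%:R^-1) * \sum_d nabla c u d e d).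
  apply: smoothM => //; first exact: smooth_cst.
  by apply: smooth_sum => // d; exact: smooth_sub cT (sG c Ac d e d).
apply: eq_smooth (smoothD oc s1 s2) => // u cu.
by rewrite /upsilon trace_conn_mx mulN1r mulNr.
Qed.

(** As [upsilon] is a 1-form, the added terms transform tensorially, and the inhomogeneous term of
    the transformation law comes from nabla alone. *)
Lemma upsilon_connection_torsion_free : torsion_free_connection A N G'.
Proof.
have [sG symG tG] := htf; have cT c := @coordsT _ _ _ c N; split.
- move=> c Ac k i j; have oc := @coords_open _ _ _ c _ oN.
  apply: smoothD => //; first apply: smoothD => //.
  + exact: smooth_sub (cT c) (sG c Ac k i j).
  + by apply: smoothM => //; [exact: upsilon_smooth|exact: smooth_cst].
  + by apply: smoothM => //; [exact: upsilon_smooth|exact: smooth_cst].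
- move=> c u Ac cu k i j; rewrite /G' /projective_change (symG c u Ac (cT c u cu)).
  by rewrite addrAC.
- move=> c c' u Ac Ac' cu k a b.
  have cu1 : coords c (dom c') u by apply: coords_sub cu => x [].
  have cu2 : coords c N u by apply: coords_sub cu => x [].
  have cu3 : coords c (dom c' `&` setT) u by apply: coords_sub cu => x [].
  have Yt e := upsilon_trans e Ac Ac' cu1 (DN Ac cu2).
  have := tG c c' u Ac Ac' cu3 k a b.
  set Y := upsilon nabla zeta in Yt *; set J := jac c c' u in Yt *; set u' := trans c c' u in Yt *.
  set p := pd _ _ _ => E.
  have -> : \sum_(d < n) G' c u d a b * J d k =
      \sum_(d < n) nabla c u d a b * J d k + (Y c u a * J b k + Y c u b * J a k).
    have E1 x y : \sum_(d < n) Y c u x * (d == y)%:R * J d k = Y c u x * J y k.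
      rewrite (bigD1 y)//= eqxx mulr1 big1 ?addr0// => d dy.
      by rewrite (negbTE dy) mulr0 mul0r.
    rewrite -!E1 -!big_split /=; apply: eq_bigr => d _.
    by rewrite /G' /projective_change -/Y; ring.
  have -> : \sum_(i < n) \sum_(j < n) G' c' u' k i j * J a i * J b j =
      \sum_(i < n) \sum_(j < n) nabla c' u' k i j * J a i * J b j +
      (Y c u a * J b k + Y c u b * J a k).
    rewrite !Yt -/Y.
    have E1 : \sum_(i < n) \sum_(j < n) Y c' u' i * (k == j)%:R * J a i * J b j =
        (\sum_i J a i * Y c' u' i) * J b k.
      rewrite mulr_suml; apply: eq_bigr => i _.
      rewrite (bigD1 k)//= eqxx /= big1 ?addr0; first by ring.
      by move=> j jk; rewrite eq_sym (negbTE jk) /=; ring.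
    have E2 : \sum_(i < n) \sum_(j < n) Y c' u' j * (k == i)%:R * J a i * J b j =
        (\sum_i J b i * Y c' u' i) * J a k.
      rewrite (bigD1 k)//= eqxx /= [X in _ + X]big1 ?addr0; last first.
        by move=> j jk; rewrite eq_sym (negbTE jk) /= big1// => i _; ring.
      by rewrite mulr_suml; apply: eq_bigr => i _; ring.
    rewrite -E1 -E2 -!big_split /=; apply: eq_bigr => i _.
    rewrite -!big_split /=; apply: eq_bigr => j _.
    by rewrite /G' /projective_change -/Y; ring.
  by rewrite E -addrA.
Qed.

Lemma induced_metric_pseudo : pseudo_metric A N (induced_metric zeta).
Proof.
have cT c := @coordsT _ _ _ c N; split=> //.
- move=> c Ac i j; apply: (induced_metric_smooth hz) => //; first exact: coords_open.
  by move=> u cu; exact: DN cu.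
- move=> c u Ac cu; have D0 := DN Ac cu; split; last by rewrite unitmx_inv induced_unit.
  by rewrite /induced_metric trmx_inv (induced_sym hz Ac (cT c u cu)).
- move=> c c' u Ac Ac' cu.
  have cu1 : coords c (dom c') u by apply: coords_sub cu => x [].
  have cu2 : coords c N u by apply: coords_sub cu => x [].
  have Ju := jac_unit Ac Ac' cu1; have J0 := jac_det_neq0 Ac Ac' cu1.
  have D0 := DN Ac cu2.
  set J := jac c c' u in Ju J0 *; set u' := trans c c' u.
  have hE : induced_inverse_metric zeta c' u' = J^T *m induced_inverse_metric zeta c u *m J.
    rewrite /induced_inverse_metric !sg_det_density zeta_trans// -/D det_trans//.
    rewrite sgrM (gtr0_sg (weight_factor_gt0 _ _))// mul1r scalerA -scalemxAr -scalemxAl.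
    congr (_ *: _).
    have W : weight_factor 2 c c' u * weight_factor (-2) c c' u = 1.
      by rewrite weight_factorD// subrr weight_factor0.
    have key (w w' m s d : R) : w * w' = 1 -> m * (s * (w * d)) * w' = m * (s * d).
      by move=> E; rewrite -[RHS]mul1r -E; ring.
    exact: key.
  have hu := induced_unit D0.
  have h'u : induced_inverse_metric zeta c' u' \in unitmx.
    by rewrite hE !unitmx_mul unitmx_tr Ju hu.
  rewrite /induced_metric -/u'.
  set h := induced_inverse_metric zeta c u in hE hu *; set h' := induced_inverse_metric zeta c' u' in hE h'u *.
  (* Commuting the factors of this identity twice reads off the inverse of h as J h'^-1 J^T. *)
  have E : J^T *m (h *m J *m invmx h') = 1%:M by rewrite !mulmxA -hE mulmxV.
  have E2 : h *m (J *m invmx h' *m J^T) = 1%:M by rewrite !mulmxA; exact: mulmx1C E.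
  by rewrite -[LHS]mulmx1 -E2 mulKmx.
Qed.

Lemma induced_levi_civita (hm : metrizability A nabla zeta) :
  levi_civita A N (induced_metric zeta) G'.
Proof.
split; first exact: upsilon_connection_torsion_free.
move=> c u Ac cu k i j.
have := pd_induced_metric hz hm k Ac (@coords_open _ _ _ c _ oN) (@coordsT _ _ _ c N)
  (fun v cv => DN Ac cv) cu.
move=> /matrixP/(_ i j); rewrite !mxE => ->; rewrite -big_split /=.
by apply: eq_bigr => d _; rewrite !mxE -/G' [X in _ + X]mulrC.
Qed.

Lemma upsilon_proj_equiv : proj_equiv A N nabla G'.
Proof. by apply: (proj_equiv_change (Y := upsilon nabla zeta)). Qed.

End Transition.

(** * Charts with a prescribed coordinate function *)

Section AdaptedChart.
Context {R : realType} {n : nat} {M : topologicalType}.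
Variables (A : set (chart R n M)) (c : chart R n M) (x0 : M) (i : 'I_n)
  (s : 'rV[R]_n -> R).
Hypotheses (hM : smooth_manifold A) (Ac : A c) (dx0 : dom c x0)
  (ss : smooth (coords c setT) s) (ds : pd i s (cmap c x0) != 0).

Let O := coords c setT.
Let u0 := cmap c x0.

Lemma adapted_chart : exists c1, [/\ A c1, dom c1 x0, dom c1 `<=` dom c
  & forall y, dom c1 y -> cmap c1 y 0 i = s (cmap c y)].
Proof.
have oO : open O by exact: coordsT_open.
have Ou0 : O u0 by exact: coords_dom.
have [d d0 Hd] := pd_sign_ball oO ss Ou0 ds.
set U : set 'rV[R]_n := ball u0 d.
have oU : open U by exact: ball_open.
pose phi u := setc i u (s u); pose psi := psi i s u0 d.
have oV : open (phi @` U) := phi_open ss ds d0 Hd.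
have phiK : forall u, U u -> psi (phi u) = u := phiK ss d0 Hd.
have psiP : forall w, (phi @` U) w -> U (psi w) /\ phi (psi w) = w.
  by move=> w Vw; exact: (psiP Vw).
have UO u : U u -> O u by move=> /Hd[].
pose dm := dom c `&` [set x | U (cmap c x)].
have imE : (phi \o cmap c) @` dm = phi @` U.
  apply/seteqP; split=> w.
    by move=> [x [dx Ux] <-]; exists (cmap c x).
  move=> [u Uu <-]; have [dx _ E] := cinv_coords (UO _ Uu).
  by exists (cinv c u); rewrite /= ?E//; split=> //=; rewrite E.
have odm : open dm.
  rewrite openE => x [dx Ux].
  have n1 : \forall y \near x, dom c y by apply: open_nbhs_nbhs; split=> //; exact: dom_open.
  have n2 : \forall y \near x, U (cmap c y).
    by apply: (cmap_continuous dx); exact: open_nbhs_nbhs.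
  by apply: filterS2 n1 n2.
have oim : open ((phi \o cmap c) @` dm) by rewrite imE.
have K x : dm x -> (cinv c \o psi) ((phi \o cmap c) x) = x.
  by move=> [dx Ux] /=; rewrite phiK// cmapK.
have ccm x : dm x -> {for x, continuous (phi \o cmap c)}.
  move=> [dx Ux]; apply: continuous_comp; first exact: cmap_continuous.
  exact: (Ck_cont (phi_smooth ss Hd 0) Ux).
have cci w : ((phi \o cmap c) @` dm) w -> {for w, continuous (cinv c \o psi)}.
  rewrite imE => Vw; apply: continuous_comp.
    exact: (psi_cont ss ds d0 Hd Vw).
  by apply: cinv_continuous; have [/UO[x [dx _] xE] _] := psiP _ Vw; exists x.
pose c1 := Chart odm oim K ccm cci.
have c1V N w : coords c1 N w -> (phi @` U) w.
  by move=> [x [dx _] <-]; rewrite -imE; exists x.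
have psm := psi_smooth oO ss ds d0 Hd.
(* The atlas is maximal, so compatibility with its members places c1 in it. *)
have compat c' : A c' -> compatible c1 c'.
  move=> Ac'; have [_ _ _ H _] := hM; have [sT sT'] := H c c' Ac Ac'; split.
    move=> k; have o1 : open (coords c1 (dom c')) by apply: coords_open; exact: dom_open.
    apply: (Ck_comp_mx (f := psi) (g := trans c c') o1 (@coords_dom_open _ _ _ c c')).
    - move=> w [x [[dx Ux] dx'] <-]; rewrite /= phiK//; by exists x.
    - by apply: Ck_sub (psm k) => w; exact: c1V.
    - exact: sT.
  move=> k; have o1 : open (coords c' (dom c1)) by apply: coords_open; exact: dom_open.
  apply: (Ck_comp_mx (f := trans c' c) (g := phi) o1 oU).
  - by move=> w [x [dx' [dx Ux]] <-]; rewrite transE.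
  - by apply: Ck_sub (sT' k); apply: coords_sub => x [].
  - exact: (phi_smooth ss Hd).
have Ac1 : A c1 by have [_ _ _ _ H] := hM; exact: H.
exists c1; split=> //.
- by split=> //=; exact: ballxx.
- by move=> y [].
- by move=> y [dy Uy] /=; rewrite /phi setcE eqxx.
Qed.

End AdaptedChart.

(** * The degeneracy locus *)

Section Boundary.
Context {R : realType}.

Lemma cvg_line n (u v : 'rV[R]_n) : t *: v + u @[t --> (0 : R)] --> u.
Proof.
rewrite -{2}[u]add0r -(scale0r v).
apply: (@cvgD _ _ _ _ _ (fun t : R => t *: v) (cst u)); last exact: cvg_cst.
by apply: cvgZr_tmp; exact: cvg_id.
Qed.

Lemma pd_zero_line n (f : 'rV[R]_n -> R) (U : set 'rV[R]_n) u j : open U -> U u ->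
  (forall t : R, U (t *: delta_mx 0 j + u) -> f (t *: delta_mx 0 j + u) = 0) ->
  pd j f u = 0.
Proof.
move=> oU Uu H; rewrite /pd derive_lineE.
rewrite (near_eq_derive (g := fun=> 0 : R)) ?derive_cst//.
have nU : \forall v \near u, U v by exact: open_nbhs_nbhs.
have : \forall t \near (0 : R), U (t *: delta_mx 0 j + u) := cvg_line _ nU.
by apply: filterS => t; exact: H.
Qed.

Lemma pd_nonzero_pos n (f : 'rV[R]_n -> R) (W : set 'rV[R]_n) u i : open W -> W u ->
  derivable f u (delta_mx 0 i) -> f u = 0 -> pd i f u != 0 ->
  exists2 v, W v & 0 < f v.
Proof.
move=> oW Wu df fu0 p0; set p := pd i f u in p0.
have nW : \forall v \near u, W v by exact: open_nbhs_nbhs.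
have n1 : \forall t \near (0 : R), W (t *: delta_mx 0 i + u) := cvg_line _ nW.
have p2 : 0 < p * p by rewrite -expr2 lt_neqAle eq_sym sqrf_eq0 p0 sqr_ge0.
have lim : p * (t^-1 *: ((f \o shift u) (t *: delta_mx 0 i) - f u)) @[t --> 0^'] --> p * p.
  by apply: cvgMl_tmp; exact: df.
have n2 : \forall t \near (0 : R), t != 0 ->
    0 < p * (t^-1 *: ((f \o shift u) (t *: delta_mx 0 i) - f u)).
  exact: (cvgr_gt _ lim _ p2).
have n3 : \forall t \near (0 : R), W (t *: delta_mx 0 i + u) /\ (t != 0 ->
    0 < p * (t^-1 *: ((f \o shift u) (t *: delta_mx 0 i) - f u))).
  by apply: filterS2 n1 n2.
move/nbhs_ballP : n3 => [e /= e0 He].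
(* The sign of p makes p / t positive, and the factor 1/2 keeps t in the ball. *)
pose t := Num.sg p * (e / 2).
have t0 : t != 0 by rewrite mulf_neq0 ?sgr_eq0// gt_eqF// divr_gt0.
have Bt : ball 0 e t.
  rewrite -ball_normE /= sub0r normrN normrM normr_sg p0 mul1r gtr0_norm ?divr_gt0//.
  by rewrite ltr_pdivrMr// ltr_pMr// ltr1n.
have [Wt /(_ t0)] := He t Bt; rewrite /= fu0 subr0 => h.
exists (t *: delta_mx 0 i + u) => //.
have pt : 0 < p * t^-1.
  have pt' : 0 < p * t.
    by rewrite /t mulrA [p * _]mulrC -normrEsg mulr_gt0 ?normr_gt0// divr_gt0.
  rewrite (_ : p * t^-1 = p * t * (t^-1) ^+ 2); last by field.
  by rewrite mulr_gt0// lt_neqAle eq_sym sqrf_eq0 invr_eq0 t0 sqr_ge0.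
by move: h; rewrite /GRing.scale /= mulrA pmulr_rgt0.
Qed.

(** The derivatives agree on N, which is open. If they differed at y, they would by continuity
    differ on a whole neighbourhood of y, and that neighbourhood meets N. The square of the
    difference expresses inequality as positivity. *)
Lemma pd_unique_on_closure n (F1 F2 : 'rV[R]_n -> R) (U N : set 'rV[R]_n) y a :
  open U -> U y -> smooth U F1 -> smooth U F2 -> open N ->
  (forall W, open W -> W y -> exists2 v, W v & N v) ->
  (forall v, U v -> N v -> F1 v = F2 v) -> pd a F1 y = pd a F2 y.
Proof.
move=> oU Uy s1 s2 oN cl E; apply/eqP; rewrite -subr_eq0; apply/negPn/negP => d0.
pose g v := pd a F1 v - pd a F2 v.
have cg v : U v -> {for v, continuous g}.
  move=> Uv; have h1 := Ck_cont (smooth_pd a s1 0%N) Uv.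
  have h2 := Ck_cont (smooth_pd a s2 0%N) Uv.
  exact: (cvgB h1 h2).
have oW : open (U `&` [set v | 0 < g v ^+ 2]).
  apply: (open_pos oU) => v Uv.
  have -> : (fun v => g v ^+ 2) = (fun v => g v * g v) by apply/funext => w; rewrite expr2.
  by have h := cg v Uv; exact: (cvgM h h).
have [|v [Uv gv] Nv] := cl _ oW.
  by split=> //=; rewrite lt_neqAle sqr_ge0 andbT eq_sym sqrf_eq0.
move: gv; rewrite /= /g (_ : pd a F1 v = pd a F2 v) ?subrr ?expr0n ?ltxx//.
apply: near_eq_derive; apply: (@eq_near_open R 'rV[R]_n R (U `&` N)) => //.
- exact: openI.
- by move=> w [Uw Nw]; exact: E.
Qed.

End Boundary.

Section DegeneracyLocus.
Context {R : realType} {n : nat} {M : topologicalType}.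
Variables (A : set (chart R n M)) (nabla : @connection_field R n M)
  (zeta : @matrix_field R n M) (V : @density_field R n M).
Hypotheses (hM : smooth_manifold A) (hz : sym_bivector_density A (-2) zeta)
  (hm : metrizability A nabla zeta)
  (htf : torsion_free_connection A setT nabla)
  (hV : density A (- n.+1%:R) V)
  (V0 : forall c u, A c -> coords c setT u -> 0 < V c u)
  (dV : forall c u, A c -> coords c setT u ->
       forall a, cov_density nabla (- n.+1%:R) V c u a = 0)
  (hL : forall c u, A c -> coords c setT u -> \det (tractor_form nabla zeta c u) != 0).
Implicit Types (c : chart R n M) (u : 'rV[R]_n) (e : 'I_n).

Let D := det_field zeta.
Let G' := projective_change nabla (upsilon nabla zeta).

(* The witness is w = lam adj(zeta); it is nonzero since w lam^T = - det L(zeta). *)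
Lemma degenerate_differential c u : A c -> coords c setT u -> D c u = 0 ->
  exists w : 'rV[R]_n, [/\ w != 0, w *m zeta c u = 0 & forall e, pd e (D c) u = - 2 * w 0 e].
Proof.
move=> Ac cu D0; exists (tractor_lambda nabla zeta c u *m \adj (zeta c u)); split.
- have := hL Ac cu; rewrite /tractor_form (det_bordered _ _ (zeta_sym hz Ac cu)).
  rewrite -/(det_field zeta c u) -/D D0 mulr0 sub0r oppr_eq0; apply: contra => /eqP ->.
  by rewrite mul0mx mxE.
- by rewrite -mulmxA mul_adj_mx -/(det_field zeta c u) -/D D0 mul_mx_scalar scale0r.
- by move=> e; rewrite (pd_det hz hm)// -/D D0 mulr0 sub0r mulNr.
Qed.

Lemma degenerate_submersion c u : A c -> coords c setT u -> D c u = 0 ->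
  exists i, pd i (D c) u != 0.
Proof.
move=> Ac cu D0; have [w [w0 _ H]] := degenerate_differential Ac cu D0.
have /rV0Pn[i wi] := w0; exists i; rewrite H mulf_neq0// oppr_eq0 pnatr_eq0//.
Qed.

(** D vanishes on the slice x^i = 0, so its differential is a multiple of dx^i. That differential is
    nonzero and lies in the radical of zeta, hence so does dx^i. *)
Lemma slice_row S c i u :
  (forall c x, A c -> dom c x -> S x <-> D c (cmap c x) = 0) ->
  slice_chart A S c i -> coords c S u -> row i (zeta c u) = 0.
Proof.
move=> HS [Ac Hi] cu; have cuT : coords c setT u := coordsT cu.
have D0 v : coords c setT v -> v 0 i = 0 -> D c v = 0.
  move=> [x [dx _] <-] xi; apply/(HS c x Ac dx)/(Hi x dx) => //.
have ui : u 0 i = 0 by have [x [dx Sx] <-] := cu; apply/(Hi x dx).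
have [w [w0 wz H]] := degenerate_differential Ac cuT (D0 u cuT ui).
have wj j : j != i -> w 0 j = 0.
  move=> ji; have : pd j (D c) u = 0.
    apply: (pd_zero_line (@coordsT_open _ _ _ c) cuT) => t ct; apply: D0 => //.
    by rewrite !mxE eqxx /= eq_sym (negbTE ji) mulr0 add0r.
  move/eqP; rewrite H mulf_eq0 oppr_eq0 pnatr_eq0 /= => /eqP //.
have wE : w = w 0 i *: delta_mx 0 i.
  apply/rowP => j; rewrite !mxE eqxx /=; case: eqP => [->|/eqP ji]; first by rewrite mulr1.
  by rewrite mulr0 wj.
have wi : w 0 i != 0 by apply: contra w0 => /eqP E; rewrite wE E scale0r.
move: wz; rewrite wE -scalemxAl -rowE => /eqP; rewrite scaler_eq0 (negbTE wi) => /eqP //.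
Qed.

Variables (eps : R) (N Nbar B : set M).
Hypotheses (eps0 : eps != 0)
  (HN : forall c x, A c -> dom c x -> N x <-> 0 < eps * D c (cmap c x))
  (HNb : forall c x, A c -> dom c x -> Nbar x <-> 0 <= eps * D c (cmap c x))
  (HB : forall c x, A c -> dom c x -> B x <-> D c (cmap c x) = 0).

(** With eps = (-1)^q or - (-1)^q this is a defining function that is positive on the side under
    consideration. *)
Let r c u := eps * D c u.

Lemma r_smooth c : A c -> smooth (coords c setT) (r c).
Proof.
move=> Ac; have H := det_field_smooth hz Ac.
by apply: smoothM H; [exact: coordsT_open|exact: smooth_cst].
Qed.

Lemma pd_r c u e : A c -> coords c setT u -> pd e (r c) u = eps * pd e (D c) u.
Proof.
move=> Ac cu; have H := smooth_is_derive (delta_mx 0 e) (det_field_smooth hz Ac) cu.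
have [_ E] := is_derive_mulf (is_derive_cst eps u (delta_mx 0 e : 'rV[R]_n)) H.
by apply: etrans E _; rewrite mulr0 addr0.
Qed.

Lemma N_D c u : A c -> coords c N u -> D c u != 0.
Proof.
move=> Ac [x [dx Nx] <-]; have := (HN Ac dx).1 Nx.
by apply: contraTneq => ->; rewrite mulr0 ltxx.
Qed.

Lemma chart_at x : exists2 c, A c & dom c x.
Proof. by case: hM => _ _ H _ _; exact: H. Qed.

Lemma N_open : open N.
Proof.
rewrite openE => x Nx; have [c Ac dx] := chart_at x.
have n1 : \forall y \near x, dom c y by apply: open_nbhs_nbhs; split=> //; exact: dom_open.
have cx : coords c setT (cmap c x) by exact: coords_dom.
have n2 : \forall y \near x, 0 < r c (cmap c y).
  have c2 : {for x, continuous (r c \o cmap c)}.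
    apply: continuous_comp; first exact: cmap_continuous.
    exact: (Ck_cont (r_smooth Ac 0) cx).
  exact: (cvgr_gt _ c2 _ ((HN Ac dx).1 Nx)).
by apply: filterS2 n1 n2 => y dy ry; apply/(HN Ac dy).
Qed.

Lemma N_sub : N `<=` Nbar.
Proof.
by move=> x Nx; have [c Ac dx] := chart_at x; apply/(HNb Ac dx)/ltW/(HN Ac dx).
Qed.

(** The function r itself becomes the i-th coordinate, so one chart is at once a slice chart for B
    and a half-space chart for Nbar. *)
Lemma adapted_boundary_chart x : B x -> exists c i, [/\ A c, dom c x &
  forall y, dom c y -> [/\ Nbar y <-> 0 <= cmap c y 0 i, N y <-> 0 < cmap c y 0 i
    & B y <-> cmap c y 0 i = 0]].
Proof.
move=> Bx; have [c Ac dx] := chart_at x.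
have cx : coords c setT (cmap c x) by exact: coords_dom.
have [i pi0] := degenerate_submersion Ac cx ((HB Ac dx).1 Bx).
have [|c1 [Ac1 d1x d1 E]] := adapted_chart hM Ac dx (r_smooth Ac) (i := i).
  by rewrite pd_r// mulf_neq0.
exists c1, i; split=> // y d1y; rewrite (E y d1y); have dy := d1 y d1y; split.
- exact: HNb.
- exact: HN.
- rewrite (HB Ac dy); split=> [h|/eqP]; first by rewrite /r h mulr0.
  by rewrite mulf_eq0 (negbTE eps0) => /eqP.
Qed.

Lemma hypersurface_B : embedded_hypersurface A B.
Proof.
move=> x Bx; have [c [i [Ac dx H]]] := adapted_boundary_chart Bx.
by exists c, i; split=> //; split=> // y dy; have [] := H y dy.
Qed.

Lemma boundary_domain : domain_with_boundary A Nbar N B.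
Proof.
split; first exact: N_open.
- apply/seteqP; split=> // x [Nx Bx]; have [c Ac dx] := chart_at x.
  by have := (HN Ac dx).1 Nx; rewrite (HB Ac dx).1// mulr0 ltxx.
- apply/seteqP; split=> x; have [c Ac dx] := chart_at x.
    move=> [Nx|Bx]; first exact: N_sub.
    by apply/(HNb Ac dx); rewrite (HB Ac dx).1// mulr0.
  move=> /(HNb Ac dx); rewrite le_eqVlt => /orP[/eqP/esym/eqP|h].
    rewrite mulf_eq0 (negbTE eps0) => /eqP D0; right; exact/(HB Ac dx).
  by left; apply/(HN Ac dx).
- move=> x Bx; have [c [i [Ac dx H]]] := adapted_boundary_chart Bx.
  by exists c, i; split=> // y dy; have [] := H y dy.
Qed.

(** At a boundary point dr != 0, so r takes positive values arbitrarily close by. *)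
Lemma N_dense c y W : A c -> coords c Nbar y -> open W -> W y ->
  exists2 v, W v & coords c N v.
Proof.
move=> Ac cy oW Wy; have cyT : coords c setT y := coordsT cy.
have toN v : coords c setT v -> 0 < r c v -> coords c N v.
  by move=> [x [dx _] <-] rx; apply: coords_dom => //; apply/(HN Ac dx).
have [x [dx Nx] xy] := cy.
have := (HNb Ac dx).1 Nx; rewrite xy le_eqVlt => /orP[/eqP r0|ry]; last first.
  by exists y => //; exact: toN.
have D0 : D c y = 0 by apply/eqP; move/esym/eqP: r0; rewrite mulf_eq0 (negbTE eps0).
have [i pi0] := degenerate_submersion Ac cyT D0.
have pr : pd i (r c) y != 0 by rewrite pd_r// mulf_neq0.
have [dr _] := smooth_is_derive (delta_mx 0 i) (r_smooth Ac) cyT.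
have oWc : open (W `&` coords c setT) by apply: openI => //; exact: coordsT_open.
have ry : r c y = 0 by rewrite /r D0 mulr0.
have [v [Wv cv] rv] := pd_nonzero_pos oWc (conj Wy cyT) dr ry pr.
by exists v => //; exact: toN.
Qed.

Lemma smooth_mxP m (U : set 'rV[R]_n) (f : 'rV[R]_n -> 'rV[R]_m) : open U ->
  smooth U f <-> forall k, smooth U (fun u => f u 0 k).
Proof.
move=> oU; split=> [sf k m'|H m']; first exact: (Ck_mxP _ _ oU).1 (sf m') 0 k.
by apply/Ck_mxP => // a j; rewrite ord1; exact: H.
Qed.

(** In dr / (2 r) the constant eps cancels and dD / (2 D) remains, the negative of the singular part
    of [upsilon]. *)
Lemma projectively_compact_B : projectively_compact A 2 Nbar N B G'.
Proof.
move=> x Bx; have [c Ac dx] := chart_at x; exists c, (r c); split=> //.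
- exact: r_smooth.
- move=> y dy Ny; have cy : coords c setT (cmap c y) by exact: coords_dom.
  split; first exact/(HNb Ac dy).
  split.
    rewrite (HB Ac dy); split=> [/eqP|h]; last by rewrite /r h mulr0.
    by rewrite mulf_eq0 (negbTE eps0) => /eqP.
  move=> /(HB Ac dy) D0; have [i pi0] := degenerate_submersion Ac cy D0.
  by exists i; rewrite pd_r// mulf_neq0.
move=> mu xi smu sxi.
have oN := @coords_open _ _ _ c _ N_open.
have cTN := @coordsT _ _ _ c N.
have cNN := coords_sub (c := c) N_sub.
have [sG _ _] := htf.
(* The Christoffel symbols of the Levi-Civita connection with the poles, which
   dr / (2 r) cancels, removed. *)
pose T u k a b : R := nabla c u k a b -
  n.+1%:R^-1 * (\tr (conn_mx nabla c u a) * (k == b)%:R + \tr (conn_mx nabla c u b) * (k == a)%:R).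
have sT k a b : smooth (coords c setT) (fun u => T u k a b).
  have oc := @coordsT_open _ _ _ c.
  have st e : smooth (coords c setT) (fun u => \tr (conn_mx nabla c u e)).
    have s0 : smooth (coords c setT) (fun u => \sum_d nabla c u d e d).
      by apply: smooth_sum => // d; exact: (sG c Ac d e d).
    by apply: (eq_smooth _ _ s0) => // u _; rewrite trace_conn_mx.
  apply: (eq_smooth (f := fun u => nabla c u k a b + (- n.+1%:R^-1) *
     (\tr (conn_mx nabla c u a) * (k == b)%:R + \tr (conn_mx nabla c u b) * (k == a)%:R))) => //.
    by move=> u _; rewrite mulNr.
  apply: smoothD => //; first exact: (sG c Ac k a b).
  apply: smoothM => //; first exact: smooth_cst.
  by apply: smoothD => //; apply: smoothM => //; exact: smooth_cst.
(* Extensions of xi are chosen pointwise: as N is dense in Nbar, the first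
   derivatives of an extension at a boundary point do not depend on it. *)
have ext y : exists F : 'rV[R]_n -> 'rV[R]_n, coords c Nbar y ->
    exists U, [/\ open U, U y, smooth U F & forall v, coords c Nbar v -> U v -> F v = xi v].
  case: (pselect (coords c Nbar y)) => [cy|ny]; last by exists xi.
  by have [U [F H]] := sxi y cy; exists F => _; exists U.
have [X HX] := choice ext.
have pdX y U F k a : coords c Nbar y -> open U -> U y -> smooth U F ->
    (forall v, coords c Nbar v -> U v -> F v = xi v) ->
    pd a (fun v => X y v 0 k) y = pd a (fun v => F v 0 k) y.
  move=> cy oU Uy sF EF; have [U' [oU' U'y sX EX]] := HX y cy.
  apply: (@pd_unique_on_closure _ _ _ _ (U `&` U') (coords c N)) => //.
  - exact: openI.
  - apply: (@smooth_sub _ _ U') ((smooth_mxP (X y) oU').1 sX k) => v [] //.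
  - apply: (@smooth_sub _ _ U) ((smooth_mxP F oU).1 sF k) => v [] //.
  - by move=> W oW Wy; exact: (N_dense Ac cy oW Wy).
  - by move=> v [Uv U'v] /cNN cv; rewrite EX// EF.
(* Covariant differentiation of F along m with the regular symbols T; it makes sense on the boundary
   as well. *)
pose op (m : 'rV[R]_n) (F : 'rV[R]_n -> 'rV[R]_n) u : 'rV[R]_n :=
  \row_k \sum_a m 0 a * (pd a (fun v => F v 0 k) u + \sum_b T u k a b * F u 0 b).
exists (fun u => op (mu u) (X u) u).
  move=> y cy; have [U1 [F1 [oU1 U1y s1 E1]]] := smu y cy.
  have [U2 [F2 [oU2 U2y s2 E2]]] := sxi y cy.
  pose U := U1 `&` U2 `&` coords c setT.
  have oU : open U by apply: openI; [exact: openI|exact: coordsT_open].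
  exists U, (fun u => op (F1 u) F2 u); split=> //.
  - by split=> //; exact: coordsT cy.
  - apply/(smooth_mxP _ oU) => k.
    have s1' j : smooth U (fun u => F1 u 0 j).
      by apply: (@smooth_sub _ _ U1) ((smooth_mxP F1 oU1).1 s1 j) => v [[]].
    have s2' j : smooth U (fun u => F2 u 0 j).
      by apply: (@smooth_sub _ _ U2) ((smooth_mxP F2 oU2).1 s2 j) => v [[]].
    apply: (eq_smooth (f := fun u => \sum_a F1 u 0 a * (pd a (fun v => F2 v 0 k) u + \sum_b T u k a b * F2 u 0 b))) => //.
      by move=> u _; rewrite mxE.
    apply: smooth_sum => // a; apply: smoothM => //; apply: smoothD => //.
      exact: smooth_pd.
    apply: smooth_sum => // b; apply: smoothM => //.
    by apply: (@smooth_sub _ _ (coords c setT)) (sT k a b) => v [].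
  - move=> v cv [[U1v U2v] _]; apply/rowP => k; rewrite !mxE.
    have XE : X v v = F2 v.
      by have [U' [_ U'v _ EX]] := HX v cv; rewrite EX// E2.
    apply: eq_bigr => a _; rewrite E1// XE; congr (_ * (_ + _)).
    by apply/esym; exact: (pdX v U2 F2).
move=> u cu k; have cuT := cTN u cu; have cub := cNN u cu.
have D0 := N_D Ac cu.
have [U' [oU' U'u sX EX]] := HX u cub.
have XE : X u u = xi u by exact: EX.
have pdE a : pd a (fun v => X u v 0 k) u = pd a (fun v => xi v 0 k) u.
  apply: near_eq_derive; apply: (@eq_near_open R 'rV[R]_n R (U' `&` coords c N)) => //.
    exact: openI.
  by move=> v [U'v /cNN cv]; rewrite EX.
have Dr (w : 'rV[R]_n) : 'D_w (r c) u / (2 * r c u) =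
    - \sum_a w 0 a * (upsilon nabla zeta c u a + n.+1%:R^-1 * \tr (conn_mx nabla c u a)).
  rewrite (Ck1_derive _ (@coordsT_open _ _ _ c) (r_smooth Ac 1) cuT) mulr_suml -sumrN.
  apply: eq_bigr => a _; rewrite pd_r// /upsilon subrK /r -/D.
  have key (a1 b1 p z : R) : a1 != 0 -> b1 != 0 -> z * (a1 * p) / (2 * (a1 * b1)) = - (z * - (p / (2 * b1))).
    by move=> a0 b0; field; rewrite a0 b0.
  exact: key.
rewrite mxE XE !Dr.
set Y := upsilon nabla zeta c u.
pose t a := n.+1%:R^-1 * \tr (conn_mx nabla c u a).
have -> : \sum_a mu u 0 a * (pd a (fun v => X u v 0 k) u + \sum_b T u k a b * xi u 0 b) =
    \sum_a mu u 0 a * (pd a (fun v => xi v 0 k) u + \sum_b nabla c u k a b * xi u 0 b)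
    - (\sum_a mu u 0 a * t a) * xi u 0 k - (\sum_a xi u 0 a * t a) * mu u 0 k.
  have E a : \sum_b T u k a b * xi u 0 b = \sum_b nabla c u k a b * xi u 0 b
      - t a * xi u 0 k - (k == a)%:R * \sum_b xi u 0 b * t b.
    rewrite -[t a * _](_ : \sum_b t a * (k == b)%:R * xi u 0 b = _); last first.
      rewrite (bigD1 k)//= eqxx mulr1 big1 ?addr0// => b bk.
      by rewrite eq_sym (negbTE bk) mulr0 mul0r.
    rewrite mulr_sumr -!sumrB; apply: eq_bigr => b _; rewrite /T /t; ring.
  rewrite (eq_bigr (fun a => mu u 0 a * (pd a (fun v => xi v 0 k) u + \sum_b nabla c u k a b * xi u 0 b)
     - mu u 0 a * t a * xi u 0 k - mu u 0 a * (k == a)%:R * \sum_b xi u 0 b * t b)); last first.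
    by move=> a _; rewrite pdE E; ring.
  rewrite !sumrB -!mulr_suml; congr (_ - _).
  rewrite mulrC; congr (_ * _).
  rewrite (bigD1 k)//= eqxx mulr1 big1 ?addr0// => b bk.
  by rewrite eq_sym (negbTE bk) mulr0.
have -> : \sum_a mu u 0 a * (pd a (fun v => xi v 0 k) u + \sum_b G' c u k a b * xi u 0 b) =
    \sum_a mu u 0 a * (pd a (fun v => xi v 0 k) u + \sum_b nabla c u k a b * xi u 0 b)
    + (\sum_a mu u 0 a * Y a) * xi u 0 k + (\sum_a xi u 0 a * Y a) * mu u 0 k.
  have E a : \sum_b G' c u k a b * xi u 0 b = \sum_b nabla c u k a b * xi u 0 b
      + Y a * xi u 0 k + (k == a)%:R * \sum_b xi u 0 b * Y b.
    rewrite -[Y a * _](_ : \sum_b Y a * (k == b)%:R * xi u 0 b = _); last first.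
      rewrite (bigD1 k)//= eqxx mulr1 big1 ?addr0// => b bk.
      by rewrite eq_sym (negbTE bk) mulr0 mul0r.
    rewrite mulr_sumr -!big_split; apply: eq_bigr => b _.
    by rewrite /G' /projective_change -/Y /=; ring.
  rewrite (eq_bigr (fun a => mu u 0 a * (pd a (fun v => xi v 0 k) u + \sum_b nabla c u k a b * xi u 0 b)
     + mu u 0 a * Y a * xi u 0 k + mu u 0 a * (k == a)%:R * \sum_b xi u 0 b * Y b)); last first.
    by move=> a _; rewrite E; ring.
  rewrite !big_split /= -!mulr_suml; congr (_ + _).
  rewrite mulrC; congr (_ * _).
  rewrite (bigD1 k)//= eqxx mulr1 big1 ?addr0// => b bk.
  by rewrite eq_sym (negbTE bk) mulr0.
have S (w : 'rV[R]_n) : \sum_a w 0 a * (Y a + n.+1%:R^-1 * \tr (conn_mx nabla c u a)) =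
    \sum_a w 0 a * Y a + \sum_a w 0 a * t a.
  by rewrite -big_split /=; apply: eq_bigr => a _; rewrite mulrDr.
rewrite !S; ring.
Qed.

End DegeneracyLocus.

Section DefiniteForms.
Context {R : realType}.

Lemma neg_definite_bordered n (rho : R) (lam : 'rV[R]_n) (z : 'M[R]_n) :
  neg_definite (block_mx rho%:M lam lam^T z) -> neg_definite z.
Proof.
move=> H v v0; rewrite -(bordered_restrict rho lam); apply: H.
by rewrite row_mx_eq0 eqxx.
Qed.

Lemma neg_definite_unit n (S : 'M[R]_n) : neg_definite S -> S \in unitmx.
Proof.
move=> /pos_definiteN/pos_definite_unit.
by rewrite -scaleN1r unitmxZ// unitfE oppr_eq0 oner_eq0.
Qed.

Lemma neg_definite_inverse n (S T : 'M[R]_n) : S^T = S -> T *m S = 1%:M ->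
  neg_definite S -> neg_definite T.
Proof.
move=> Ss TS /pos_definiteN HS; apply/pos_definiteN.
apply: pos_definite_inverse HS; first by rewrite linearN /= Ss.
by rewrite mulmxN mulNmx opprK.
Qed.

Lemma neg_definiteZ n (S : 'M[R]_n) (k : R) : 0 < k -> neg_definite S -> neg_definite (k *: S).
Proof.
move=> k0 /pos_definiteN HS; apply/pos_definiteN; rewrite -scalerN.
exact: pos_definiteZ.
Qed.

End DefiniteForms.

Section InducedGeometry.
Context {R : realType} {n : nat} {M : topologicalType}.
Variables (A : set (chart R n M)) (P : set (@connection_field R n M))
  (nabla : @connection_field R n M) (zeta : @matrix_field R n M)
  (V : @density_field R n M).
Hypotheses (hM : smooth_manifold A) (hP : projective_structure A P)
  (hz : sym_bivector_density A (-2) zeta) (hnabla : P nabla)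
  (hm : metrizability A nabla zeta)
  (hV : density A (- n.+1%:R) V)
  (V0 : forall c u, A c -> coords c setT u -> 0 < V c u)
  (dV : forall c u, A c -> coords c setT u ->
       forall a, cov_density nabla (- n.+1%:R) V c u a = 0).
Implicit Types (c : chart R n M) (u : 'rV[R]_n) (x : M).

Let D := det_field zeta.
Let g := induced_metric zeta.

Lemma nabla_torsion_free : torsion_free_connection A setT nabla.
Proof. by have [_ H] := hP; have [] := H nabla hnabla. Qed.

Lemma induced_factor_gt0 c u : D c u != 0 ->
  0 < Num.sg (det_density zeta c u) * det_density zeta c u.
Proof.
move=> D0; rewrite sg_det_density -/D -normrEsg mulr_gt0// ?normr_gt0//.
by rewrite ltr0n fact_gt0.
Qed.

Lemma det_transition c c' x : A c -> A c' -> dom c x -> dom c' x ->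
  exists2 k, 0 < k & D c' (cmap c' x) = k * D c (cmap c x).
Proof.
move=> Ac Ac' dx dx'; have cu : coords c (dom c') (cmap c x) by exact: coords_dom.
exists (weight_factor 2 c c' (cmap c x)).
  exact: weight_factor_gt0 (jac_det_neq0 hV V0 Ac Ac' cu).
by rewrite -(det_trans hz hV V0 Ac Ac' cu) transE.
Qed.

Lemma rank_lt_det m (z : 'M[R]_m) : (\rank z < m)%N <-> \det z = 0.
Proof.
have E : (\rank z < m)%N = ~~ (z \in unitmx).
  by rewrite -row_free_unit /row_free ltn_neqAle rank_leq_row andbT.
by rewrite E unitmxE unitfE negbK; split=> /eqP.
Qed.

(** The locus refers to all charts at x; the transition factor of D lets a single chart decide. *)
Lemma degeneracy_det c x : A c -> dom c x ->
  degeneracy_locus A zeta x <-> D c (cmap c x) = 0.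
Proof.
move=> Ac dx; split=> [H|D0 c' Ac' dx']; apply/rank_lt_det; first exact: H.
by have [k _ E] := det_transition Ac Ac' dx dx'; rewrite -[LHS]/(D _ _) E D0 mulr0.
Qed.

Lemma induced_metric_inverse (N : set M) :
  (forall c u, A c -> coords c N u -> D c u != 0) ->
  inverse_metric_on A N g (induced_inverse_metric zeta).
Proof. by move=> DN c u Ac cu; apply: induced_metricK; exact: DN. Qed.

Lemma induced_connection_equiv (N : set M) G : P G ->
  proj_equiv A N G (projective_change nabla (upsilon nabla zeta)).
Proof.
move=> PG; have [_ H] := hP; have [_ HG] := H G PG.
have [_ E] := (HG nabla).1 hnabla.
apply: (proj_equiv_trans _ (@upsilon_proj_equiv _ _ _ A nabla zeta N)).
by apply: proj_equiv_sub E.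
Qed.

Lemma nondegenerate_case : (forall c x, A c -> dom c x -> D c (cmap c x) != 0) ->
  [/\ degeneracy_locus A zeta = set0, pseudo_metric A setT g,
     inverse_metric_on A setT g (induced_inverse_metric zeta)
     & exists2 G, P G & levi_civita A setT g G].
Proof.
move=> D0; have D0' c u : A c -> coords c setT u -> D c u != 0.
  by move=> Ac [x [dx _] <-]; exact: D0.
have lc := induced_levi_civita hM hz nabla_torsion_free hV V0 dV openT D0' hm.
split.
- apply/seteqP; split=> // x Dx; have [c Ac dx] := chart_at hM x.
  by have := D0 c x Ac dx; rewrite ((degeneracy_det Ac dx).1 Dx) eqxx.
- exact: (induced_metric_pseudo hz hV V0 openT D0').
- exact: induced_metric_inverse.
(* The change of connection is defined on all of M here. The class P contains every torsion-free
   connection equivalent to nabla, hence the Levi-Civita connection itself. *)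
- exists (projective_change nabla (upsilon nabla zeta)) => //.
  have [_ H] := hP; have [_ HG] := H nabla hnabla; apply/HG; split; first by case: lc.
  exact: upsilon_proj_equiv.
Qed.

(** * The strata in the indefinite case *)

Section Indefinite.
Variables (p q : nat).
Hypothesis hL : forall c x, A c -> dom c x ->
  signature (tractor_form nabla zeta c (cmap c x)) p.+1 q.+1 0.

Let Mp := signature_locus A zeta p.+1 q 0.
Let Mm := signature_locus A zeta p q.+1 0.
Let M0 := signature_locus A zeta p q 1.
(** The sign of det zeta for signature (p + 1, q); for (p, q + 1) it is the opposite one. *)
Let sgq : R := (-1) ^+ q.

Lemma sgq_neq0 : sgq != 0.
Proof. by rewrite expf_neq0// oppr_eq0 oner_eq0. Qed.

Lemma bordered_at c x : A c -> dom c x ->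
  let z := zeta c (cmap c x) in
  [/\ z^T = z, \det z = 0 -> signature z p q 1, 0 < sgq * \det z -> signature z p.+1 q 0
    & sgq * \det z < 0 -> signature z p q.+1 0].
Proof.
move=> Ac dx z; have cx : coords c setT (cmap c x) by exact: coords_dom.
have zs := zeta_sym hz Ac cx.
by have [_ h1 h2 h3] := signature_bordered zs (hL Ac dx).
Qed.

(** The sign of D in one chart fixes it in all charts at x, and in each of them the bordered form
    then determines the signature of zeta. *)
Lemma Mp_sign c x : A c -> dom c x -> Mp x <-> 0 < sgq * D c (cmap c x).
Proof.
move=> Ac dx; split=> [H|h c' Ac' dx'].
  by have [zs _ _ _] := bordered_at Ac dx; exact: signature_det_sign zs (H c Ac dx).
have [_ _ H _] := bordered_at Ac' dx'; apply: H.
have [k k0 E] := det_transition Ac Ac' dx dx'.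
by rewrite -/(det_field _ _ _) -/D E mulrCA mulr_gt0.
Qed.

Lemma Mm_sign c x : A c -> dom c x -> Mm x <-> sgq * D c (cmap c x) < 0.
Proof.
move=> Ac dx; split=> [H|h c' Ac' dx'].
  have [zs _ _ _] := bordered_at Ac dx; have := signature_det_sign zs (H c Ac dx).
  by rewrite exprS mulN1r mulNr oppr_gt0.
have [_ _ _ H] := bordered_at Ac' dx'; apply: H.
have [k k0 E] := det_transition Ac Ac' dx dx'.
by rewrite -/(det_field _ _ _) -/D E mulrCA pmulr_rlt0.
Qed.

Lemma M0_sign c x : A c -> dom c x -> M0 x <-> D c (cmap c x) = 0.
Proof.
move=> Ac dx; split=> [H|h c' Ac' dx'].
  have [zs _ _ _] := bordered_at Ac dx; apply/eqP.
  by rewrite (signature_det0 zs (H c Ac dx)).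
have [_ H _ _] := bordered_at Ac' dx'; apply: H.
have [k k0 E] := det_transition Ac Ac' dx dx'.
by rewrite -/(det_field _ _ _) -/D E h mulr0.
Qed.

Lemma M0_degeneracy : M0 = degeneracy_locus A zeta.
Proof.
apply/seteqP; split=> x; have [c Ac dx] := chart_at hM x.
  by move=> /(M0_sign Ac dx)/(degeneracy_det Ac dx).
by move=> /(degeneracy_det Ac dx)/(M0_sign Ac dx).
Qed.

Lemma notMm_sign c x : A c -> dom c x -> (~` Mm) x <-> 0 <= sgq * D c (cmap c x).
Proof.
move=> Ac dx; rewrite leNgt; split=> [h|/negP h] /=; first by apply/negP => /(Mm_sign Ac dx).
by move=> /(Mm_sign Ac dx).
Qed.

Lemma notMp_sign c x : A c -> dom c x -> (~` Mp) x <-> 0 <= (- sgq) * D c (cmap c x).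
Proof.
move=> Ac dx; rewrite mulNr oppr_ge0 leNgt; split=> [h|/negP h] /=.
  by apply/negP => /(Mp_sign Ac dx).
by move=> /(Mp_sign Ac dx).
Qed.

Lemma Mm_sign' c x : A c -> dom c x -> Mm x <-> 0 < (- sgq) * D c (cmap c x).
Proof. by move=> Ac dx; rewrite mulNr oppr_gt0; exact: Mm_sign. Qed.

Lemma tractor_det c u : A c -> coords c setT u -> \det (tractor_form nabla zeta c u) != 0.
Proof.
move=> Ac cu; have [x [dx _] xu] := cu; have := hL Ac dx; rewrite xu => sL.
by rewrite (signature_det0 (tr_bordered _ _ (zeta_sym hz Ac cu)) sL).
Qed.

Lemma strata_disjoint : [/\ Mp `|` M0 `|` Mm = setT, Mp `&` M0 = set0, M0 `&` Mm = set0
  & Mp `&` Mm = set0].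
Proof.
split; apply/seteqP; split=> // x; have [c Ac dx] := chart_at hM x.
- move=> _; have [h|h|h] := ltgtP 0 (sgq * D c (cmap c x)).
  + by left; left; apply/(Mp_sign Ac dx).
  + by right; apply/(Mm_sign Ac dx).
  + left; right; apply/(M0_sign Ac dx)/eqP.
    by move/esym/eqP: h; rewrite mulf_eq0 (negbTE sgq_neq0).
- by move=> [/(Mp_sign Ac dx) h /(M0_sign Ac dx) E]; move: h; rewrite E mulr0 ltxx.
- by move=> [/(M0_sign Ac dx) E /(Mm_sign Ac dx) h]; move: h; rewrite E mulr0 ltxx.
- by move=> [/(Mp_sign Ac dx) h /(Mm_sign Ac dx)] /(lt_trans h); rewrite ltxx.
Qed.

Lemma strata_separated : separates A Mm (degeneracy_locus A zeta) Mp.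
Proof.
have oc c := @coordsT_open _ _ _ c.
exists 2, (fun c u => sgq * D c u); split.
  have [h1 h2] := det_density_field hz hV V0; split.
    by move=> c Ac; apply: smoothM; [exact: oc|exact: smooth_cst|exact: (h1 c Ac)].
  by move=> c c' u Ac Ac' cu; rewrite /D h2// mulrCA.
move=> c x Ac dx; have cx : coords c setT (cmap c x) by exact: coords_dom.
split.
- exact: Mm_sign.
- rewrite (degeneracy_det Ac dx); split=> [->|/eqP]; first by rewrite mulr0.
  by rewrite mulf_eq0 (negbTE sgq_neq0) => /eqP.
- exact: Mp_sign.
- move=> /(degeneracy_det Ac dx) D0.
  have [i pi0] := degenerate_submersion hz hm tractor_det Ac cx D0.
  by exists i; rewrite (pd_r hz)// mulf_neq0// sgq_neq0.
Qed.

(** The conormal of the slice is the radical of zeta, so deleting row and column i gives zeta on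
    T*M0, which is nondegenerate. The weight of zeta makes the inverse a metric up to positive scale
    only. *)
Let h c i u : 'M[R]_n.-1 := invmx (row' i (col' i (zeta c u))).

Lemma slice_coords c i u : slice_chart A M0 c i -> coords c M0 u ->
  [/\ (zeta c u)^T = zeta c u, row i (zeta c u) = 0 &
    signature (row' i (col' i (zeta c u))) p q 0].
Proof.
move=> Hs cu; have [Ac _] := Hs; have zs := zeta_sym hz Ac (coordsT cu).
have zi := slice_row hz hm tractor_det M0_sign Hs cu; split=> //.
apply: signature_drop => //; have [x [dx M0x] <-] := cu; exact: M0x.
Qed.

Lemma slice_unit c i u : slice_chart A M0 c i -> coords c M0 u ->
  row' i (col' i (zeta c u)) \in unitmx.
Proof.
move=> Hs cu; have [zs _ sz] := slice_coords Hs cu.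
have zs' : (row' i (col' i (zeta c u)))^T = row' i (col' i (zeta c u)).
  by apply/matrixP => a b; rewrite !mxE -[in LHS]zs mxE.
by rewrite unitmxE unitfE (signature_det0 zs' sz).
Qed.

Lemma boundary_conformal : conformal_structure A M0 p q h.
Proof.
split.
- move=> c i Hs a b u cu; have [Ac _] := Hs; have oc := @coordsT_open _ _ _ c.
  pose f v := \det (row' i (col' i (zeta c v))).
  have sz a' b' : smooth (coords c setT) (fun v => row' i (col' i (zeta c v)) a' b').
    apply: (eq_smooth _ _ (zeta_smooth hz (lift i a') (lift i b') Ac)) => // v _.
    by rewrite !mxE.
  have sf : smooth (coords c setT) f by move=> k; apply: Ck_det => // a' b'; exact: sz.
  have sf2 : smooth (coords c setT) (fun v => f v * f v) by exact: smoothM.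
  have fu : f u != 0 by have := slice_unit Hs cu; rewrite unitmxE unitfE.
  (* The formula for h is its own local extension: the block stays invertible where f does not
     vanish, although off M0 it has no invariant meaning. *)
  exists (coords c setT `&` [set v | 0 < f v * f v]), (fun v => h c i v a b).
  have oU : open (coords c setT `&` [set v | 0 < f v * f v]).
    by apply: open_pos => // v cv; exact: (Ck_cont (sf2 0) cv).
  split=> //.
  + by split; [exact: coordsT cu|rewrite /= -expr2 lt_neqAle sqr_ge0 eq_sym sqrf_eq0 fu].
  + move=> k; apply: Ck_invmx => //.
      move=> v [_ /= fv]; rewrite unitmxE unitfE; apply: contraTneq fv => E.
      by rewrite /f E mulr0 ltxx.
    by move=> a' b'; apply: Ck_sub (sz a' b' k) => v [].
- move=> c i Hs u cu; have [zs _ sz] := slice_coords Hs cu; have zu := slice_unit Hs cu.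
  have zs' : (row' i (col' i (zeta c u)))^T = row' i (col' i (zeta c u)).
    by apply/matrixP => a b; rewrite !mxE -[in LHS]zs mxE.
  split; first by rewrite /h trmx_inv zs'.
  by apply: signature_inverse zs' _ sz; rewrite mulVmx.
- move=> c i c' i' Hs Hs' u cu T; have [Ac _] := Hs; have [Ac' _] := Hs'.
  have cu1 : coords c (dom c') u by apply: coords_sub cu => x [].
  have cu2 : coords c M0 u by apply: coords_sub cu => x [].
  have cu' : coords c' M0 (trans c c' u).
    by have := trans_coords cu; apply: coords_sub => x [].
  have [zs zi _] := slice_coords Hs cu2.
  have zu := slice_unit Hs cu2; have z'u := slice_unit Hs' cu'.
  have k0 : 0 < weight_factor (-2) c c' u.
    exact: weight_factor_gt0 (jac_det_neq0 hV V0 Ac Ac' cu1).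
  (* The conformal factor is the transition factor of the weight of zeta; inverting E moves it to
     the other side. *)
  exists (weight_factor (-2) c c' u) => //.
  have E : row' i' (col' i' (zeta c' (trans c c' u))) =
      weight_factor (-2) c c' u *: (T^T *m row' i (col' i (zeta c u)) *m T).
    rewrite (zeta_trans hz Ac Ac' cu1); set J := jac c c' u; set z := zeta c u.
    have -> : row' i' (col' i' (weight_factor (-2) c c' u *: (J^T *m z *m J))) =
        weight_factor (-2) c c' u *: ((col' i' J)^T *m z *m (col' i' J)^T^T).
      rewrite trmxK; apply/matrixP => a b; rewrite !mxE; congr (_ * _).
      apply: eq_bigr => j _; rewrite !mxE; congr (_ * _).
      by apply: eq_bigr => l _; rewrite !mxE.
    rewrite (sandwich_drop _ zs zi) /T; congr (_ *: (_ *m _ *m _)).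
    + by apply/matrixP => a b; rewrite !mxE.
    + by apply/matrixP => a b; rewrite !mxE.
  rewrite /h; set k := weight_factor _ _ _ _ in E k0 *.
  set S := row' i (col' i _) in E zu *; set S' := row' i' (col' i' _) in E z'u *.
  have E1 : T^T *m (S *m (k *: (T *m invmx S'))) = 1%:M.
    by rewrite -!scalemxAr !mulmxA scalemxAl -E mulmxV.
  have E2 : S *m (k *: (T *m invmx S' *m T^T)) = 1%:M.
    by rewrite scalemxAl mulmxA; exact: mulmx1C E1.
  by rewrite -[LHS]mulmx1 -E2 mulKmx.
Qed.

Lemma boundary_conformal_induced : conformal_structure_induced_by A M0 zeta h.
Proof.
move=> c i Hs u cu; have [zs zi _] := slice_coords Hs cu; split=> //.
by exists 1 => //; rewrite /h mulVmx ?(slice_unit Hs cu).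
Qed.

(** The factor sgn(tau) tau is positive, so the inverse metric has the signature of zeta, and
    inversion preserves it. *)
Lemma side_metric (N : set M) (p' q' : nat) :
  open N -> (forall c u, A c -> coords c N u -> D c u != 0) ->
  (forall x, N x -> signature_locus A zeta p' q' 0 x) ->
  [/\ pseudo_metric A N g,
     (forall c x, A c -> dom c x -> N x -> signature (g c (cmap c x)) p' q' 0)
     & inverse_metric_on A N g (induced_inverse_metric zeta)].
Proof.
move=> oN DN HN; split.
- exact: (induced_metric_pseudo hz hV V0 oN DN).
- move=> c x Ac dx Nx; have cx : coords c N (cmap c x) by exact: coords_dom.
  have hs := induced_sym hz Ac (coordsT cx).
  apply: (signature_inverse hs (induced_metricK (DN c _ Ac cx))).
  have zs := zeta_sym hz Ac (coordsT cx).
  exact: (signatureZ zs (induced_factor_gt0 (DN c _ Ac cx)) (HN x Nx c Ac dx)).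
- exact: induced_metric_inverse.
Qed.

Lemma side_compactification (eps : R) (N Nbar : set M) : eps != 0 ->
  (forall c x, A c -> dom c x -> N x <-> 0 < eps * D c (cmap c x)) ->
  (forall c x, A c -> dom c x -> Nbar x <-> 0 <= eps * D c (cmap c x)) ->
  compact Nbar -> projective_compactification A 2 P Nbar N M0 g.
Proof.
move=> e0 HN HNb cN; have oN := N_open hM hz HN.
have DN := N_D HN; split=> //.
  exact: (boundary_domain hM hz hm tractor_det e0 HN HNb M0_sign).
exists (projective_change nabla (upsilon nabla zeta)); split.
- exact: (induced_levi_civita hM hz nabla_torsion_free hV V0 dV oN DN hm).
- by move=> G PG; exact: induced_connection_equiv.
- exact: (projectively_compact_B hM hz hm nabla_torsion_free tractor_det e0 HN HNb M0_sign).
Qed.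

End Indefinite.

End InducedGeometry.

Theorem theorem1p1 (R : realType) (n : nat) (hn : (2 <= n)%N)
    (M : topologicalType) (A : set (chart R n M)) (hM : smooth_manifold A)
    (P : set (@connection_field R n M)) (hP : projective_structure A P)
    (zeta : @matrix_field R n M) (hzeta : sym_bivector_density A (-2) zeta)
    (nabla : @connection_field R n M) (hnabla : P nabla)
    (hspecial : special A nabla)
    (hmetrizability : metrizability A nabla zeta)
    (hrank : forall c x, A c -> dom c x ->
       \rank (tractor_form nabla zeta c (cmap c x)) = n.+1) :
  (* L(zeta) positive, respectively negative, definite *)
  ((forall c x, A c -> dom c x ->
      pos_definite (tractor_form nabla zeta c (cmap c x))) ->
   degeneracy_locus A zeta = set0 /\
   exists g, [/\ pseudo_metric A setT g,
     (forall c x, A c -> dom c x -> pos_definite (g c (cmap c x))),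
     inverse_metric_on A setT g (induced_inverse_metric zeta)
     & exists2 G, P G & levi_civita A setT g G])
  /\
  ((forall c x, A c -> dom c x ->
      neg_definite (tractor_form nabla zeta c (cmap c x))) ->
   degeneracy_locus A zeta = set0 /\
   exists g, [/\ pseudo_metric A setT g,
     (forall c x, A c -> dom c x -> neg_definite (g c (cmap c x))),
     inverse_metric_on A setT g (induced_inverse_metric zeta)
     & exists2 G, P G & levi_civita A setT g G])
  /\
  (* L(zeta) of signature (p+1,q+1) *)
  (forall p q : nat,
   (forall c x, A c -> dom c x ->
      signature (tractor_form nabla zeta c (cmap c x)) p.+1 q.+1 0) ->
   let Mp := signature_locus A zeta p.+1 q 0 in
   let Mm := signature_locus A zeta p q.+1 0 in
   let M0 := signature_locus A zeta p q 1 in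
   degeneracy_locus A zeta = set0 \/
   [/\ embedded_hypersurface A (degeneracy_locus A zeta),
       separates A Mm (degeneracy_locus A zeta) Mp,
       (* (i) *)
       [/\ Mp `|` M0 `|` Mm = setT, Mp `&` M0 = set0, M0 `&` Mm = set0,
           Mp `&` Mm = set0 & M0 = degeneracy_locus A zeta],
       (* (ii) *)
       (exists h, conformal_structure A M0 p q h /\
                  conformal_structure_induced_by A M0 zeta h)
     & (* (iii), (iv) *)
       exists gp gm,
       [/\ pseudo_metric A Mp gp /\
           (forall c x, A c -> dom c x -> Mp x ->
              signature (gp c (cmap c x)) p.+1 q 0),
           pseudo_metric A Mm gm /\
           (forall c x, A c -> dom c x -> Mm x ->
              signature (gm c (cmap c x)) p q.+1 0),
           inverse_metric_on A Mp gp (induced_inverse_metric zeta),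
           inverse_metric_on A Mm gm (induced_inverse_metric zeta)
         & compact [set: M] ->
           projective_compactification A 2 P (~` Mm) Mp M0 gp /\
           projective_compactification A 2 P (~` Mp) Mm M0 gm]]).
Proof.
have [V [hV V0 dV]] := hspecial.
split; [|split].
- move=> hpos; have zpos c x : A c -> dom c x -> pos_definite (zeta c (cmap c x)).
    by move=> Ac dx; exact: pos_definite_bordered (hpos c x Ac dx).
  have D0 c x : A c -> dom c x -> det_field zeta c (cmap c x) != 0.
    by move=> Ac dx; have := pos_definite_unit (zpos c x Ac dx); rewrite unitmxE unitfE.
  have [h1 h2 h3 h4] := nondegenerate_case hM hP hzeta hnabla hmetrizability hV V0 dV D0.
  split=> //; exists (induced_metric zeta); split=> // c x Ac dx.
  have cx : coords c setT (cmap c x) by exact: coords_dom.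
  apply: (pos_definite_inverse (induced_sym hzeta Ac cx) (induced_metricK (D0 c x Ac dx))).
  exact: pos_definiteZ (induced_factor_gt0 (D0 c x Ac dx)) (zpos c x Ac dx).
- move=> hneg; have zneg c x : A c -> dom c x -> neg_definite (zeta c (cmap c x)).
    by move=> Ac dx; exact: neg_definite_bordered (hneg c x Ac dx).
  have D0 c x : A c -> dom c x -> det_field zeta c (cmap c x) != 0.
    by move=> Ac dx; have := neg_definite_unit (zneg c x Ac dx); rewrite unitmxE unitfE.
  have [h1 h2 h3 h4] := nondegenerate_case hM hP hzeta hnabla hmetrizability hV V0 dV D0.
  split=> //; exists (induced_metric zeta); split=> // c x Ac dx.
  have cx : coords c setT (cmap c x) by exact: coords_dom.
  apply: (neg_definite_inverse (induced_sym hzeta Ac cx) (induced_metricK (D0 c x Ac dx))).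
  exact: neg_definiteZ (induced_factor_gt0 (D0 c x Ac dx)) (zneg c x Ac dx).
(* The second alternative is established for an empty locus too, where its clauses about the points
   of [M0] hold vacuously. *)
- move=> p q hL Mp Mm M0; right.
  have sp := Mp_sign hzeta hV V0 hL; have sm := Mm_sign hzeta hV V0 hL.
  have sm' := Mm_sign' hzeta hV V0 hL; have s0 := M0_sign hzeta hV V0 hL.
  have np := notMp_sign hzeta hV V0 hL; have nm := notMm_sign hzeta hV V0 hL.
  have e0 := @sgq_neq0 R q; have e0' : - (-1) ^+ q != 0 :> R by rewrite oppr_eq0.
  have tdet := tractor_det hzeta hL.
  have E0 := M0_degeneracy hM hzeta hV V0 hL.
  have oMp := N_open hM hzeta sp; have oMm := N_open hM hzeta sm'.
  have [h1 h2 h3 h4] := strata_disjoint hM hzeta hV V0 hL.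
  have [gp1 gp2 gp3] := side_metric hzeta hV V0 oMp (N_D sp) (fun x Mx => Mx).
  have [gm1 gm2 gm3] := side_metric hzeta hV V0 oMm (N_D sm') (fun x Mx => Mx).
  split.
  + rewrite -E0; exact: (hypersurface_B hM hzeta hmetrizability tdet e0 sp nm s0).
  + exact: (strata_separated hzeta hmetrizability hV V0 hL).
  + by [].
  + exists (fun c i u => invmx (row' i (col' i (zeta c u)))); split.
      exact: (boundary_conformal hzeta hmetrizability hV V0 hL).
    exact: (boundary_conformal_induced hzeta hmetrizability hV V0 hL).
  + exists (induced_metric zeta), (induced_metric zeta); split=> //.
    move=> cM; have cl (N : set M) : open N -> compact (~` N).
      by move=> oN; exact: (subclosed_compact (open_closedC oN) cM (fun _ _ => I)).
    split.
    * by apply: (side_compactification hM hP hzeta hnabla hmetrizability hV V0 dV hL e0 sp nm); exact: cl.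
    * by apply: (side_compactification hM hP hzeta hnabla hmetrizability hV V0 dV hL e0' sm' np); exact: cl.
Qed.
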